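(* Let $\rho$ be a conformal metric on a domain $D\subset\mathbf{C}$, let $\omega\in D$ and $r>0$, and let $\gamma$ be a geodesic line contained in a geodesic disk $D_\rho(\omega,r)\subset D$ with $\omega\in\gamma$. Let $f:\mathbf{U}\to\gamma$ be a $\rho$-harmonic mapping with $f(0)=\omega$. Then for all $z,z_1,z_2\in\mathbf{U}$, $$d_\rho(f(z),f(0))\le \frac{4r}{\pi}\arctan|z|,$$ $$\rho(f(z))\,|Df(z)|\le \frac{4r}{\pi}\,\frac{1}{1-|z|^2},$$ $$d_\rho(f(z_1),f(z_2))\le \frac{4r}{\pi}\,d_h(z_1,z_2).$$ Moreover these inequalities are sharp: in each of them the constant $4/\pi$ cannot be replaced by a smaller constant valid for all such $D,\rho,\omega,r,\gamma,f$.
   Context: $\mathbf{U}=\{z\in\mathbf{C}:|z|<1\}$ is the unit disk. A conformal metric on a domain $D\subset\mathbf{C}$ is a positive function $\rho\in C^1(D)$; the $\rho$-length of a curve $\Gamma\subset D$ is $\int_\Gamma\rho(w)\,|dw|$, and $d_\rho(w_1,w_2)$ is the infimum of $\rho$-lengths of curves in $D$ joining $w_1$ and $w_2$. The geodesic disk is $D_\rho(\omega,r)=\{w\in D: d_\rho(w,\omega)<r\}$. A geodesic line is a smooth arc $\gamma\subset D$ such that for any two points $w_1,w_2\in\gamma$, $d_\rho(w_1,w_2)$ equals the $\rho$-length of the part of $\gamma$ between $w_1$ and $w_2$. For a domain $\Omega\subset\mathbf{C}$, a $C^2$ mapping $f:\Omega\to D$ is called $\rho$-harmonic if $$f_{z\bar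 z}+\big((\partial_w\log\rho^2)\circ f\big)\, f_z f_{\bar z}=0\quad\text{in }\Omega,$$ where $f_z,f_{\bar z}$ are the Wirtinger derivatives. A mapping $f:\mathbf{U}\to\gamma$ is $\rho$-harmonic if it is so as a mapping into $D$. $|Df(z)|$ is the operator norm of the real differential of $f$ at $z$, i.e. $|Df(z)|=|f_z(z)|+|f_{\bar z}(z)|$. The hyperbolic distance on $\mathbf{U}$ is $d_h(z,w)=\tanh^{-1}\left|\frac{z-w}{1-\bar z w}\right|$. *)

(* Defs.v *)
From Stdlib Require Import Reals.
From Coquelicot Require Import Coquelicot.
Open Scope R_scope.

(** Subsets of [C] are predicates.  Functions on a subset of [C] are total; every
    notion below only depends on their values on the subset concerned. *)

Definition unit_disk (z : C) : Prop := Cmod z < 1.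

Definition domain (D : C -> Prop) : Prop :=
  open D /\
  (exists w, D w) /\
  (forall A B : C -> Prop, open A -> open B ->
     (forall w, D w -> A w \/ B w) ->
     (exists w, D w /\ A w) -> (exists w, D w /\ B w) ->
     exists w, D w /\ A w /\ B w).

Definition Dx (u : C -> R) (z : C) : R := Derive (fun t => u (t, Im z)) (Re z).
Definition Dy (u : C -> R) (z : C) : R := Derive (fun t => u (Re z, t)) (Im z).

(** Meant for open [W]. *)
Definition C1_on (W : C -> Prop) (u : C -> R) : Prop :=
  forall z, W z ->
    ex_derive (fun t => u (t, Im z)) (Re z) /\
    ex_derive (fun t => u (Re z, t)) (Im z) /\
    continuous (Dx u) z /\ continuous (Dy u) z.

Definition C2_on (W : C -> Prop) (u : C -> R) : Prop :=
  C1_on W u /\ C1_on W (Dx u) /\ C1_on W (Dy u).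

Definition C2_map_on (W : C -> Prop) (f : C -> C) : Prop :=
  C2_on W (fun z => Re (f z)) /\ C2_on W (fun z => Im (f z)).

Definition CDx (f : C -> C) (z : C) : C :=
  (Dx (fun w => Re (f w)) z, Dx (fun w => Im (f w)) z).
Definition CDy (f : C -> C) (z : C) : C :=
  (Dy (fun w => Re (f w)) z, Dy (fun w => Im (f w)) z).

Definition wirtinger (f : C -> C) (z : C) : C :=
  ((CDx f z - Ci * CDy f z) / RtoC 2)%C.
Definition wirtinger_bar (f : C -> C) (z : C) : C :=
  ((CDx f z + Ci * CDy f z) / RtoC 2)%C.

Definition differential (f : C -> C) (z h : C) : C :=
  (RtoC (Re h) * CDx f z + RtoC (Im h) * CDy f z)%C.

Definition operator_norm (L : C -> C) : R :=
  real (Lub_Rbar (fun s => exists h, Cmod h <= 1 /\ s = Cmod (L h))).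

Definition conformal_metric (D : C -> Prop) (rho : C -> R) : Prop :=
  (forall w, D w -> 0 < rho w) /\ C1_on D rho.

(** [g] is continuously differentiable on the interval [I], with derivative [g'];
    derivatives are taken within [I], hence one-sided at an endpoint in [I]. *)
Definition C1_path (I : R -> Prop) (g g' : R -> C) : Prop :=
  forall t, I t ->
    filterlim (fun s => ((g s - g t) / RtoC (s - t))%C)
      (within I (locally' t)) (locally (g' t)) /\
    filterlim g' (within I (locally t)) (locally (g' t)).

Definition rho_length (rho : C -> R) (g g' : R -> C) (a b : R) : R :=
  RInt (fun t => rho (g t) * Cmod (g' t)) a b.

(** [curve_length D rho w1 w2 l]: some piecewise [C^1] curve in [D], i.e. a finite
    concatenation of [C^1] paths, leads from [w1] to [w2] and has [rho]-length [l]. *)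
Inductive curve_length (D : C -> Prop) (rho : C -> R) : C -> C -> R -> Prop :=
| curve_piece : forall (g g' : R -> C) (a b : R),
    a < b ->
    C1_path (fun t => a <= t <= b) g g' ->
    (forall t, a <= t <= b -> D (g t)) ->
    curve_length D rho (g a) (g b) (rho_length rho g g' a b)
| curve_concat : forall (w1 w2 w3 : C) (l1 l2 : R),
    curve_length D rho w1 w2 l1 ->
    curve_length D rho w2 w3 l2 ->
    curve_length D rho w1 w3 (l1 + l2).

Definition rho_dist (D : C -> Prop) (rho : C -> R) (w1 w2 : C) : R :=
  real (Glb_Rbar (curve_length D rho w1 w2)).

Definition geodesic_disk (D : C -> Prop) (rho : C -> R) (omega : C) (r : R)
    (w : C) : Prop :=
  D w /\ rho_dist D rho w omega < r.

(** A smooth arc is the image of a nondegenerate interval (containing its endpoints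
    or not, bounded or not) under an injective regular [C^1] path. *)
Definition geodesic_line (D : C -> Prop) (rho : C -> R) (gamma : C -> Prop) : Prop :=
  exists (I : R -> Prop) (g g' : R -> C),
    is_connected I /\
    (exists s t, I s /\ I t /\ s < t) /\
    C1_path I g g' /\
    (forall t, I t -> g' t <> RtoC 0) /\
    (forall s t, I s -> I t -> g s = g t -> s = t) /\
    (forall w, gamma w <-> exists t, I t /\ g t = w) /\
    (forall w, gamma w -> D w) /\
    (forall s t, I s -> I t -> s <= t ->
       rho_dist D rho (g s) (g t) = rho_length rho g g' s t).

Definition rho_harmonic (D : C -> Prop) (rho : C -> R) (W : C -> Prop)
    (f : C -> C) : Prop :=
  (forall z, W z -> D (f z)) /\
  C2_map_on W f /\
  (forall z, W z ->
     (wirtinger_bar (wirtinger f) z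
      + wirtinger (fun w => RtoC (ln (rho w ^ 2))) (f z)
        * wirtinger f z * wirtinger_bar f z)%C = RtoC 0).

Definition artanh (x : R) : R := ln ((1 + x) / (1 - x)) / 2.

Definition hyperbolic_dist (z w : C) : R :=
  artanh (Cmod ((z - w) / (RtoC 1 - Cconj z * w))%C).

Record harmonic_into_geodesic (D : C -> Prop) (rho : C -> R) (omega : C) (r : R)
    (gamma : C -> Prop) (f : C -> C) : Prop := {
  hig_domain : domain D;
  hig_metric : conformal_metric D rho;
  hig_center : D omega;
  hig_radius : 0 < r;
  hig_line : geodesic_line D rho gamma;
  hig_in_disk : forall w, gamma w -> geodesic_disk D rho omega r w;
  hig_center_on_line : gamma omega;
  hig_values : forall z, unit_disk z -> gamma (f z);
  hig_harmonic : rho_harmonic D rho unit_disk f;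
  hig_origin : f (RtoC 0) = omega
}.

Definition growth_estimate (c : R) (D : C -> Prop) (rho : C -> R) (r : R)
    (f : C -> C) : Prop :=
  forall z, unit_disk z ->
    rho_dist D rho (f z) (f (RtoC 0)) <= c * r * atan (Cmod z).

Definition gradient_estimate (c : R) (rho : C -> R) (r : R) (f : C -> C) : Prop :=
  forall z, unit_disk z ->
    rho (f z) * operator_norm (differential f z) <= c * r * (1 / (1 - Cmod z ^ 2)).

Definition distance_estimate (c : R) (D : C -> Prop) (rho : C -> R) (r : R)
    (f : C -> C) : Prop :=
  forall z1 z2, unit_disk z1 -> unit_disk z2 ->
    rho_dist D rho (f z1) (f z2) <= c * r * hyperbolic_dist z1 z2.

(* Main.v *)
Require Import Defs.
From Stdlib Require Import Reals Lra Psatz ClassicalEpsilon.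
From Coquelicot Require Import Coquelicot.
Open Scope R_scope.

(* Let [u] be the signed arclength along the geodesic, measured from [omega], of the point
   [f z].  Minimality of the geodesic [g] gives its Euler-Lagrange equation: the covector
   [rho g' / |g'|] is differentiable, with derivative [(grad rho) |g'|].  Hence [u] inherits
   C^2 regularity from [f], with [grad u = rho < g' / |g'|, D f >], and the harmonic map
   equation becomes [Laplacian u = 0].  As [d_rho (f z, f w) = |u z - u w|] and [|u| < r], what
   remains is the Schwarz-Pick inequality
   [(1 - |z|^2) |grad u| <= (4 r / pi) cos (pi u / (2 r))] for real harmonic functions.  By
   Moebius invariance it suffices to prove it at [0], where the mean and the first Fourier
   mode of [u] on circles give [u (0)] and [grad u (0)].  Integrating it along radii, with
   [artanh (sin (pi u / (2 r))) / 2] as unknown, yields the growth and distance estimates.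
   The map [(4 / pi) Re (arctan z)] into [(-1, 1)] shows that [4 / pi] is sharp. *)

(** * Harmonic functions *)

(** The metric is only C^1 and the geodesic is only a C^1 arc, so the geodesic equation cannot be
    written with second derivatives of [g]. It is obtained in integrated form, and differentiability
    of the covector is a conclusion drawn from it. Nor is the parameter of [f z] on the arc known to
    depend continuously on [z]. What is known is that [d_rho] is locally at most a multiple of the
    Euclidean distance, while along the geodesic it is the difference of arclengths: points of the
    line that are close in the plane are close along the line. For this reason arclength, and not
    the given parameter, is the variable of differentiation. The constant [4 / pi] is the integral
    [4] of [|cos|] over a period, divided by the [pi] that normalises the first Fourier mode. The
    factor [cos (pi u / (2 r))] is essential for the growth estimate: the plain gradient bound
    integrates to [artanh |z|], which is unbounded, instead of [arctan |z|]. *)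

Definition grad_on (W : C -> Prop) (u ux uy : C -> R) : Prop :=
  forall x y, W (x, y) ->
    is_derive (fun t => u (t, y)) x (ux (x, y)) /\
    is_derive (fun t => u (x, t)) y (uy (x, y)) /\
    continuous ux (x, y) /\ continuous uy (x, y).

(** [uxy] and [uyx] are kept as separate functions: in the changes of variables below, the
    contributions of each of them to the Laplacian cancel on their own. *)
Definition harmonic_on (W : C -> Prop) (u ux uy : C -> R) : Prop :=
  grad_on W u ux uy /\
  exists uxx uxy uyx uyy : C -> R,
    grad_on W ux uxx uxy /\ grad_on W uy uyx uyy /\
    forall z, W z -> uxx z + uyy z = 0.

Lemma continuous_fst_C (z : C) : continuous (fun w : C => fst w) z.
Proof. apply (continuous_fst (U := R_UniformSpace) (V := R_UniformSpace)). Qed.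

Lemma continuous_snd_C (z : C) : continuous (fun w : C => snd w) z.
Proof. apply (continuous_snd (U := R_UniformSpace) (V := R_UniformSpace)). Qed.

Lemma continuous_pair_C (T : UniformSpace) (f g : T -> R) (x : T) :
  continuous f x -> continuous g x -> continuous (fun t => (f t, g t) : C) x.
Proof.
  intros Hf Hg.
  apply (continuous_comp_2 f g (fun a b => (a, b) : C)); auto.
  apply continuous_ext with (f := fun z : C => z).
  - intros [a b]; reflexivity.
  - apply continuous_id.
Qed.

(** Continuity of the partial derivatives gives total differentiability, on which every chain rule
    below rests. *)
Lemma grad_on_differentiable (W : C -> Prop) (u ux uy : C -> R) (x y : R) :
  open W -> grad_on W u ux uy -> W (x, y) ->
  differentiable_pt_lim (fun a b => u (a, b)) x y (ux (x, y)) (uy (x, y)).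
Proof.
  intros HW Hu Hz.
  apply filterdiff_differentiable_pt_lim.
  apply filterdiff_ext_lin with
    (fun v : R * R => plus (scal (fst v) (ux (x, y))) (scal (snd v) (uy (x, y)))).
  2:{ intros [a b]; unfold plus, scal; simpl; unfold mult; simpl; ring. }
  apply (is_derive_filterdiff (fun a b => u (a, b)) x y (fun a b => ux (a, b))).
  - generalize (HW (x, y) Hz).
    apply filter_imp; intros [a b] Hab; apply (Hu a b Hab).
  - apply (Hu x y Hz).
  - apply continuous_ext with (f := ux).
    + intros [a b]; reflexivity.
    + apply (Hu x y Hz).
Qed.

Lemma grad_on_chain (W : C -> Prop) (u ux uy : C -> R) (X Y : R -> R) (t X' Y' : R) :
  open W -> grad_on W u ux uy -> W (X t, Y t) ->
  is_derive X t X' -> is_derive Y t Y' ->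
  is_derive (fun s => u (X s, Y s)) t (ux (X t, Y t) * X' + uy (X t, Y t) * Y').
Proof.
  intros HW Hu Hz HX HY.
  apply is_derive_Reals.
  apply (derivable_pt_lim_comp_2d (fun a b => u (a, b)) X Y).
  - now apply grad_on_differentiable with W.
  - now apply is_derive_Reals.
  - now apply is_derive_Reals.
Qed.

Lemma grad_on_continuous (W : C -> Prop) (u ux uy : C -> R) (z : C) :
  open W -> grad_on W u ux uy -> W z -> continuous u z.
Proof.
  destruct z as [x y]; intros HW Hu Hz.
  pose proof (grad_on_differentiable W u ux uy x y HW Hu Hz) as Hd.
  assert (Hc : continuity_2d_pt (fun a b => u (a, b)) x y).
  { apply differentiable_continuity_pt. now exists (ux (x, y)), (uy (x, y)). }
  apply continuity_2d_pt_filterlim in Hc.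
  apply continuous_ext with (f := fun z : C => u (fst z, snd z)).
  - now intros [a b].
  - exact Hc.
Qed.

(** Serves to bring the gradients produced by the rules for sums, products and compositions into the
    wanted closed form. *)
Lemma grad_on_ext (W : C -> Prop) (u u' ux uy ux' uy' : C -> R) :
  open W -> (forall z, W z -> u z = u' z) ->
  (forall z, W z -> ux z = ux' z) -> (forall z, W z -> uy z = uy' z) ->
  grad_on W u ux uy -> grad_on W u' ux' uy'.
Proof.
  intros HW E E1 E2 Hu x y Hz.
  destruct (Hu x y Hz) as (H1 & H2 & H3 & H4).
  pose proof (HW _ Hz) as HL.
  assert (HL2 : locally_2d (fun a b => W (a, b)) x y).
  { apply locally_2d_locally. revert HL; apply filter_imp. now intros [a b]. }
  refine (conj _ (conj _ (conj _ _))).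
  - rewrite <- E1 by assumption.
    refine (is_derive_ext_loc _ _ _ _ _ H1).
    apply locally_2d_1d_const_y in HL2.
    revert HL2; apply filter_imp; intros a Ha; auto.
  - rewrite <- E2 by assumption.
    refine (is_derive_ext_loc _ _ _ _ _ H2).
    apply locally_2d_1d_const_x in HL2.
    revert HL2; apply filter_imp; intros a Ha; auto.
  - unfold continuous; rewrite <- E1 by assumption.
    refine (filterlim_ext_loc _ _ _ H3).
    revert HL; apply filter_imp; auto.
  - unfold continuous; rewrite <- E2 by assumption.
    refine (filterlim_ext_loc _ _ _ H4).
    revert HL; apply filter_imp; auto.
Qed.

Lemma grad_on_lin (W : C -> Prop) (c d : R) (u ux uy v vx vy : C -> R) :
  grad_on W u ux uy -> grad_on W v vx vy ->
  grad_on W (fun z => c * u z + d * v z) (fun z => c * ux z + d * vx z)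
    (fun z => c * uy z + d * vy z).
Proof.
  intros Hu Hv x y Hz.
  destruct (Hu x y Hz) as (H1 & H2 & H3 & H4).
  destruct (Hv x y Hz) as (K1 & K2 & K3 & K4).
  assert (Hc : forall (f g : C -> R) z, continuous f z -> continuous g z ->
            continuous (fun z => c * f z + d * g z) z).
  { intros f g z Hf Hg.
    apply (continuous_plus (fun z => c * f z) (fun z => d * g z)).
    - now apply (continuous_scal_r c f).
    - now apply (continuous_scal_r d g). }
  refine (conj _ (conj _ (conj _ _))); auto.
  - apply (is_derive_plus (fun t => c * u (t, y)) (fun t => d * v (t, y))).
    + now apply (is_derive_scal (fun t => u (t, y))).
    + now apply (is_derive_scal (fun t => v (t, y))).
  - apply (is_derive_plus (fun t => c * u (x, t)) (fun t => d * v (x, t))).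
    + now apply (is_derive_scal (fun t => u (x, t))).
    + now apply (is_derive_scal (fun t => v (x, t))).
Qed.

Lemma grad_on_mult (W : C -> Prop) (u ux uy v vx vy : C -> R) :
  open W -> grad_on W u ux uy -> grad_on W v vx vy ->
  grad_on W (fun z => u z * v z) (fun z => ux z * v z + u z * vx z)
    (fun z => uy z * v z + u z * vy z).
Proof.
  intros HW Hu Hv x y Hz.
  pose proof (grad_on_continuous W u ux uy (x, y) HW Hu Hz) as Cu.
  pose proof (grad_on_continuous W v vx vy (x, y) HW Hv Hz) as Cv.
  destruct (Hu x y Hz) as (H1 & H2 & H3 & H4).
  destruct (Hv x y Hz) as (K1 & K2 & K3 & K4).
  assert (Hc : forall (f g : C -> R) z, continuous f z -> continuous g z ->
            continuous (fun z => f z * g z) z).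
  { intros f g z Hf Hg. now apply (continuous_mult f g). }
  assert (Hp : forall (f g : C -> R) z, continuous f z -> continuous g z ->
            continuous (fun z => f z + g z) z).
  { intros f g z Hf Hg. now apply (continuous_plus f g). }
  refine (conj _ (conj _ (conj _ _))); auto.
  - apply (is_derive_mult (fun t => u (t, y)) (fun t => v (t, y))); auto.
    intros; apply Rmult_comm.
  - apply (is_derive_mult (fun t => u (x, t)) (fun t => v (x, t))); auto.
    intros; apply Rmult_comm.
Qed.

Lemma grad_on_comp (V W : C -> Prop) (u ux uy X Xx Xy Y Yx Yy : C -> R) :
  open V -> open W -> (forall z, V z -> W (X z, Y z)) ->
  grad_on W u ux uy -> grad_on V X Xx Xy -> grad_on V Y Yx Yy ->
  grad_on V (fun z => u (X z, Y z))
    (fun z => ux (X z, Y z) * Xx z + uy (X z, Y z) * Yx z)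
    (fun z => ux (X z, Y z) * Xy z + uy (X z, Y z) * Yy z).
Proof.
  intros HV HW Hm Hu HX HY x y Hz.
  pose proof (grad_on_continuous V X Xx Xy (x, y) HV HX Hz) as CX.
  pose proof (grad_on_continuous V Y Yx Yy (x, y) HV HY Hz) as CY.
  destruct (HX x y Hz) as (H1 & H2 & H3 & H4).
  destruct (HY x y Hz) as (K1 & K2 & K3 & K4).
  pose proof (Hm _ Hz) as Hw.
  destruct (Hu (X (x, y)) (Y (x, y)) Hw) as (_ & _ & L3 & L4).
  assert (Hc : forall f g h k : C -> R,
            continuous f (X (x, y), Y (x, y)) -> continuous g (x, y) ->
            continuous h (X (x, y), Y (x, y)) -> continuous k (x, y) ->
            continuous (fun z => f (X z, Y z) * g z + h (X z, Y z) * k z) (x, y)).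
  { intros f g h k Hf Hg Hh Hk.
    assert (CXY : continuous (fun z => (X z, Y z) : C) (x, y)) by now apply continuous_pair_C.
    apply (continuous_plus (fun z => f (X z, Y z) * g z) (fun z => h (X z, Y z) * k z)).
    - apply (continuous_mult (fun z => f (X z, Y z)) g); auto.
      now apply (continuous_comp (fun z => (X z, Y z) : C) f).
    - apply (continuous_mult (fun z => h (X z, Y z)) k); auto.
      now apply (continuous_comp (fun z => (X z, Y z) : C) h). }
  refine (conj _ (conj _ (conj _ _))); auto.
  - now apply (grad_on_chain W u ux uy (fun t => X (t, y)) (fun t => Y (t, y))).
  - now apply (grad_on_chain W u ux uy (fun t => X (x, t)) (fun t => Y (x, t))).
Qed.

(* The map [(X, Y)] is holomorphic with derivative [p + i q], which in turn has
   derivative [p1 + i q1]. *)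
Lemma harmonic_on_comp (V W : C -> Prop) (u ux uy X Y p q p1 q1 : C -> R) :
  open V -> open W -> (forall z, V z -> W (X z, Y z)) ->
  harmonic_on W u ux uy ->
  grad_on V X p (fun z => - q z) -> grad_on V Y q p ->
  grad_on V p p1 (fun z => - q1 z) -> grad_on V q q1 p1 ->
  harmonic_on V (fun z => u (X z, Y z))
    (fun z => ux (X z, Y z) * p z + uy (X z, Y z) * q z)
    (fun z => - ux (X z, Y z) * q z + uy (X z, Y z) * p z).
Proof.
  intros HV HW Hm [Hu (uxx & uxy & uyx & uyy & Hux & Huy & HL)] HX HY Hp Hq.
  pose proof (grad_on_comp V W u ux uy X _ _ Y _ _ HV HW Hm Hu HX HY) as G.
  pose proof (grad_on_comp V W ux _ _ X _ _ Y _ _ HV HW Hm Hux HX HY) as Gx.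
  pose proof (grad_on_comp V W uy _ _ X _ _ Y _ _ HV HW Hm Huy HX HY) as Gy.
  pose proof (grad_on_mult V _ _ _ _ _ _ HV Gx Hp) as Gxp.
  pose proof (grad_on_mult V _ _ _ _ _ _ HV Gy Hp) as Gyp.
  pose proof (grad_on_mult V _ _ _ _ _ _ HV Gx Hq) as Gxq.
  pose proof (grad_on_mult V _ _ _ _ _ _ HV Gy Hq) as Gyq.
  split.
  - refine (grad_on_ext V _ _ _ _ _ _ HV _ _ _ G); intros; simpl; ring.
  - pose proof (grad_on_lin V 1 1 _ _ _ _ _ _ Gxp Gyq) as G1.
    pose proof (grad_on_lin V (-1) 1 _ _ _ _ _ _ Gxq Gyp) as G2.
    do 4 eexists.
    split; [|split].
    + refine (grad_on_ext V _ _ _ _ _ _ HV _ _ _ G1).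
      * intros; simpl; ring.
      * reflexivity.
      * reflexivity.
    + refine (grad_on_ext V _ _ _ _ _ _ HV _ _ _ G2).
      * intros; simpl; ring.
      * reflexivity.
      * reflexivity.
    + intros z Hz; simpl.
      specialize (HL _ (Hm z Hz)).
      (* What remains is [p^2 + q^2] times the Laplacian of [u]: the terms in [uxy], [uyx], [p1] and
         [q1] cancel in pairs by the Cauchy-Riemann equations. *)
      replace (uyy (X z, Y z)) with (- uxx (X z, Y z)) by lra.
      ring.
Qed.

Lemma unit_disk_iff (x y : R) : unit_disk (x, y) <-> x ^ 2 + y ^ 2 < 1.
Proof.
  unfold unit_disk, Cmod; simpl fst; simpl snd.
  rewrite <- sqrt_1 at 1.
  split; intros H.
  - now apply sqrt_lt_0_alt.
  - apply sqrt_lt_1_alt. split; [nra | exact H].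
Qed.

Lemma continuous_pow (T : UniformSpace) (f : T -> R) (n : nat) (x : T) :
  continuous f x -> continuous (fun z => f z ^ n) x.
Proof.
  intros Hf; induction n as [|n IH]; simpl.
  - apply continuous_const.
  - now apply (continuous_mult f (fun z => f z ^ n)).
Qed.

Ltac prove_continuous :=
  repeat match goal with
  | |- continuous (fun _ => ?c) _ => apply continuous_const
  | |- continuous (fun z => fst z) _ => apply continuous_fst_C
  | |- continuous (fun z => snd z) _ => apply continuous_snd_C
  | |- continuous (fun z => @?f z + @?g z) _ => apply (continuous_plus f g)
  | |- continuous (fun z => @?f z - @?g z) _ => apply (continuous_minus f g)
  | |- continuous (fun z => @?f z * @?g z) _ => apply (continuous_mult f g)
  | |- continuous (fun z => - @?f z) _ => apply (continuous_opp f)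
  | |- continuous (fun z => (@?f z) ^ ?n) _ => apply (continuous_pow _ f n)
  | |- continuous (fun z => / @?f z) _ =>
      apply (continuous_comp f Rinv); [ | apply continuous_Rinv ]
  | |- continuous (fun z => @?f z / @?g z) _ =>
      apply (continuous_mult f (fun z => / g z))
  end.

Lemma continuous_Cmod (z : C) : continuous Cmod z.
Proof.
  unfold Cmod.
  apply (continuous_comp (fun z : C => fst z ^ 2 + snd z ^ 2) sqrt).
  - prove_continuous.
  - apply continuous_sqrt.
Qed.

Lemma open_unit_disk : open unit_disk.
Proof.
  apply (open_comp Cmod (fun r => r < 1)).
  - intros; apply continuous_Cmod.
  - apply open_lt.
Qed.

(** * Moebius automorphisms of the disk in real coordinates *)

Definition mobius (a z : C) : C := ((z + a) / (1 + Cconj a * z))%C.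

Section Mobius.
Variables a1 a2 : R.
Hypothesis Ha : a1 ^ 2 + a2 ^ 2 < 1.

(** [N1 + i N2] is the denominator [1 + conj a z] and [d] its squared modulus. [X + i Y] is the
    Moebius map, [p + i q = k / (1 + conj a z)^2] its derivative and [p1 + i q1 = - 2 k conj a / (1
    + conj a z)^3] its second derivative, each rationalised with the conjugate of the
    denominator. *)
Let N1 (z : C) := 1 + a1 * fst z + a2 * snd z.
Let N2 (z : C) := a1 * snd z - a2 * fst z.
Let d (z : C) := N1 z ^ 2 + N2 z ^ 2.
Let k := 1 - a1 ^ 2 - a2 ^ 2.
Let X (z : C) := ((fst z + a1) * N1 z + (snd z + a2) * N2 z) / d z.
Let Y (z : C) := ((snd z + a2) * N1 z - (fst z + a1) * N2 z) / d z.
Let p (z : C) := k * (N1 z ^ 2 - N2 z ^ 2) / d z ^ 2.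
Let q (z : C) := - (2 * k * N1 z * N2 z) / d z ^ 2.
Let p1 (z : C) :=
  - (2 * k * (a1 * (N1 z ^ 3 - 3 * N1 z * N2 z ^ 2)
              + a2 * (N2 z ^ 3 - 3 * N1 z ^ 2 * N2 z))) / d z ^ 3.
Let q1 (z : C) :=
  - (2 * k * (a1 * (N2 z ^ 3 - 3 * N1 z ^ 2 * N2 z)
              - a2 * (N1 z ^ 3 - 3 * N1 z * N2 z ^ 2))) / d z ^ 3.

Lemma mobius_denom (z : C) : unit_disk z -> d z > 0.
Proof.
  destruct z as [x y]; rewrite unit_disk_iff; unfold d, N1, N2; simpl fst; simpl snd.
  intros Hz.
  (* Cauchy-Schwarz, by way of Lagrange's identity for the vectors [(a1, a2)] and [(x, y)]. *)
  assert (H : (a1 * x + a2 * y) ^ 2 < 1).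
  { replace ((a1 * x + a2 * y) ^ 2)
      with ((a1 ^ 2 + a2 ^ 2) * (x ^ 2 + y ^ 2) - (a1 * y - a2 * x) ^ 2) by ring.
    assert (0 <= a1 ^ 2 + a2 ^ 2) by nra. assert (0 <= x ^ 2 + y ^ 2) by nra.
    pose proof (pow2_ge_0 (a1 * y - a2 * x)).
    generalize dependent (a1 ^ 2 + a2 ^ 2); generalize dependent (x ^ 2 + y ^ 2); intros; nra. }
  assert (H1 : -1 < a1 * x + a2 * y) by nra.
  pose proof (pow_lt (1 + a1 * x + a2 * y) 2 ltac:(lra)).
  pose proof (pow2_ge_0 (a1 * y - a2 * x)).
  lra.
Qed.

Lemma mobius_grad :
  grad_on unit_disk X p (fun z => - q z) /\ grad_on unit_disk Y q p /\
  grad_on unit_disk p p1 (fun z => - q1 z) /\ grad_on unit_disk q q1 p1.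
Proof.
  assert (HD := mobius_denom).
  refine (conj _ (conj _ (conj _ _))); intros x y Hz; specialize (HD _ Hz);
  unfold X, Y, p, q, p1, q1, k, d, N1, N2 in *; simpl fst in *; simpl snd in *;
  refine (conj _ (conj _ (conj _ _))).
  all: try (match goal with |- is_derive _ _ _ => auto_derive | _ => prove_continuous end).
  all: try (simpl in HD |- *; nra).
  all: try (field; simpl in HD |- *; nra).
  all: apply pow_nonzero; simpl fst; simpl snd; lra.
Qed.

Lemma mobius_coords (z : C) : unit_disk z -> mobius (a1, a2) z = (X z, Y z).
Proof.
  intros Hz; pose proof (mobius_denom z Hz) as HD; destruct z as [x y].
  unfold mobius, X, Y, d, N1, N2 in *; simpl fst in *; simpl snd in *.
  apply injective_projections; simpl; field; simpl in HD; nra.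
Qed.

Lemma mobius_in_unit_disk_aux (z : C) : unit_disk z -> unit_disk (X z, Y z).
Proof.
  intros Hz; pose proof (mobius_denom z Hz) as HD; destruct z as [x y].
  rewrite unit_disk_iff in *.
  assert (E : 1 - (X (x, y) ^ 2 + Y (x, y) ^ 2)
              = (1 - a1 ^ 2 - a2 ^ 2) * (1 - x ^ 2 - y ^ 2) / d (x, y)).
  { unfold X, Y, d, N1, N2 in *; simpl fst in *; simpl snd in *.
    field; simpl in HD; nra. }
  assert (0 < (1 - a1 ^ 2 - a2 ^ 2) * (1 - x ^ 2 - y ^ 2) / d (x, y)).
  { apply Rdiv_lt_0_compat; [apply Rmult_lt_0_compat; lra | lra]. }
  lra.
Qed.

Lemma harmonic_on_mobius_aux (u ux uy : C -> R) :
  harmonic_on unit_disk u ux uy ->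
  exists vx vy : C -> R,
    harmonic_on unit_disk (fun z => u (mobius (a1, a2) z)) vx vy /\
    vx (0, 0) = (1 - a1 ^ 2 - a2 ^ 2) * ux (a1, a2) /\
    vy (0, 0) = (1 - a1 ^ 2 - a2 ^ 2) * uy (a1, a2).
Proof.
  intros Hu.
  destruct mobius_grad as (GX & GY & Gp & Gq).
  pose proof (harmonic_on_comp unit_disk unit_disk u ux uy X Y p q p1 q1
                open_unit_disk open_unit_disk mobius_in_unit_disk_aux Hu GX GY Gp Gq)
    as [Hg Hh].
  do 2 eexists; split; [split | ].
  - refine (grad_on_ext unit_disk _ _ _ _ _ _ open_unit_disk _ _ _ Hg).
    + intros z Hz; cbv beta; now rewrite mobius_coords.
    + reflexivity.
    + reflexivity.
  - exact Hh.
  - assert (EX : X (0, 0) = a1) by (unfold X, d, N1, N2; simpl; field).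
    assert (EY : Y (0, 0) = a2) by (unfold Y, d, N1, N2; simpl; field).
    assert (Ep : p (0, 0) = 1 - a1 ^ 2 - a2 ^ 2)
      by (unfold p, k, d, N1, N2; simpl; field).
    assert (Eq : q (0, 0) = 0) by (unfold q, k, d, N1, N2; simpl; field).
    cbv beta; rewrite EX, EY, Ep, Eq; split; ring.
Qed.
End Mobius.

Lemma mobius_in_unit_disk (a z : C) :
  unit_disk a -> unit_disk z -> unit_disk (mobius a z).
Proof.
  destruct a as [a1 a2]; intros Ha Hz.
  rewrite unit_disk_iff in Ha.
  rewrite mobius_coords by assumption.
  now apply mobius_in_unit_disk_aux.
Qed.

(** The derivative of [mobius a] at [0] is the real number [1 - |a|^2], so the gradient is scaled
    without being rotated. This carries a bound at the centre over to [a], and it is the source of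
    the denominator [1 - |z|^2]. *)
Lemma harmonic_on_mobius (a : C) (u ux uy : C -> R) :
  unit_disk a -> harmonic_on unit_disk u ux uy ->
  exists vx vy : C -> R,
    harmonic_on unit_disk (fun z => u (mobius a z)) vx vy /\
    vx (0, 0) = (1 - Cmod a ^ 2) * ux a /\ vy (0, 0) = (1 - Cmod a ^ 2) * uy a.
Proof.
  destruct a as [a1 a2]; intros Ha Hu.
  rewrite unit_disk_iff in Ha.
  rewrite Cmod2_alt; unfold Re, Im; simpl fst; simpl snd.
  replace (1 - (a1 ^ 2 + a2 ^ 2)) with (1 - a1 ^ 2 - a2 ^ 2) by ring.
  now apply harmonic_on_mobius_aux.
Qed.

Lemma mobius_0 (a : C) : mobius a (RtoC 0) = a.
Proof. unfold mobius; field. Qed.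

Lemma Cmod_lt_1_denom (a b : C) : unit_disk a -> unit_disk b -> (1 - Cconj a * b)%C <> 0%C.
Proof.
  unfold unit_disk; intros Ha Hb E.
  assert (E1 : Cmod (Cconj a * b) = 1).
  { replace (Cconj a * b)%C with (RtoC 1); [apply Cmod_1 | ].
    replace (RtoC 1) with ((1 - Cconj a * b) + Cconj a * b)%C by ring.
    rewrite E; ring. }
  rewrite Cmod_mult, Cmod_conj in E1.
  pose proof (Cmod_ge_0 a); pose proof (Cmod_ge_0 b). nra.
Qed.

(** The preimage is [mobius (- a) b]. Its modulus is the quotient under [artanh] in
    [hyperbolic_dist a b], so moving [a] to [0] turns the hyperbolic distance into a function of a
    modulus. *)
Lemma mobius_surjective (a b : C) : unit_disk a -> unit_disk b ->
  unit_disk ((b - a) / (1 - Cconj a * b))%C /\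
  mobius a ((b - a) / (1 - Cconj a * b))%C = b.
Proof.
  intros Ha Hb.
  pose proof (Cmod_lt_1_denom a b Ha Hb) as H0.
  pose proof (Cmod_lt_1_denom a a Ha Ha) as H1.
  split.
  - replace ((b - a) / (1 - Cconj a * b))%C with (mobius (- a) b).
    + apply mobius_in_unit_disk; [|exact Hb].
      unfold unit_disk in *; now rewrite Cmod_opp.
    + unfold mobius; rewrite Copp_conj.
      replace (1 + - Cconj a * b)%C with (1 - Cconj a * b)%C by ring.
      reflexivity.
  - unfold mobius; field; split; auto.
    replace (1 - Cconj a * b + Cconj a * (b - a))%C with (1 - Cconj a * a)%C by ring.
    exact H1.
Qed.

(** * Circle integrals *)

(** Differentiation under the integral with the derivative of the integrand given by name, so that
    its joint continuity can be read off a formula. *)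
Lemma is_derive_RInt_param_explicit (f f' : R -> R -> R) (a b x : R) :
  locally x (fun y => forall t, is_derive (fun u => f u t) y (f' y t)) ->
  (forall t, Rmin a b <= t <= Rmax a b -> continuity_2d_pt f' x t) ->
  locally x (fun y => ex_RInt (f y) a b) ->
  is_derive (fun y => RInt (f y) a b) x (RInt (f' x) a b).
Proof.
  intros Hd Hc Hi.
  assert (HD : RInt (f' x) a b = RInt (fun t => Derive (fun u => f u t) x) a b).
  { apply RInt_ext; intros t _. symmetry; apply is_derive_unique.
    now apply (locally_singleton _ _ Hd). }
  rewrite HD.
  apply (is_derive_RInt_param f a b x).
  - revert Hd; apply filter_imp; intros y Hy t _. now exists (f' y t).
  - intros t Ht. apply continuity_2d_pt_ext_loc with (2 := Hc t Ht).
    destruct Hd as [e He]. exists e; intros u v Hu _.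
    symmetry; apply is_derive_unique. now apply He.
  - exact Hi.
Qed.

(** Polar coordinates with a signed radius as first component: the centre of the disk becomes an
    interior radius, where two-sided derivatives make sense. *)
Definition strip (z : C) : Prop := -1 < fst z < 1.

Lemma open_strip : open strip.
Proof.
  apply (open_and (fun z : C => -1 < fst z) (fun z : C => fst z < 1)).
  - apply (open_comp (fun z : C => fst z) (fun r => -1 < r)).
    + intros; apply continuous_fst_C.
    + apply open_gt.
  - apply (open_comp (fun z : C => fst z) (fun r => r < 1)).
    + intros; apply continuous_fst_C.
    + apply open_lt.
Qed.

(** The offset [delta] rotates the circle, so that the fixed weight [cos] picks out the derivative
    in direction [delta]. *)
Definition polar_x (delta : R) (z : C) : R := fst z * cos (snd z + delta).
Definition polar_y (delta : R) (z : C) : R := fst z * sin (snd z + delta).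

Lemma polar_in_unit_disk (delta : R) (z : C) :
  strip z -> unit_disk (polar_x delta z, polar_y delta z).
Proof.
  intros Hz; apply unit_disk_iff; unfold polar_x, polar_y.
  pose proof (sin2_cos2 (snd z + delta)) as E; unfold Rsqr in E.
  unfold strip in Hz.
  replace ((fst z * cos (snd z + delta)) ^ 2 + (fst z * sin (snd z + delta)) ^ 2)
    with (fst z * fst z * (sin (snd z + delta) * sin (snd z + delta)
          + cos (snd z + delta) * cos (snd z + delta))) by ring.
  rewrite E. nra.
Qed.

Lemma continuous_cos_snd (delta : R) (z : C) :
  continuous (fun w : C => cos (snd w + delta)) z.
Proof.
  apply (continuous_comp (fun w : C => snd w + delta) cos).
  - prove_continuous.
  - apply continuous_cos.
Qed.

Lemma continuous_sin_snd (delta : R) (z : C) :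
  continuous (fun w : C => sin (snd w + delta)) z.
Proof.
  apply (continuous_comp (fun w : C => snd w + delta) sin).
  - prove_continuous.
  - apply continuous_sin.
Qed.

Section Polar.
Variables (delta : R) (v vx vy : C -> R).
Hypothesis Hv : harmonic_on unit_disk v vx vy.

Let X := polar_x delta.
Let Y := polar_y delta.
Let c (z : C) := cos (snd z + delta).
Let s (z : C) := sin (snd z + delta).

Lemma grad_on_cos : grad_on strip c (fun _ => 0) (fun z => - s z).
Proof.
  intros x y _; unfold c, s; simpl; refine (conj _ (conj _ (conj _ _))).
  - auto_derive; auto.
  - auto_derive; auto. ring.
  - prove_continuous.
  - prove_continuous. apply continuous_sin_snd.
Qed.

Lemma grad_on_sin : grad_on strip s (fun _ => 0) c.
Proof.
  intros x y _; unfold c, s; simpl; refine (conj _ (conj _ (conj _ _))).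
  - auto_derive; auto.
  - auto_derive; auto. ring.
  - prove_continuous.
  - apply continuous_cos_snd.
Qed.

Lemma grad_on_fst : grad_on strip (fun z => fst z) (fun _ => 1) (fun _ => 0).
Proof.
  intros x y _; simpl; refine (conj _ (conj _ (conj _ _))).
  - auto_derive; auto.
  - auto_derive; auto.
  - prove_continuous.
  - prove_continuous.
Qed.

Definition polar_radial (z : C) : R := vx (X z, Y z) * c z + vy (X z, Y z) * s z.
Definition polar_angular (z : C) : R :=
  fst z * (- vx (X z, Y z) * s z + vy (X z, Y z) * c z).

(** This is the Laplacian in polar coordinates multiplied by the square of the radius, a form that
    stays regular at radius [0]. *)
Lemma polar_laplacian :
  exists wss wst wts wtt : C -> R,
    grad_on strip (fun z => v (X z, Y z)) polar_radial polar_angular /\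
    grad_on strip polar_radial wss wst /\
    grad_on strip polar_angular wts wtt /\
    forall z, strip z -> fst z ^ 2 * wss z + fst z * polar_radial z + wtt z = 0.
Proof.
  destruct Hv as [Hu (uxx & uxy & uyx & uyy & Hux & Huy & HL)].
  pose proof open_strip as HS.
  pose proof (grad_on_mult strip _ _ _ _ _ _ HS grad_on_fst grad_on_cos) as HX.
  pose proof (grad_on_mult strip _ _ _ _ _ _ HS grad_on_fst grad_on_sin) as HY.
  pose proof (grad_on_comp strip unit_disk v _ _ X _ _ Y _ _ HS open_unit_disk
                (polar_in_unit_disk delta) Hu HX HY) as G.
  pose proof (grad_on_comp strip unit_disk vx _ _ X _ _ Y _ _ HS open_unit_disk
                (polar_in_unit_disk delta) Hux HX HY) as Gx.
  pose proof (grad_on_comp strip unit_disk vy _ _ X _ _ Y _ _ HS open_unit_disk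
                (polar_in_unit_disk delta) Huy HX HY) as Gy.
  pose proof (grad_on_lin strip 1 1 _ _ _ _ _ _
                (grad_on_mult strip _ _ _ _ _ _ HS Gx grad_on_cos)
                (grad_on_mult strip _ _ _ _ _ _ HS Gy grad_on_sin)) as G1.
  pose proof (grad_on_mult strip _ _ _ _ _ _ HS grad_on_fst
                (grad_on_lin strip (-1) 1 _ _ _ _ _ _
                (grad_on_mult strip _ _ _ _ _ _ HS Gx grad_on_sin)
                (grad_on_mult strip _ _ _ _ _ _ HS Gy grad_on_cos))) as G2.
  do 4 eexists; refine (conj _ (conj _ (conj _ _))).
  - refine (grad_on_ext strip _ _ _ _ _ _ HS _ _ _ G); intros;
      unfold polar_radial, polar_angular; simpl; ring.
  - refine (grad_on_ext strip _ _ _ _ _ _ HS _ _ _ G1);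
     [ intros; unfold polar_radial; simpl; ring | reflexivity | reflexivity ].
  - refine (grad_on_ext strip _ _ _ _ _ _ HS _ _ _ G2);
     [ intros; unfold polar_angular; simpl; ring | reflexivity | reflexivity ].
  - intros z Hz; unfold polar_radial; cbv beta.
    specialize (HL _ (polar_in_unit_disk delta z Hz)).
    fold (X z) (Y z) in HL |- *.
    replace (uyy (X z, Y z)) with (- uxx (X z, Y z)) by lra.
    pose proof (sin2_cos2 (snd z + delta)) as E; unfold Rsqr in E.
    fold (s z) (c z) in E.
    replace (s z * s z) with (1 - c z * c z) by lra.
    ring_simplify.
    replace (s z ^ 2) with (1 - c z * c z) by (simpl; lra).
    ring.
Qed.
End Polar.

Section Weighted_integral.
Variables (a b : R) (k : R -> R).
Hypothesis Hk : forall t, continuous k t.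

Lemma continuous_weighted (F : C -> R) (s t : R) :
  continuous F (s, t) -> continuous (fun z : C => F z * k (snd z)) (s, t).
Proof.
  intros HF.
  apply (continuous_mult F (fun z : C => k (snd z))); [exact HF | ].
  apply (continuous_comp (fun z : C => snd z) k); [apply continuous_snd_C | apply Hk].
Qed.

Lemma continuous_weighted_slice (F : C -> R) (s t : R) :
  continuous F (s, t) -> continuous (fun t => F (s, t) * k t) t.
Proof.
  intros HF.
  apply (continuous_comp (fun t => (s, t) : C) (fun z : C => F z * k (snd z))).
  - apply continuous_pair_C; [apply continuous_const | apply continuous_id].
  - now apply continuous_weighted.
Qed.

Lemma ex_RInt_weighted (F : C -> R) (s : R) :
  (forall t, continuous F (s, t)) -> ex_RInt (fun t => F (s, t) * k t) a b.
Proof.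
  intros HF.
  apply (ex_RInt_continuous (V := R_CompleteNormedModule)); intros t _.
  now apply continuous_weighted_slice.
Qed.

Lemma is_derive_weighted (F Fs Ft : C -> R) (s : R) :
  grad_on strip F Fs Ft -> -1 < s < 1 ->
  is_derive (fun s => RInt (fun t => F (s, t) * k t) a b) s
    (RInt (fun t => Fs (s, t) * k t) a b).
Proof.
  intros HF Hs.
  assert (HL : locally s (fun y => -1 < y < 1)).
  { apply (open_and (fun r => -1 < r) (fun r => r < 1)); auto.
    - apply open_gt.
    - apply open_lt. }
  apply (is_derive_RInt_param_explicit (fun s t => F (s, t) * k t)
           (fun s t => Fs (s, t) * k t)).
  - revert HL; apply filter_imp; intros y Hy t.
    apply is_derive_ext with (fun u => k t * F (u, t)); [intros; simpl; ring | ].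
    rewrite Rmult_comm.
    apply (is_derive_scal (fun u => F (u, t))). now apply HF.
  - intros t _. apply continuity_2d_pt_filterlim.
    apply (continuous_ext (fun z : C => Fs z * k (snd z))).
    + now intros [x y].
    + apply continuous_weighted. now apply HF.
  - revert HL; apply filter_imp; intros y Hy. apply ex_RInt_weighted.
    intros t; now apply (grad_on_continuous strip F Fs Ft (y, t) open_strip HF).
Qed.
End Weighted_integral.

(** * Fourier modes of a harmonic function as functions of the radius *)

Lemma is_derive_continuity_pt (f : R -> R) (x l : R) :
  is_derive f x l -> continuity_pt f x.
Proof.
  intros H; apply continuity_pt_filterlim, (ex_derive_continuous (V := R_NormedModule)).
  now exists l.
Qed.

Lemma is_derive_0_constant (f f' : R -> R) (a b : R) :
  a <= b -> (forall x, a <= x <= b -> is_derive f x (f' x)) ->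
  (forall x, a < x < b -> f' x = 0) -> f b = f a.
Proof.
  intros Hab Hd H0.
  destruct (MVT_gen f a b (fun _ => 0)) as [y [_ Hy]].
  - intros y Hy. rewrite Rmin_left, Rmax_right in Hy by lra.
    rewrite <- (H0 y Hy). apply Hd; lra.
  - intros y Hy. rewrite Rmin_left, Rmax_right in Hy by lra.
    apply is_derive_continuity_pt with (f' y). now apply Hd.
  - lra.
Qed.

(** The Euler equation has the solutions [s] and [1 / s]; regularity at [0] excludes the second. *)
Lemma euler_ode_linear (I I1 I2 : R -> R) (s : R) :
  (forall x, -1 < x < 1 -> is_derive I x (I1 x)) ->
  (forall x, -1 < x < 1 -> is_derive I1 x (I2 x)) ->
  (forall x, -1 < x < 1 -> x ^ 2 * I2 x + x * I1 x = I x) ->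
  0 < s < 1 -> I s = I1 0 * s.
Proof.
  intros H1 H2 HE Hs.
  (* The derivative of [x (x I1 - I)] is [x^2 I2 + x I1 - I], which is zero by the equation. *)
  assert (Hq : forall x, 0 <= x < 1 -> x * (x * I1 x - I x) = 0).
  { intros x Hx.
    rewrite (is_derive_0_constant (fun y => y * (y * I1 y - I y)) (fun _ => 0) 0 x);
      [ring | lra | | reflexivity].
    intros y Hy.
    assert (D1 : is_derive I y (I1 y)) by (apply H1; lra).
    assert (D2 : is_derive I1 y (I2 y)) by (apply H2; lra).
    auto_derive.
    - repeat split; [exists (I2 y) | exists (I1 y)]; assumption.
    - change (Derive (fun x : R => I x) y) with (Derive I y).
      change (Derive (fun x : R => I1 x) y) with (Derive I1 y).
      rewrite (is_derive_unique _ _ _ D1), (is_derive_unique _ _ _ D2).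
      assert (E := HE y ltac:(lra)). nra. }
  assert (Hz : forall x, 0 < x < 1 -> I2 x = 0).
  { intros x Hx. assert (E := HE x ltac:(lra)). assert (Q := Hq x ltac:(lra)).
    assert (x * I1 x - I x = 0) by nra.
    assert (x ^ 2 * I2 x = 0) by lra.
    assert (0 < x ^ 2) by nra. nra. }
  assert (E : I1 s = I1 0).
  { apply is_derive_0_constant with I2; [lra | |].
    - intros y Hy; apply H2; lra.
    - intros y Hy; apply Hz; lra. }
  assert (Q := Hq s ltac:(lra)). assert (s * I1 s - I s = 0) by nra. nra.
Qed.

(** Here the solutions are [1] and [ln s]; regularity at [0] excludes the logarithm, through the
    constancy of [x I1 x]. *)
Lemma euler_ode_constant (I I1 I2 : R -> R) (s : R) :
  (forall x, -1 < x < 1 -> is_derive I x (I1 x)) ->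
  (forall x, -1 < x < 1 -> is_derive I1 x (I2 x)) ->
  (forall x, -1 < x < 1 -> x ^ 2 * I2 x + x * I1 x = 0) ->
  0 < s < 1 -> I s = I 0.
Proof.
  intros H1 H2 HE Hs.
  assert (Hq : forall x, 0 < x < 1 -> x * I1 x = 0).
  { intros x Hx.
    rewrite (is_derive_0_constant (fun y => y * I1 y) (fun y => I1 y + y * I2 y) 0 x);
      [ring | lra | |].
    - intros y Hy.
      assert (D2 : is_derive I1 y (I2 y)) by (apply H2; lra).
      auto_derive.
      + exists (I2 y); assumption.
      + change (Derive (fun x : R => I1 x) y) with (Derive I1 y).
        rewrite (is_derive_unique _ _ _ D2). ring.
    - intros y Hy. assert (E := HE y ltac:(lra)). nra. }
  apply is_derive_0_constant with I1; [lra | |].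
  - intros y Hy; apply H1; lra.
  - intros y Hy. assert (Q := Hq y ltac:(lra)). nra.
Qed.

Lemma RInt_ext_all (f g : R -> R) (a b : R) :
  (forall t : R, f t = g t) -> RInt f a b = RInt g a b.
Proof. intros H; apply RInt_ext; intros t _; apply H. Qed.

Lemma cos_plus_2PI (x : R) : cos (x + 2 * PI) = cos x.
Proof. replace (x + 2 * PI) with (x + 2 * INR 1 * PI) by (simpl; ring). apply cos_period. Qed.

Lemma sin_plus_2PI (x : R) : sin (x + 2 * PI) = sin x.
Proof. replace (x + 2 * PI) with (x + 2 * INR 1 * PI) by (simpl; ring). apply sin_period. Qed.

Section Circle_integrals.
Variables (delta a : R) (v vx vy : C -> R).
Hypothesis Hv : harmonic_on unit_disk v vx vy.

Let w (z : C) := v (polar_x delta z, polar_y delta z).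
Let ws := polar_radial delta vx vy.

(** The weight [k] is a periodic eigenfunction of the second derivative. Two integrations by parts
    in the angle replace the angular part of the polar Laplacian by [- lambda], which leaves an
    Euler equation in the radius. *)
Lemma circle_integral_ode (lambda : R) (k k' : R -> R) :
  (forall t, is_derive k t (k' t)) ->
  (forall t, is_derive k' t (- lambda * k t)) ->
  k (a + 2 * PI) = k a -> k' (a + 2 * PI) = k' a ->
  let I (s : R) := RInt (fun t => w (s, t) * k t) a (a + 2 * PI) in
  let I1 (s : R) := RInt (fun t => ws (s, t) * k t) a (a + 2 * PI) in
  exists I2 : R -> R,
    (forall s, -1 < s < 1 -> is_derive I s (I1 s)) /\
    (forall s, -1 < s < 1 -> is_derive I1 s (I2 s)) /\
    (forall s, -1 < s < 1 -> s ^ 2 * I2 s + s * I1 s = lambda * I s).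
Proof.
  intros Dk Dk' Pk Pk' I I1.
  assert (Ck : forall t, continuous k t).
  { intros t; apply (ex_derive_continuous (V := R_NormedModule)). now exists (k' t). }
  assert (Ck' : forall t, continuous k' t).
  { intros t; apply (ex_derive_continuous (V := R_NormedModule)). eexists; apply Dk'. }
  destruct (polar_laplacian delta v vx vy Hv)
    as (wss & wst & wts & wtt & Gw & Gs & Gt & HL).
  exists (fun s => RInt (fun t => wss (s, t) * k t) a (a + 2 * PI)).
  refine (conj _ (conj _ _)); intros s Hs.
  - apply (is_derive_weighted a (a + 2 * PI) k Ck w ws _ s Gw Hs).
  - apply (is_derive_weighted a (a + 2 * PI) k Ck ws wss _ s Gs Hs).
  - assert (Cw : forall t, continuous w (s, t)).
    { intros t; apply (grad_on_continuous strip _ _ _ (s, t) open_strip Gw Hs). }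
    assert (Ct : forall t, continuous (polar_angular delta vx vy) (s, t)).
    { intros t; apply (grad_on_continuous strip _ _ _ (s, t) open_strip Gt Hs). }
    assert (Cs : forall t, continuous ws (s, t)).
    { intros t; apply (grad_on_continuous strip _ _ _ (s, t) open_strip Gs Hs). }
    assert (Css : forall t, continuous wss (s, t)) by (intros t; now apply Gs).
    assert (Ctt : forall t, continuous wtt (s, t)) by (intros t; now apply Gt).
    pose proof (fun F => ex_RInt_weighted a (a + 2 * PI) k Ck F s) as EX.
    assert (PT : is_RInt (fun t => wtt (s, t) * k t + lambda * (w (s, t) * k t))
                   a (a + 2 * PI) 0).
    (* The boundary terms agree because the polar pullback, its angular derivative, [k] and [k']
       take the same values at both ends of the period. *)
    { replace 0 with
        (minus (polar_angular delta vx vy (s, a + 2 * PI) * k (a + 2 * PI)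
                - w (s, a + 2 * PI) * k' (a + 2 * PI))
               (polar_angular delta vx vy (s, a) * k a - w (s, a) * k' a)).
      2:{ rewrite Pk, Pk'. unfold w, polar_angular, polar_x, polar_y, minus, plus, opp.
          simpl fst; simpl snd; simpl.
          replace (a + 2 * PI + delta) with (a + delta + 2 * PI) by ring.
          rewrite cos_plus_2PI, sin_plus_2PI. ring. }
      apply (is_RInt_derive
               (fun t => polar_angular delta vx vy (s, t) * k t - w (s, t) * k' t)).
      - intros t _.
        destruct (Gw s t Hs) as (_ & D1 & _).
        destruct (Gt s t Hs) as (_ & D2 & _).
        replace (wtt (s, t) * k t + lambda * (w (s, t) * k t)) with
          (minus (plus (mult (wtt (s, t)) (k t))
                       (mult (polar_angular delta vx vy (s, t)) (k' t)))
                 (plus (mult (polar_angular delta vx vy (s, t)) (k' t))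
                       (mult (w (s, t)) (- lambda * k t))))
          by (unfold minus, plus, opp, mult; simpl; ring).
        apply (is_derive_minus (fun t => polar_angular delta vx vy (s, t) * k t)
                 (fun t => w (s, t) * k' t)).
        + apply (is_derive_mult (fun t => polar_angular delta vx vy (s, t)) k); auto.
          intros; apply Rmult_comm.
        + apply (is_derive_mult (fun t => w (s, t)) k'); auto.
          intros; apply Rmult_comm.
      - intros t _.
        apply (continuous_plus (fun t => wtt (s, t) * k t)
                 (fun t => lambda * (w (s, t) * k t))).
        + now apply continuous_weighted_slice.
        + apply (continuous_scal_r lambda (fun t => w (s, t) * k t)).
          now apply continuous_weighted_slice. }
    assert (E : RInt (fun t => s ^ 2 * (wss (s, t) * k t) + s * (ws (s, t) * k t)) a
                  (a + 2 * PI)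
                = RInt (fun t => - (wtt (s, t) * k t + lambda * (w (s, t) * k t))
                                 + lambda * (w (s, t) * k t)) a (a + 2 * PI)).
    { apply RInt_ext_all; intros t. pose proof (HL (s, t) Hs) as E. simpl fst in E.
      fold ws in E.
      replace (wtt (s, t)) with (- (s ^ 2 * wss (s, t) + s * ws (s, t))) by lra.
      ring. }
    rewrite (RInt_plus (fun t => s ^ 2 * (wss (s, t) * k t))
               (fun t => s * (ws (s, t) * k t))) in E.
    2:{ apply (ex_RInt_scal (fun t => wss (s, t) * k t)); auto. }
    2:{ apply (ex_RInt_scal (fun t => ws (s, t) * k t)); auto. }
    rewrite (RInt_scal (fun t => wss (s, t) * k t)), (RInt_scal (fun t => ws (s, t) * k t))
      in E by auto.
    rewrite (RInt_plus (fun t => - (wtt (s, t) * k t + lambda * (w (s, t) * k t)))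
               (fun t => lambda * (w (s, t) * k t))) in E.
    2:{ apply (ex_RInt_opp (fun t => wtt (s, t) * k t + lambda * (w (s, t) * k t))).
        now exists 0. }
    2:{ apply (ex_RInt_scal (fun t => w (s, t) * k t)); auto. }
    rewrite (RInt_scal (fun t => w (s, t) * k t)) in E by auto.
    rewrite (RInt_opp (fun t => wtt (s, t) * k t + lambda * (w (s, t) * k t))) in E
      by now exists 0.
    rewrite (is_RInt_unique _ _ _ _ PT) in E.
    unfold plus, scal, opp in E; simpl in E; unfold mult in E; simpl in E.
    fold (I s) (I1 s) in E. simpl. lra.
Qed.

(** Mode [lambda = 0] with constant weight: the integral does not depend on the radius and is
    evaluated at radius [0]. *)
Lemma circle_mean (s : R) : 0 < s < 1 ->
  RInt (fun t => w (s, t)) a (a + 2 * PI) = 2 * PI * v (0, 0).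
Proof.
  intros Hs.
  destruct (circle_integral_ode 0 (fun _ => 1) (fun _ => 0)) as (I2 & D1 & D2 & E).
  - intros t; auto_derive; auto.
  - intros t; auto_derive; auto; ring.
  - reflexivity.
  - reflexivity.
  - pose proof (euler_ode_constant _ _ I2 s D1 D2) as H.
    cbv beta in H.
    transitivity (RInt (fun t => w (s, t) * 1) a (a + 2 * PI)).
    { apply RInt_ext_all; intros; ring. }
    rewrite H; [ | intros x Hx; rewrite E by assumption; ring | assumption].
    rewrite (RInt_ext_all _ (fun _ => v (0, 0))).
    + rewrite RInt_const. unfold scal; simpl; unfold mult; simpl. ring.
    + intros t. unfold w, polar_x, polar_y; simpl fst.
      rewrite !Rmult_0_l. ring.
Qed.

(** Mode [lambda = 1]: the integral is linear in the radius. Its slope is computed at the centre,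
    where the radial derivative at angle [t] is the derivative of [v] in direction [t + delta]. *)
Lemma circle_first_mode (s : R) : 0 < s < 1 ->
  RInt (fun t => w (s, t) * cos t) a (a + 2 * PI)
  = s * PI * (vx (0, 0) * cos delta + vy (0, 0) * sin delta).
Proof.
  intros Hs.
  destruct (circle_integral_ode 1 cos (fun t => - sin t)) as (I2 & D1 & D2 & E).
  - intros t; auto_derive; auto; ring.
  - intros t; auto_derive; auto; ring.
  - apply cos_plus_2PI.
  - now rewrite sin_plus_2PI.
  - pose proof (euler_ode_linear _ _ I2 s D1 D2) as H.
    cbv beta in H.
    rewrite H; [ | intros x Hx; rewrite E by assumption; ring | assumption].
    set (p := vx (0, 0)); set (q := vy (0, 0)).
    (* An explicit primitive, from the product-to-sum formulas; only its linear part has a nonzero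
       increment over a period. *)
    rewrite (is_RInt_unique _ _ _
               (minus ((p * cos delta + q * sin delta) * (a + 2 * PI) / 2
                + (p * sin (2 * (a + 2 * PI) + delta)
                   - q * cos (2 * (a + 2 * PI) + delta)) / 4)
               ((p * cos delta + q * sin delta) * a / 2
                + (p * sin (2 * a + delta) - q * cos (2 * a + delta)) / 4))).
    + unfold minus, plus, opp; simpl.
      replace (2 * (a + 2 * PI) + delta) with (2 * a + delta + 2 * INR 2 * PI)
        by (simpl; ring).
      rewrite cos_period, sin_period. field.
    + apply (is_RInt_derive
        (fun x => (p * cos delta + q * sin delta) * x / 2
                + (p * sin (2 * x + delta) - q * cos (2 * x + delta)) / 4)).
      * intros t _. auto_derive; auto.
        unfold ws, polar_radial, polar_x, polar_y; simpl fst; simpl snd.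
        rewrite !Rmult_0_l. fold p q.
        replace (2 * t + delta) with (t + (t + delta)) by ring.
        rewrite (cos_plus t (t + delta)), (sin_plus t (t + delta)).
        replace delta with (t + delta - t) at 1 2 by ring.
        rewrite (cos_minus (t + delta) t), (sin_minus (t + delta) t). field.
      * intros t _. apply (continuous_weighted_slice cos continuous_cos ws).
        destruct (polar_laplacian delta v vx vy Hv)
          as (wss & wst & wts & wtt & Gw & Gs & Gt & HL).
        apply Gw. unfold strip; simpl; lra.
Qed.
End Circle_integrals.

(** * The Schwarz-Pick inequality *)

Lemma polar_decomposition (h : C) :
  exists delta, fst h = Cmod h * cos delta /\ snd h = Cmod h * sin delta.
Proof.
  destruct h as [a b]; simpl fst; simpl snd.
  pose proof (Cmod2_alt (a, b)) as E; unfold Re, Im in E; simpl fst in E; simpl snd in E.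
  pose proof (Cmod_ge_0 (a, b)) as H0.
  set (m := Cmod (a, b)) in *.
  destruct (Req_dec m 0) as [Hm | Hm].
  - exists 0. rewrite Hm in *. rewrite !Rmult_0_l. nra.
  - assert (Hp : 0 < m) by lra.
    assert (Hc : -1 <= a / m <= 1).
    { split; [apply Rle_div_r | apply Rle_div_l]; try assumption; nra. }
    assert (Hs : m * sqrt (1 - (a / m)²) = Rabs b).
    { rewrite <- (sqrt_Rsqr m) at 1 by lra.
      rewrite <- sqrt_mult_alt by apply Rle_0_sqr.
      rewrite <- sqrt_Rsqr_abs. f_equal.
      unfold Rsqr. field_simplify; [ | assumption]. nra. }
    assert (Ec : m * (a / m) = a) by (field; assumption).
    destruct (Rle_dec 0 b) as [Hb | Hb].
    + exists (acos (a / m)). rewrite cos_acos, sin_acos by assumption.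
      rewrite Hs, Ec, Rabs_right by lra. auto.
    + exists (- acos (a / m)). rewrite cos_neg, sin_neg, cos_acos, sin_acos by assumption.
      rewrite Ec, <- Ropp_mult_distr_r, Hs, Rabs_left by lra. split; ring.
Qed.

Lemma cos_ge_on_arc (alpha t : R) :
  0 <= alpha <= PI -> - alpha <= t <= alpha -> cos alpha <= cos t.
Proof.
  intros Ha Ht.
  destruct (Rle_dec 0 t).
  - apply cos_decr_1; lra.
  - rewrite <- (cos_neg t). apply cos_decr_1; lra.
Qed.

Lemma cos_le_off_arc (alpha t : R) :
  0 <= alpha <= PI -> alpha <= t <= 2 * PI - alpha -> cos t <= cos alpha.
Proof.
  intros Ha Ht.
  destruct (Rle_dec t PI).
  - apply cos_decr_1; lra.
  - replace (cos t) with (cos (2 * PI - t)).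
    + apply cos_decr_1; lra.
    + replace (2 * PI - t) with (- t + 2 * PI) by ring.
      now rewrite cos_plus_2PI, cos_neg.
Qed.

Section Bounded_harmonic.
Variables (r : R) (v vx vy : C -> R).
Hypothesis Hr : 0 < r.
Hypothesis Hv : harmonic_on unit_disk v vx vy.
Hypothesis Hb : forall z, unit_disk z -> Rabs (v z) <= r.

(* The integral of [v (cos - cos alpha)] over a circle is largest for [v = r] where
   [cos] exceeds [cos alpha] and [v = - r] elsewhere. *)
Lemma bathtub (delta alpha s : R) :
  0 <= alpha <= PI -> 0 < s < 1 ->
  s * PI * (vx (0, 0) * cos delta + vy (0, 0) * sin delta)
    - 2 * PI * v (0, 0) * cos alpha
  <= r * (4 * sin alpha + (2 * PI - 4 * alpha) * cos alpha).
Proof.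
  intros Ha Hs.
  set (w := fun t => v (polar_x delta (s, t), polar_y delta (s, t))).
  assert (Hst : forall t, strip (s, t)) by (intros t; unfold strip; simpl; lra).
  assert (Hw : forall t, Rabs (w t) <= r).
  { intros t; apply Hb, polar_in_unit_disk, Hst. }
  destruct (polar_laplacian delta v vx vy Hv)
    as (wss & wst & wts & wtt & Gw & _ & _ & _).
  assert (Cw : forall t, continuous w t).
  { intros t. apply (continuous_comp (fun t => (s, t) : C)
      (fun z => v (polar_x delta z, polar_y delta z))).
    - apply continuous_pair_C; [apply continuous_const | apply continuous_id].
    - apply (grad_on_continuous strip _ _ _ (s, t) open_strip Gw (Hst t)). }
  assert (Ck : forall t, continuous (fun t => cos t - cos alpha) t).
  { intros t; apply (continuous_minus cos (fun _ => cos alpha)).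
    - apply continuous_cos.
    - apply continuous_const. }
  assert (EX : forall (f : R -> R) a b, (forall t, continuous f t) -> ex_RInt f a b).
  { intros f a b Hf. apply (ex_RInt_continuous (V := R_CompleteNormedModule)). auto. }
  assert (CW : forall t, continuous (fun t => w t * (cos t - cos alpha)) t).
  { intros t; now apply (continuous_mult w (fun t => cos t - cos alpha)). }
  assert (CK : forall c t, continuous (fun t => c * (cos t - cos alpha)) t).
  { intros c t; now apply (continuous_scal_r c (fun t => cos t - cos alpha)). }
  assert (Hint : forall c a b, RInt (fun t => c * (cos t - cos alpha)) a b
                 = c * (sin b - sin a - (b - a) * cos alpha)).
  { intros c a b.
    replace (c * (sin b - sin a - (b - a) * cos alpha)) with
      (minus (c * (sin b - b * cos alpha)) (c * (sin a - a * cos alpha)))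
      by (unfold minus, plus, opp; simpl; ring).
    apply is_RInt_unique.
    apply (is_RInt_derive (fun t => c * (sin t - t * cos alpha))); intros t _; auto.
    auto_derive; auto; ring. }
  (* Starting the period at [- alpha] makes the arc where [cos] exceeds [cos alpha] a single
     interval, from [- alpha] to [alpha]. *)
  assert (E : RInt (fun t => w t * (cos t - cos alpha)) (- alpha) (- alpha + 2 * PI)
    = s * PI * (vx (0, 0) * cos delta + vy (0, 0) * sin delta)
      - 2 * PI * v (0, 0) * cos alpha).
  { rewrite <- (circle_first_mode delta (- alpha) v vx vy Hv s Hs).
    rewrite <- (circle_mean delta (- alpha) v vx vy Hv s Hs).
    fold w.
    rewrite (RInt_ext_all _ (fun t => minus (w t * cos t) (scal (cos alpha) (w t)))).
    - rewrite (RInt_minus (fun t => w t * cos t) (fun t => scal (cos alpha) (w t))).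
      + rewrite (RInt_scal w) by auto.
        unfold minus, plus, opp, scal; simpl; unfold mult; simpl.
        change (fun t : R => v (polar_x delta (s, t), polar_y delta (s, t)) * cos t)
          with (fun t : R => w t * cos t).
        ring.
      + apply EX. intros t. apply (continuous_mult w cos); auto. apply continuous_cos.
      + apply (ex_RInt_scal w); auto.
    - intros t. unfold minus, plus, opp, scal; simpl; unfold mult; simpl. ring. }
  rewrite <- E.
  rewrite <- (RInt_Chasles _ _ alpha) by auto.
  assert (B1 : RInt (fun t => w t * (cos t - cos alpha)) (- alpha) alpha
               <= RInt (fun t => r * (cos t - cos alpha)) (- alpha) alpha).
  { apply RInt_le; auto; [lra | ].
    intros t Ht. pose proof (cos_ge_on_arc alpha t Ha ltac:(lra)).
    specialize (Hw t). apply Rabs_le_between in Hw. nra. }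
  assert (B2 : RInt (fun t => w t * (cos t - cos alpha)) alpha (- alpha + 2 * PI)
               <= RInt (fun t => - r * (cos t - cos alpha)) alpha (- alpha + 2 * PI)).
  { apply RInt_le; auto; [lra | ].
    intros t Ht. pose proof (cos_le_off_arc alpha t Ha ltac:(lra)).
    specialize (Hw t). apply Rabs_le_between in Hw. nra. }
  rewrite Hint in B1, B2. rewrite sin_plus_2PI, sin_neg in B2. rewrite sin_neg in B1.
  unfold plus; simpl. lra.
Qed.

(** The threshold in [bathtub] is chosen so that the extremal function, [r] on an arc of half-width
    [alpha] and [- r] elsewhere, has the mean [v (0, 0)]: this means
    [alpha = PI / 2 + PI v (0, 0) / (2 r)]. *)
Lemma gradient_at_center (h : C) :
  fst h * vx (0, 0) + snd h * vy (0, 0)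
  <= Cmod h * (4 * r / PI * cos (PI * v (0, 0) / (2 * r))).
Proof.
  destruct (polar_decomposition h) as (delta & -> & ->).
  pose proof PI_RGT_0 as HPI.
  set (m := v (0, 0)).
  assert (Hm : - r <= m <= r).
  { apply Rabs_le_between, Hb, unit_disk_iff. lra. }
  set (D := vx (0, 0) * cos delta + vy (0, 0) * sin delta).
  assert (Hth : - (PI / 2) <= PI * m / (2 * r) <= PI / 2).
  { split; [apply Rle_div_r | apply Rle_div_l]; nra. }
  assert (Key : D <= 4 * r / PI * cos (PI * m / (2 * r))).
  { set (th := PI * m / (2 * r)) in *.
    assert (Em : PI * m = 2 * r * th) by (unfold th; field; lra).
    assert (B : forall s, 0 < s < 1 -> s * (PI * D) <= 4 * r * cos th).
    { intros s Hs.
      (* With this [alpha] the terms in [sin th] on both sides are equal, and only [4 r cos th]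
         survives on the right. *)
      pose proof (bathtub delta (PI / 2 + th) s ltac:(lra) Hs) as B.
      fold D m in B.
      rewrite cos_plus, sin_plus, cos_PI2, sin_PI2 in B.
      replace (2 * PI * m) with (4 * r * th) in B by lra.
      lra. }
    assert (B1 : PI * D <= 4 * r * cos th).
    { apply Rnot_lt_le; intros Hlt.
      set (K := 4 * r * cos th) in *.
      assert (HK : 0 <= K).
      { unfold K. apply Rmult_le_pos; [lra | apply cos_ge_0; lra]. }
      set (q := K / (PI * D)).
      assert (Hq : 0 <= q < 1).
      { split; [apply Rle_mult_inv_pos; lra | apply Rlt_div_l; lra]. }
      (* This is the limit [s -> 1]: the bound says [s <= q] for every radius [s < 1], which fails
         halfway between [q] and [1]. *)
      specialize (B ((1 + q) / 2) ltac:(lra)).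
      assert (q * (PI * D) = K)
        by (unfold q, Rdiv; rewrite Rmult_assoc, Rinv_l by lra; ring).
      nra. }
    replace (4 * r / PI * cos th) with (4 * r * cos th / PI) by (field; lra).
    apply Rle_div_r; lra. }
  replace (Cmod h * cos delta * vx (0, 0) + Cmod h * sin delta * vy (0, 0))
    with (Cmod h * D) by (unfold D; ring).
  apply Rmult_le_compat_l; [apply Cmod_ge_0 | exact Key].
Qed.
End Bounded_harmonic.

Section Schwarz_Pick.
Variables (r : R) (u ux uy : C -> R).
Hypothesis Hr : 0 < r.
Hypothesis Hu : harmonic_on unit_disk u ux uy.
Hypothesis Hb : forall z, unit_disk z -> Rabs (u z) <= r.

Lemma harmonic_schwarz_pick (z h : C) : unit_disk z ->
  fst h * ux z + snd h * uy z
  <= Cmod h * (4 * r / PI * cos (PI * u z / (2 * r))) / (1 - Cmod z ^ 2).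
Proof.
  intros Hz.
  destruct (harmonic_on_mobius z u ux uy Hz Hu) as (vx & vy & Hv & Ex & Ey).
  assert (Hbv : forall w, unit_disk w -> Rabs (u (mobius z w)) <= r).
  { intros w Hw; now apply Hb, mobius_in_unit_disk. }
  pose proof (gradient_at_center r _ vx vy Hr Hv Hbv h) as G.
  pose proof (mobius_0 z) as E0; unfold RtoC in E0.
  cbv beta in G; rewrite E0, Ex, Ey in G.
  assert (Hd : 0 < 1 - Cmod z ^ 2).
  { unfold unit_disk in Hz; pose proof (Cmod_ge_0 z). nra. }
  apply Rle_div_r; [exact Hd | ]. lra.
Qed.

(** The cosine is estimated by [1]. This weaker form gives the gradient estimate and, integrated,
    the distance estimate; the growth estimate uses the form with the cosine. *)
Lemma harmonic_gradient_bound (z h : C) : unit_disk z ->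
  fst h * ux z + snd h * uy z <= Cmod h * (4 * r / PI) / (1 - Cmod z ^ 2).
Proof.
  intros Hz. apply Rle_trans with (1 := harmonic_schwarz_pick z h Hz).
  assert (Hd : 0 < 1 - Cmod z ^ 2).
  { unfold unit_disk in Hz; pose proof (Cmod_ge_0 z). nra. }
  unfold Rdiv at 1 4. apply Rmult_le_compat_r.
  { left; now apply Rinv_0_lt_compat. }
  apply Rmult_le_compat_l; [apply Cmod_ge_0 | ].
  pose proof PI_RGT_0.
  assert (0 < 4 * r / PI) by (apply Rdiv_lt_0_compat; lra).
  pose proof (COS_bound (PI * u z / (2 * r))). nra.
Qed.

Lemma Cmod_radius (z : C) (t : R) : 0 <= t ->
  Cmod (t * fst z, t * snd z) = t * Cmod z.
Proof.
  intros Ht.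
  replace ((t * fst z, t * snd z) : C) with (RtoC t * z)%C.
  - rewrite Cmod_mult, Cmod_R, Rabs_right; lra.
  - destruct z; apply injective_projections; simpl; ring.
Qed.

Lemma unit_disk_radius (z : C) (t : R) :
  unit_disk z -> 0 <= t <= 1 -> unit_disk (t * fst z, t * snd z).
Proof.
  unfold unit_disk; intros Hz Ht; rewrite Cmod_radius by lra.
  pose proof (Cmod_ge_0 z). nra.
Qed.

Lemma is_derive_along_radius (z : C) (t : R) :
  unit_disk z -> 0 <= t <= 1 ->
  is_derive (fun s => u (s * fst z, s * snd z)) t
    (fst z * ux (t * fst z, t * snd z) + snd z * uy (t * fst z, t * snd z)).
Proof.
  intros Hz Ht.
  rewrite (Rmult_comm (fst z)), (Rmult_comm (snd z)).
  apply (grad_on_chain unit_disk u ux uy (fun s => s * fst z) (fun s => s * snd z)).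
  - apply open_unit_disk.
  - apply Hu.
  - now apply unit_disk_radius.
  - auto_derive; auto; ring.
  - auto_derive; auto; ring.
Qed.
End Schwarz_Pick.

(** * Integration along radii *)

Lemma artanh_0 : artanh 0 = 0.
Proof. unfold artanh. replace ((1 + 0) / (1 - 0)) with 1 by field. rewrite ln_1. field. Qed.

Lemma is_derive_artanh (x : R) : -1 < x < 1 -> is_derive artanh x (/ (1 - x ^ 2)).
Proof.
  intros Hx; unfold artanh; auto_derive.
  - split; [lra | split; [ | auto]]. apply Rdiv_lt_0_compat; lra.
  - field. repeat split; nra.
Qed.

(** The duplication formula says that [2 artanh m] is [artanh (2 m / (1 + m^2))]. This argument is
    also [sin (2 atan m)], which is how [artanh] is traded for [atan]. *)
Lemma double_artanh_le (s m : R) :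
  -1 < s < 1 -> 0 <= m < 1 -> artanh s / 2 <= artanh m -> s <= 2 * m / (1 + m ^ 2).
Proof.
  unfold artanh; intros Hs Hm H.
  assert (HA : 0 < (1 + s) / (1 - s)) by (apply Rdiv_lt_0_compat; lra).
  assert (HB : 0 < (1 + m) / (1 - m)) by (apply Rdiv_lt_0_compat; lra).
  assert (L : (1 + s) / (1 - s) <= (1 + m) / (1 - m) * ((1 + m) / (1 - m))).
  { apply Rnot_lt_le; intros L. apply ln_increasing in L; [ | nra].
    rewrite ln_mult in L by assumption. lra. }
  apply (Rle_div_l (1 + s) _ (1 - s)) in L; [ | lra].
  apply (Rmult_le_compat_r ((1 - m) * (1 - m))) in L; [ | nra].
  replace ((1 + m) / (1 - m) * ((1 + m) / (1 - m)) * (1 - s) * ((1 - m) * (1 - m)))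
    with ((1 + m) * (1 + m) * (1 - s)) in L by (field; lra).
  apply Rle_div_r; [pose proof (pow2_ge_0 m); lra | lra].
Qed.

Lemma sin_double_atan (m : R) : sin (2 * atan m) = 2 * m / (1 + m ^ 2).
Proof.
  rewrite sin_2a, sin_atan, cos_atan.
  assert (H : 0 < 1 + m²) by (pose proof (Rle_0_sqr m); lra).
  pose proof (sqrt_lt_R0 _ H) as H'.
  pose proof (sqrt_def (1 + m²) ltac:(lra)) as E.
  replace (1 + m ^ 2) with (sqrt (1 + m²) * sqrt (1 + m²))
    by (rewrite E; unfold Rsqr; ring).
  field. lra.
Qed.

(** The bound on [F'] is the derivative of [c artanh (t m)] in [t], so the difference of the two
    functions is nondecreasing. *)
Lemma artanh_comparison (c m : R) (F F' : R -> R) :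
  0 <= m < 1 ->
  (forall t, 0 <= t <= 1 -> is_derive F t (F' t)) ->
  (forall t, 0 <= t <= 1 -> F' t <= c * m / (1 - (t * m) ^ 2)) ->
  F 1 - F 0 <= c * artanh m.
Proof.
  intros Hm Hd HF.
  assert (Hpos : forall t, 0 <= t <= 1 -> 0 <= t * m < 1) by (intros; nra).
  assert (DG : forall t, 0 <= t <= 1 -> is_derive (fun t => c * artanh (t * m) - F t) t
                 (c * m / (1 - (t * m) ^ 2) - F' t)).
  { intros t Ht. specialize (Hpos t Ht).
    apply (is_derive_minus (fun t => c * artanh (t * m)) F); [ | now apply Hd].
    replace (c * m / (1 - (t * m) ^ 2)) with (c * (m * / (1 - (t * m) ^ 2)))
      by (unfold Rdiv; ring).
    apply (is_derive_scal (fun t => artanh (t * m))).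
    apply (is_derive_comp artanh (fun t => t * m)).
    - apply is_derive_artanh; lra.
    - auto_derive; auto; ring. }
  destruct (MVT_gen (fun t => c * artanh (t * m) - F t) 0 1
              (fun t => c * m / (1 - (t * m) ^ 2) - F' t)) as [t [Ht E]].
  - intros t Ht. rewrite Rmin_left, Rmax_right in Ht by lra. apply DG; lra.
  - intros t Ht. rewrite Rmin_left, Rmax_right in Ht by lra.
    eapply is_derive_continuity_pt; now apply DG.
  - rewrite Rmin_left, Rmax_right in Ht by lra. specialize (HF t Ht).
    rewrite Rmult_1_l, Rmult_0_l in E.
    rewrite artanh_0 in E. lra.
Qed.

(** Composition with [mobius z1] moves [z1] to [0] and keeps both harmonicity and the bound [r]. The
    gradient bound is then integrated along the radius ending at the preimage of [z2]. *)
Lemma harmonic_distance_upper (r : R) (u ux uy : C -> R) (z1 z2 : C) :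
  0 < r -> harmonic_on unit_disk u ux uy ->
  (forall z, unit_disk z -> Rabs (u z) <= r) ->
  unit_disk z1 -> unit_disk z2 ->
  u z2 - u z1 <= 4 / PI * r * hyperbolic_dist z1 z2.
Proof.
  intros Hr Hu Hb H1 H2.
  destruct (mobius_surjective z1 z2 H1 H2) as [Hz Ez].
  destruct (harmonic_on_mobius z1 u ux uy H1 Hu) as (vx & vy & Hv & _).
  assert (Hbv : forall w, unit_disk w -> Rabs (u (mobius z1 w)) <= r).
  { intros w Hw; now apply Hb, mobius_in_unit_disk. }
  set (z := ((z2 - z1) / (1 - Cconj z1 * z2))%C) in *.
  assert (Em : hyperbolic_dist z1 z2 = artanh (Cmod z)).
  { unfold hyperbolic_dist, z. f_equal. unfold Cdiv. rewrite !Cmod_mult. f_equal.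
    replace (z2 - z1)%C with (- (z1 - z2))%C by ring. now rewrite Cmod_opp. }
  rewrite Em.
  pose proof (artanh_comparison (4 / PI * r) (Cmod z)
    (fun t => u (mobius z1 (t * fst z, t * snd z)))
    (fun t => fst z * vx (t * fst z, t * snd z) + snd z * vy (t * fst z, t * snd z))) as A.
  cbv beta in A.
  replace (1 * fst z, 1 * snd z) with z in A
    by (destruct z; simpl; now rewrite !Rmult_1_l).
  replace (0 * fst z, 0 * snd z) with (RtoC 0) in A
    by (rewrite !Rmult_0_l; reflexivity).
  rewrite Ez, mobius_0 in A. apply A.
  - split; [apply Cmod_ge_0 | exact Hz].
  - intros t Ht. now apply (is_derive_along_radius (fun w => u (mobius z1 w)) vx vy Hv).
  - intros t Ht.
    pose proof (harmonic_gradient_bound r _ vx vy Hr Hv Hbv _ z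
                  (unit_disk_radius z t Hz Ht)) as G.
    rewrite Cmod_radius in G by lra.
    replace (4 / PI * r * Cmod z) with (Cmod z * (4 * r / PI)) by (unfold Rdiv; ring).
    exact G.
Qed.

Lemma harmonic_growth_upper (r : R) (u ux uy : C -> R) (z : C) :
  0 < r -> harmonic_on unit_disk u ux uy ->
  (forall z, unit_disk z -> Rabs (u z) < r) -> u (RtoC 0) = 0 ->
  unit_disk z -> u z <= 4 / PI * r * atan (Cmod z).
Proof.
  intros Hr Hu Hb H0 Hz.
  pose proof PI_RGT_0 as HPI.
  set (m := Cmod z). assert (Hm : 0 <= m < 1) by (split; [apply Cmod_ge_0 | exact Hz]).
  set (th := fun t => PI * u (t * fst z, t * snd z) / (2 * r)).
  set (du := fun t => fst z * ux (t * fst z, t * snd z) + snd z * uy (t * fst z, t * snd z)).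
  pose proof (fun t Ht => unit_disk_radius z t Hz Ht) as Hdisk.
  assert (Hth : forall t, 0 <= t <= 1 -> - (PI / 2) < th t < PI / 2).
  { intros t Ht. pose proof (Hb _ (Hdisk t Ht)) as B. apply Rabs_lt_between in B.
    unfold th. split; [apply Rlt_div_r | apply Rlt_div_l]; nra. }
  assert (Hcos : forall t, 0 <= t <= 1 -> 0 < cos (th t)).
  { intros t Ht. apply cos_gt_0; apply (Hth t Ht). }
  assert (Hsin : forall t, 0 <= t <= 1 -> -1 < sin (th t) < 1).
  { intros t Ht. pose proof (sin2_cos2 (th t)) as E; unfold Rsqr in E.
    specialize (Hcos t Ht). nra. }
  (* The derivative of [artanh (sin th) / 2] is [th' / (2 cos th)]: the division by the cosine
     absorbs exactly the factor in the Schwarz-Pick inequality. The strict bound on [u] keeps this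
     cosine positive. *)
  pose proof (artanh_comparison 1 m (fun t => artanh (sin (th t)) / 2)
    (fun t => PI / (4 * r) * du t / cos (th t)) Hm) as A.
  cbv beta in A.
  assert (HA : artanh (sin (th 1)) / 2 - artanh (sin (th 0)) / 2 <= 1 * artanh m).
  { apply A.
    - intros t Ht. pose proof (is_derive_along_radius u ux uy Hu z t Hz Ht) as D.
      fold (du t) in D.
      assert (Dth : is_derive th t (PI / (2 * r) * du t)).
      { apply is_derive_ext with (fun t => PI / (2 * r) * u (t * fst z, t * snd z)).
        - intros s; unfold th; simpl; field; lra.
        - now apply (is_derive_scal (fun t => u (t * fst z, t * snd z))). }
      specialize (Hsin t Ht). specialize (Hcos t Ht).
      apply is_derive_ext with (fun t => / 2 * artanh (sin (th t))).
      { intros; simpl; field. }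
      replace (PI / (4 * r) * du t / cos (th t)) with
        (/ 2 * (PI / (2 * r) * du t * cos (th t) * / (1 - sin (th t) ^ 2))).
      2:{ pose proof (sin2_cos2 (th t)) as E; unfold Rsqr in E.
          replace (1 - sin (th t) ^ 2) with (cos (th t) * cos (th t)) by (simpl; lra).
          field; lra. }
      apply (is_derive_scal (fun t => artanh (sin (th t)))).
      apply (is_derive_comp artanh (fun t => sin (th t))); [now apply is_derive_artanh | ].
      apply (is_derive_comp sin th); [apply is_derive_sin | exact Dth].
    - intros t Ht. specialize (Hcos t Ht).
      pose proof (harmonic_schwarz_pick r u ux uy Hr Hu
                    (fun z Hz => Rlt_le _ _ (Hb z Hz)) _ z (Hdisk t Ht)) as G.
      fold (du t) (th t) in G. rewrite Cmod_radius in G by lra. fold m in G.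
      apply Rle_div_l; [exact Hcos | ].
      assert (Htm : 0 <= t * m < 1) by nra.
      assert (Hd : 0 < 1 - (t * m) ^ 2) by nra.
      replace (1 * m / (1 - (t * m) ^ 2) * cos (th t)) with
        (PI / (4 * r) * (m * (4 * r / PI * cos (th t)) / (1 - (t * m) ^ 2)))
        by (field; repeat split; lra).
      apply Rmult_le_compat_l; [ | exact G].
      left; apply Rdiv_lt_0_compat; lra. }
  assert (E0 : th 0 = 0).
  { unfold th. replace ((0 * fst z, 0 * snd z) : C) with (RtoC 0)
      by (rewrite !Rmult_0_l; reflexivity).
    rewrite H0. unfold Rdiv; ring. }
  rewrite E0, sin_0, artanh_0 in HA.
  (* Both [th 1] and [2 atan m] lie where the sine is increasing, so the sines can be removed
     afterwards. *)
  assert (B : sin (th 1) <= sin (2 * atan m)).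
  { rewrite sin_double_atan.
    apply double_artanh_le; [apply Hsin; lra | exact Hm | lra]. }
  pose proof (atan_bound m) as Bm.
  assert (Bm1 : atan m < PI / 4) by (rewrite <- atan_1; apply atan_increasing; lra).
  assert (Bm0 : 0 <= atan m).
  { rewrite <- atan_0. destruct (proj1 Hm) as [L | <-]; [ | lra].
    left; now apply atan_increasing. }
  pose proof (Hth 1 ltac:(lra)) as H1.
  apply sin_incr_0 in B; try lra.
  unfold th in B. replace ((1 * fst z, 1 * snd z) : C) with z in B
    by (destruct z; simpl; now rewrite !Rmult_1_l).
  apply (Rle_div_l (PI * u z) _ (2 * r)) in B; [ | lra].
  apply (Rmult_le_compat_l (/ PI)) in B; [ | left; apply Rinv_0_lt_compat; lra].
  replace (/ PI * (PI * u z)) with (u z) in B by (field; lra).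
  replace (4 / PI * r * atan m) with (/ PI * (2 * atan m * (2 * r))) by (field; lra).
  exact B.
Qed.

(** * Lengths and distances *)

Lemma C1_on_grad (W : C -> Prop) (u : C -> R) :
  Defs.C1_on W u -> grad_on W u (Defs.Dx u) (Dy u).
Proof.
  intros H x y Hz. destruct (H (x, y) Hz) as (H1 & H2 & H3 & H4).
  refine (conj _ (conj _ (conj _ _))); auto.
  - apply Derive_correct; exact H1.
  - apply Derive_correct; exact H2.
Qed.

Lemma conformal_metric_continuous (D : C -> Prop) (rho : C -> R) (w : C) :
  open D -> conformal_metric D rho -> D w -> continuous rho w.
Proof.
  intros HD [_ HC] Hw. apply (grad_on_continuous D rho _ _ w HD (C1_on_grad D rho HC) Hw).
Qed.

(** The derivative relative to a set, as a first-order error bound without quotients. The case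
    [s = t] needs no exclusion, endpoints are handled like interior points, and such bounds compose
    even when the inner map is only controlled indirectly. *)
Definition deriv_in (I : R -> Prop) (h : R -> R) (t l : R) : Prop :=
  forall eps, 0 < eps -> exists delta, 0 < delta /\
    forall s, I s -> Rabs (s - t) < delta ->
      Rabs (h s - h t - l * (s - t)) <= eps * Rabs (s - t).

Definition cont_in (I : R -> Prop) (h : R -> R) (t : R) : Prop :=
  filterlim h (within I (locally t)) (locally (h t)).

Lemma cont_in_eps (I : R -> Prop) (h : R -> R) (t : R) :
  cont_in I h t <->
  forall eps, 0 < eps -> exists delta, 0 < delta /\
    forall s, I s -> Rabs (s - t) < delta -> Rabs (h s - h t) < eps.
Proof.
  unfold cont_in; rewrite filterlim_locally; split.
  - intros H eps He. destruct (H (mkposreal eps He)) as [d Hd].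
    exists d; split; [apply cond_pos | ]. intros s Hs Hst. exact (Hd s Hst Hs).
  - intros H eps. destruct (H eps (cond_pos eps)) as (d & Hd & Hs).
    exists (mkposreal d Hd). intros s Hst HI. apply (Hs s HI Hst).
Qed.

Lemma deriv_in_cont (I : R -> Prop) (h : R -> R) (t l : R) :
  deriv_in I h t l -> cont_in I h t.
Proof.
  intros H; apply cont_in_eps; intros eps He.
  destruct (H 1 Rlt_0_1) as (d & Hd & Hs).
  pose proof (Rabs_pos l) as Hl.
  exists (Rmin d (eps / (2 + Rabs l))). split.
  - apply Rmin_glb_lt; [assumption | apply Rdiv_lt_0_compat; lra].
  - intros s HI Hst.
    pose proof (Hs s HI (Rlt_le_trans _ _ _ Hst (Rmin_l _ _))) as B.
    pose proof (Rlt_le_trans _ _ _ Hst (Rmin_r _ _)) as B'.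
    apply Rlt_div_r in B'; [ | lra].
    replace (h s - h t) with ((h s - h t - l * (s - t)) + l * (s - t)) by ring.
    apply Rle_lt_trans with (1 := Rabs_triang _ _).
    rewrite Rabs_mult. pose proof (Rabs_pos (s - t)). nra.
Qed.

Lemma C_quotient_bound (p l : C) (d eps : R) :
  d <> 0 -> Rabs (fst ((p / RtoC d)%C) - fst l) < eps ->
  Rabs (snd ((p / RtoC d)%C) - snd l) < eps ->
  Rabs (fst p - fst l * d) <= eps * Rabs d /\ Rabs (snd p - snd l * d) <= eps * Rabs d.
Proof.
  intros Hd H1 H2.
  assert (E1 : fst ((p / RtoC d)%C) = fst p / d) by (simpl; field; auto).
  assert (E2 : snd ((p / RtoC d)%C) = snd p / d) by (simpl; field; auto).
  rewrite E1 in H1. rewrite E2 in H2.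
  split.
  - replace (fst p - fst l * d) with ((fst p / d - fst l) * d) by (field; auto).
    rewrite Rabs_mult. apply Rmult_le_compat_r; [apply Rabs_pos | lra].
  - replace (snd p - snd l * d) with ((snd p / d - snd l) * d) by (field; auto).
    rewrite Rabs_mult. apply Rmult_le_compat_r; [apply Rabs_pos | lra].
Qed.

Lemma C1_path_deriv (I : R -> Prop) (g g' : R -> C) (t : R) :
  C1_path I g g' -> I t ->
  deriv_in I (fun s => fst (g s)) t (fst (g' t)) /\
  deriv_in I (fun s => snd (g s)) t (snd (g' t)).
Proof.
  intros HP Ht. destruct (HP t Ht) as [Hq _].
  assert (Q : forall eps, 0 < eps -> exists delta, 0 < delta /\
    forall s, I s -> Rabs (s - t) < delta ->
      Rabs (fst (g s) - fst (g t) - fst (g' t) * (s - t)) <= eps * Rabs (s - t) /\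
      Rabs (snd (g s) - snd (g t) - snd (g' t) * (s - t)) <= eps * Rabs (s - t)).
  { intros eps He.
    apply filterlim_locally with (eps := mkposreal eps He) in Hq.
    destruct Hq as [d Hd]. exists d; split; [apply cond_pos | ].
    intros s Hs Hst.
    destruct (Req_dec s t) as [-> | Hne].
    - rewrite !Rminus_diag, !Rmult_0_r, Rminus_0_r, Rabs_R0. lra.
    - assert (Hne' : s - t <> 0) by lra.
      destruct (Hd s Hst Hne Hs) as [B1 B2].
      apply (C_quotient_bound (g s - g t) (g' t) (s - t) eps Hne' B1 B2). }
  split; intros eps He; destruct (Q eps He) as (d & Hd & H); exists d; split; auto;
    intros s Hs Hst; now apply H.
Qed.

Lemma C_filterlim_pair (F : (R -> Prop) -> Prop) (FF : Filter F) (f : R -> C) (l : C) :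
  filterlim (fun t => fst (f t)) F (locally (fst l)) ->
  filterlim (fun t => snd (f t)) F (locally (snd l)) ->
  filterlim f F (locally l).
Proof.
  intros H1 H2. apply filterlim_locally; intros eps.
  generalize (filter_and _ _ (proj1 (filterlim_locally _ _) H1 eps)
                (proj1 (filterlim_locally _ _) H2 eps)).
  apply filter_imp; intros t [B1 B2]. split; assumption.
Qed.

Lemma C1_path_continuous (I : R -> Prop) (g g' : R -> C) (t : R) :
  C1_path I g g' -> I t -> filterlim g (within I (locally t)) (locally (g t)).
Proof.
  intros HP Ht. destruct (C1_path_deriv I g g' t HP Ht) as [D1 D2].
  apply C_filterlim_pair.
  - apply within_filter, locally_filter.
  - apply (deriv_in_cont I (fun s => fst (g s)) t _ D1).
  - apply (deriv_in_cont I (fun s => snd (g s)) t _ D2).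
Qed.

Lemma cont_in_comp (I : R -> Prop) (g : R -> C) (h : C -> R) (t : R) :
  filterlim g (within I (locally t)) (locally (g t)) -> continuous h (g t) ->
  cont_in I (fun s => h (g s)) t.
Proof. intros Hg Hh. now apply (filterlim_comp _ _ _ g h _ (locally (g t))). Qed.

Lemma cont_in_mult (I : R -> Prop) (f h : R -> R) (t : R) :
  cont_in I f t -> cont_in I h t -> cont_in I (fun s => f s * h s) t.
Proof.
  intros Hf Hh.
  apply (filterlim_comp_2 (G := locally (f t)) (H := locally (h t)) f h Rmult); auto.
  apply (filterlim_mult (K := R_AbsRing)).
Qed.

Lemma cont_in_plus (I : R -> Prop) (f h : R -> R) (t : R) :
  cont_in I f t -> cont_in I h t -> cont_in I (fun s => f s + h s) t.
Proof.
  intros Hf Hh.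
  apply (filterlim_comp_2 (G := locally (f t)) (H := locally (h t)) f h Rplus); auto.
  apply (filterlim_plus (V := R_NormedModule)).
Qed.

Lemma cont_in_subset (I J : R -> Prop) (f : R -> R) (t : R) :
  (forall s, J s -> I s) -> cont_in I f t -> cont_in J f t.
Proof.
  rewrite !cont_in_eps; intros HJ H eps He.
  destruct (H eps He) as (d & Hd & Hs). exists d; split; auto.
Qed.

Definition interval (a b t : R) : Prop := a <= t <= b.
(** The nearest-point retraction onto the interval. Composing with it extends a function continuous
    on the interval to one continuous on the whole line, as needed for integrals and their
    derivatives. *)
Definition clamp (a b t : R) : R := Rmax a (Rmin t b).

Lemma clamp_interval (a b t : R) : a <= b -> interval a b (clamp a b t).
Proof.
  intros H; unfold interval, clamp; split; [apply Rmax_l | ].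
  apply Rmax_lub; [assumption | apply Rmin_r].
Qed.

Lemma clamp_id (a b t : R) : a <= t <= b -> clamp a b t = t.
Proof. intros H; unfold clamp. rewrite Rmin_left, Rmax_right; lra. Qed.

Lemma clamp_lipschitz (a b s t : R) : Rabs (clamp a b s - clamp a b t) <= Rabs (s - t).
Proof.
  assert (H : Rabs (s - t) <= Rabs (s - t)) by lra. apply Rabs_le_between in H.
  apply Rabs_le. unfold clamp, Rmax, Rmin.
  repeat destruct Rle_dec; lra.
Qed.

Lemma filterlim_clamp (a b t : R) : a <= b ->
  filterlim (clamp a b) (locally t) (within (interval a b) (locally (clamp a b t))).
Proof.
  intros Hab P [d HP]. exists d; intros s Hs. apply HP.
  - apply Rle_lt_trans with (2 := Hs). apply clamp_lipschitz.
  - now apply clamp_interval.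
Qed.

Lemma continuous_clamp (T : UniformSpace) (h : R -> T) (a b t : R) : a <= b ->
  (forall s, interval a b s -> filterlim h (within (interval a b) (locally s)) (locally (h s))) ->
  continuous (fun s => h (clamp a b s)) t.
Proof.
  intros Hab H.
  apply (filterlim_comp _ _ _ (clamp a b) h _ (within (interval a b) (locally (clamp a b t)))).
  - now apply filterlim_clamp.
  - now apply H, clamp_interval.
Qed.

Lemma ex_RInt_cont_in (h : R -> R) (a b : R) : a <= b ->
  (forall t, interval a b t -> cont_in (interval a b) h t) -> ex_RInt h a b.
Proof.
  intros Hab H.
  apply ex_RInt_ext with (fun t => h (clamp a b t)).
  - intros t Ht. rewrite Rmin_left, Rmax_right in Ht by lra. rewrite clamp_id by lra.
    reflexivity.
  - apply (ex_RInt_continuous (V := R_CompleteNormedModule)); intros t _.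
    now apply continuous_clamp.
Qed.

Section Metric.
Variables (D : C -> Prop) (rho : C -> R).
Hypothesis HD : open D.
Hypothesis Hrho : conformal_metric D rho.

Lemma speed_cont_in (I : R -> Prop) (g g' : R -> C) (t : R) :
  C1_path I g g' -> I t -> D (g t) ->
  cont_in I (fun s => rho (g s) * Cmod (g' s)) t.
Proof.
  intros HP Ht HDt. apply cont_in_mult.
  - apply cont_in_comp; [now apply C1_path_continuous with g' | ].
    now apply conformal_metric_continuous with D.
  - apply cont_in_comp; [now apply (HP t Ht) | apply continuous_Cmod].
Qed.

Lemma ex_RInt_speed (g g' : R -> C) (a b : R) : a <= b ->
  C1_path (interval a b) g g' -> (forall t, interval a b t -> D (g t)) ->
  ex_RInt (fun t => rho (g t) * Cmod (g' t)) a b.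
Proof.
  intros Hab HP Hg. apply ex_RInt_cont_in; [assumption | ].
  intros t Ht. apply speed_cont_in; auto.
Qed.

Lemma curve_length_nonneg (w1 w2 : C) (l : R) : curve_length D rho w1 w2 l -> 0 <= l.
Proof.
  intros H; induction H as [g g' a b Hab HP Hg | w1 w2 w3 l1 l2 _ IH1 _ IH2].
  - apply RInt_ge_0; [lra | apply ex_RInt_speed; auto; lra | ].
    intros t Ht. apply Rmult_le_pos; [ | apply Cmod_ge_0].
    left; apply Hrho, Hg; lra.
  - lra.
Qed.

(** The default values of [real] must be ruled out: nonnegativity of lengths excludes an infimum of
    minus infinity, and the given curve excludes plus infinity. *)
Lemma rho_dist_le (w1 w2 : C) (l : R) : curve_length D rho w1 w2 l -> rho_dist D rho w1 w2 <= l.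
Proof.
  intros H; unfold rho_dist.
  destruct (Glb_Rbar_correct (curve_length D rho w1 w2)) as [Hlb Hglb].
  assert (H0 : Rbar_le 0 (Glb_Rbar (curve_length D rho w1 w2))).
  { apply Hglb; intros x Hx; simpl. now apply curve_length_nonneg with w1 w2. }
  specialize (Hlb l H).
  destruct (Glb_Rbar (curve_length D rho w1 w2)); simpl in *; tauto.
Qed.

Lemma C1_path_reverse (g g' : R -> C) (a b : R) :
  C1_path (interval a b) g g' ->
  C1_path (interval a b) (fun t => g (a + b - t)) (fun t => Copp (g' (a + b - t))).
Proof.
  intros HP t Ht.
  assert (Ht' : interval a b (a + b - t)) by (unfold interval in *; lra).
  destruct (HP _ Ht') as [H1 H2]. split.
  - apply filterlim_ext_loc with
      (fun s => Copp ((g (a + b - s)%R - g (a + b - t)%R) / RtoC ((a + b - s) - (a + b - t)))%C).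
    + exists (mkposreal 1 Rlt_0_1). intros s _ Hne _.
      assert (s - t <> 0) by lra.
      assert (E : RtoC (a + b - s - (a + b - t)) = (- RtoC (s - t))%C).
      { rewrite <- RtoC_opp. f_equal; ring. }
      rewrite E. field. intros E0. apply (f_equal fst) in E0; simpl in E0; lra.
    + apply (filterlim_comp _ _ _
        (fun s => ((g (a + b - s)%R - g (a + b - t)%R) / RtoC ((a + b - s) - (a + b - t)))%C)
        Copp _ (locally (g' (a + b - t)))).
      2:{ apply (filterlim_opp (V := C_NormedModule)). }
      apply (filterlim_comp _ _ _ (fun s => a + b - s)
        (fun s => ((g s - g (a + b - t)%R) / RtoC (s - (a + b - t)))%C) _
        (within (interval a b) (locally' (a + b - t)))); [ | exact H1].
      intros P [d Hd]. exists d; intros s Hs Hne HI. apply Hd.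
      * unfold ball in *; simpl in *; unfold AbsRing_ball, abs, minus, plus, opp in *; simpl in *.
        replace (a + b - s + - (a + b - t)) with (- (s + - t)) by ring.
        now rewrite Rabs_Ropp.
      * lra.
      * unfold interval in *; lra.
  - apply (filterlim_comp _ _ _ (fun s => g' (a + b - s)) Copp _ (locally (g' (a + b - t)))).
    2:{ apply (filterlim_opp (V := C_NormedModule)). }
    apply (filterlim_comp _ _ _ (fun s => a + b - s) g' _
        (within (interval a b) (locally (a + b - t)))); [ | exact H2].
    intros P [d Hd]. exists d; intros s Hs HI. apply Hd.
    + unfold ball in *; simpl in *; unfold AbsRing_ball, abs, minus, plus, opp in *; simpl in *.
      replace (a + b - s + - (a + b - t)) with (- (s + - t)) by ring.
      now rewrite Rabs_Ropp.
    + unfold interval in *; lra.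
Qed.

Lemma curve_length_sym (w1 w2 : C) (l : R) :
  curve_length D rho w1 w2 l -> curve_length D rho w2 w1 l.
Proof.
  intros H; induction H as [g g' a b Hab HP Hg | w1 w2 w3 l1 l2 _ IH1 _ IH2].
  - pose proof (curve_piece D rho (fun t => g (a + b - t)) (fun t => Copp (g' (a + b - t))) a b
                  Hab (C1_path_reverse g g' a b HP)) as P.
    cbv beta in P.
    replace (a + b - a) with b in P by ring. replace (a + b - b) with a in P by ring.
    replace (rho_length rho g g' a b) with
      (rho_length rho (fun t => g (a + b - t)) (fun t => Copp (g' (a + b - t))) a b).
    + apply P. intros t Ht; apply Hg; lra.
    + unfold rho_length.
      pose proof (RInt_comp_lin (V := R_CompleteNormedModule)
                    (fun t => rho (g t) * Cmod (g' t)) (-1) (a + b) a b) as E.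
      replace (-1 * a + (a + b)) with b in E by ring.
      replace (-1 * b + (a + b)) with a in E by ring.
      assert (EX : ex_RInt (fun t => rho (g t) * Cmod (g' t)) a b).
      { apply ex_RInt_speed; auto; lra. }
      specialize (E (ex_RInt_swap _ _ _ EX)).
      rewrite <- (opp_RInt_swap (fun t => rho (g t) * Cmod (g' t)) b a) by now apply ex_RInt_swap.
      rewrite <- E.
      rewrite <- RInt_opp.
      * apply RInt_ext_all. intros t.
        unfold opp, scal; simpl; unfold mult; simpl.
        replace (-1 * t + (a + b)) with (a + b - t) by ring.
        rewrite Cmod_opp. ring.
      * apply (ex_RInt_comp_lin (V := R_CompleteNormedModule)
                    (fun t => rho (g t) * Cmod (g' t)) (-1) (a + b) a b).
        replace (-1 * a + (a + b)) with b by ring.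
        replace (-1 * b + (a + b)) with a by ring.
        now apply ex_RInt_swap.
  - rewrite Rplus_comm. now apply curve_concat with w2.
Qed.

Lemma rho_dist_sym (w1 w2 : C) : rho_dist D rho w1 w2 = rho_dist D rho w2 w1.
Proof.
  unfold rho_dist. f_equal. apply Glb_Rbar_eqset. intros l; split; apply curve_length_sym.
Qed.

(** The straight segment is a competitor; this is the way in which [rho_dist] is bounded by a
    Euclidean distance. *)
Lemma rho_dist_segment (w1 w2 : C) (M : R) :
  (forall t, 0 <= t <= 1 -> let w := (w1 + RtoC t * (w2 - w1))%C in D w /\ rho w <= M) ->
  rho_dist D rho w1 w2 <= M * Cmod (w2 - w1).
Proof.
  intros H.
  set (g := fun t : R => (w1 + RtoC t * (w2 - w1))%C).
  assert (HP : C1_path (interval 0 1) g (fun _ => (w2 - w1)%C)).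
  { intros t Ht; split.
    - apply filterlim_ext_loc with (fun _ => (w2 - w1)%C); [ | apply filterlim_const].
      exists (mkposreal 1 Rlt_0_1). intros s _ Hne _.
      unfold g. rewrite RtoC_minus. field.
      rewrite <- RtoC_minus. intros E. apply (f_equal fst) in E; simpl in E; lra.
    - apply filterlim_const. }
  assert (P : curve_length D rho (g 0) (g 1) (rho_length rho g (fun _ => (w2 - w1)%C) 0 1)).
  { apply curve_piece; [lra | exact HP | ]. intros t Ht; now apply H. }
  replace (g 0) with w1 in P by (unfold g; ring).
  replace (g 1) with w2 in P by (unfold g; ring).
  apply Rle_trans with (1 := rho_dist_le _ _ _ P).
  unfold rho_length.
  replace (M * Cmod (w2 - w1)) with (RInt (fun _ => M * Cmod (w2 - w1)) 0 1).
  - apply RInt_le; [lra | | apply ex_RInt_const | ].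
    + apply ex_RInt_speed; [lra | exact HP | ]. intros t Ht; now apply H.
    + intros t Ht. apply Rmult_le_compat_r; [apply Cmod_ge_0 | ]. apply H; lra.
  - rewrite RInt_const. unfold scal; simpl; unfold mult; simpl. ring.
Qed.
End Metric.

(** * The geodesic equation *)

Lemma is_derive_deriv_in (I : R -> Prop) (h : R -> R) (t l : R) :
  is_derive h t l -> deriv_in I h t l.
Proof.
  intros [_ H] eps He.
  destruct (H t (fun P HP => HP) (mkposreal eps He)) as [d Hd].
  exists d; split; [apply cond_pos | ]. intros s _ Hs.
  specialize (Hd s Hs).
  unfold norm, minus, plus, opp, scal in Hd; simpl in Hd.
  unfold abs, mult in Hd; simpl in Hd.
  replace (h s - h t - l * (s - t)) with (h s + - h t + - ((s + - t) * l)) by ring.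
  exact Hd.
Qed.

Lemma deriv_in_lin (I : R -> Prop) (f h : R -> R) (t l m c : R) :
  deriv_in I f t l -> deriv_in I h t m ->
  deriv_in I (fun s => f s + c * h s) t (l + c * m).
Proof.
  intros Hf Hh eps He.
  pose proof (Rabs_pos c) as Hc.
  destruct (Hf (eps / 2) ltac:(lra)) as (d1 & Hd1 & H1).
  destruct (Hh (eps / (2 * (1 + Rabs c)))) as (d2 & Hd2 & H2).
  { apply Rdiv_lt_0_compat; lra. }
  exists (Rmin d1 d2); split; [now apply Rmin_glb_lt | ].
  intros s Hs Hst.
  specialize (H1 s Hs (Rlt_le_trans _ _ _ Hst (Rmin_l _ _))).
  specialize (H2 s Hs (Rlt_le_trans _ _ _ Hst (Rmin_r _ _))).
  replace (f s + c * h s - (f t + c * h t) - (l + c * m) * (s - t))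
    with ((f s - f t - l * (s - t)) + c * (h s - h t - m * (s - t))) by ring.
  apply Rle_trans with (1 := Rabs_triang _ _). rewrite Rabs_mult.
  apply (Rmult_le_compat_l (Rabs c)) in H2; [ | assumption].
  assert (E : Rabs c * (eps / (2 * (1 + Rabs c)) * Rabs (s - t))
              <= eps / 2 * Rabs (s - t)).
  { rewrite <- Rmult_assoc. apply Rmult_le_compat_r; [apply Rabs_pos | ].
    replace (Rabs c * (eps / (2 * (1 + Rabs c)))) with
      (Rabs c * (eps / 2) / (1 + Rabs c)) by (field; lra).
    apply Rle_div_l; nra. }
  lra.
Qed.

Lemma C1_path_intro (I : R -> Prop) (g g' : R -> C) :
  (forall t, I t ->
     deriv_in I (fun s => fst (g s)) t (fst (g' t)) /\
     deriv_in I (fun s => snd (g s)) t (snd (g' t)) /\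
     cont_in I (fun s => fst (g' s)) t /\ cont_in I (fun s => snd (g' s)) t) ->
  C1_path I g g'.
Proof.
  intros H t Ht. destruct (H t Ht) as (D1 & D2 & C1 & C2). split.
  - assert (Q : forall (h : R -> R) l, deriv_in I h t l ->
      filterlim (fun s => (h s - h t) / (s - t)) (within I (locally' t)) (locally l)).
    { intros h l Hd. apply filterlim_locally; intros eps.
      destruct (Hd (eps / 2) ltac:(apply Rdiv_lt_0_compat; [apply cond_pos | lra]))
        as (d & Hd0 & Hs).
      exists (mkposreal d Hd0). intros s Hst Hne HI.
      specialize (Hs s HI Hst).
      assert (Hne' : s - t <> 0) by lra.
      unfold ball; simpl; unfold AbsRing_ball, abs, minus, plus, opp; simpl.
      replace ((h s - h t) / (s - t) + - l) with ((h s - h t - l * (s - t)) / (s - t))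
        by (field; auto).
      unfold Rdiv; rewrite Rabs_mult, Rabs_inv.
      pose proof (Rabs_pos_lt _ Hne') as Hp.
      pose proof (cond_pos eps).
      apply Rlt_div_l; [exact Hp | ]. nra. }
    apply C_filterlim_pair.
    + apply within_filter, within_filter, locally_filter.
    + apply filterlim_ext_loc with (2 := Q _ _ D1).
      exists (mkposreal 1 Rlt_0_1). intros s _ Hne _. simpl. field. lra.
    + apply filterlim_ext_loc with (2 := Q _ _ D2).
      exists (mkposreal 1 Rlt_0_1). intros s _ Hne _. simpl. field. lra.
  - apply C_filterlim_pair; auto. apply within_filter, locally_filter.
Qed.

(** Compactness of the interval: neighbourhoods of the points [(0, t)] contain a strip of uniform
    width. *)
Lemma tube (P : R -> R -> Prop) (a b : R) :
  (forall t, a <= t <= b -> locally_2d P 0 t) ->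
  exists delta : posreal, forall e t, Rabs e < delta -> a <= t <= b -> P e t.
Proof.
  intros H.
  (* The indicator function of [P] is locally [1] along the interval, hence continuous there;
     uniform continuity on the compact interval supplies the width. *)
  set (f := fun e t => if excluded_middle_informative (P e t) then 1 else 0).
  assert (Cf : forall t, a <= t <= b -> continuity_2d_pt f 0 t).
  { intros t Ht. apply continuity_2d_pt_ext_loc with (fun _ _ => 1);
      [ | apply continuity_2d_pt_const].
    destruct (H t Ht) as [d Hd]. exists d; intros u v Hu Hv.
    unfold f. destruct excluded_middle_informative as [_ | N]; [reflexivity | ].
    exfalso; apply N; auto. }
  destruct (uniform_continuity_2d_1d' f a b 0 Cf (mkposreal 1 Rlt_0_1)) as [d Hd].
  exists d; intros e t He Ht.
  apply Rabs_lt_between in He.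
  specialize (Hd t 0 t e Ht). simpl in Hd.
  assert (E0 : f 0 t = 1).
  { unfold f. destruct excluded_middle_informative as [_ | N]; [reflexivity | ].
    exfalso; apply N; now apply locally_2d_singleton, H. }
  assert (B : Rabs (f e t - f 0 t) < 1).
  { apply Hd; try lra. rewrite Rminus_diag, Rabs_R0. apply cond_pos. }
  rewrite E0 in B. unfold f in B.
  destruct (excluded_middle_informative (P e t)) as [Y | N]; [exact Y | ].
  rewrite Rabs_left in B; lra.
Qed.

Lemma RInt_square_eq_0 (f : R -> R) (a b : R) :
  a < b -> (forall t, continuous f t) -> RInt (fun t => f t * f t) a b = 0 ->
  forall t, a <= t <= b -> f t = 0.
Proof.
  intros Hab Hc H0 t Ht.
  destruct (Req_dec (f t) 0) as [E | N]; [exact E | exfalso].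
  assert (C2 : forall s, continuous (fun t => f t * f t) s).
  { intros s; now apply (continuous_mult f f). }
  assert (EX : forall p q, ex_RInt (fun t => f t * f t) p q).
  { intros; apply (ex_RInt_continuous (V := R_CompleteNormedModule)); auto. }
  assert (HL : locally t (fun s => f s <> 0)).
  { apply (Hc t (fun y => y <> 0)). apply (open_neq 0 (f t) N). }
  destruct HL as [d Hd].
  assert (Hp : exists p q, a <= p /\ p < q /\ q <= b /\ forall s, p < s < q -> f s <> 0).
  { pose proof (cond_pos d).
    exists (Rmax a (t - d)), (Rmin b (t + d)).
    pose proof (Rmax_l a (t - d)); pose proof (Rmax_r a (t - d)).
    pose proof (Rmin_l b (t + d)); pose proof (Rmin_r b (t + d)).
    repeat split; auto.
    - apply Rmax_lub_lt; apply Rmin_glb_lt; lra.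
    - intros s Hs. apply Hd. unfold ball; simpl; unfold AbsRing_ball, abs, minus, plus, opp; simpl.
      apply Rabs_lt_between; lra. }
  destruct Hp as (p & q & Hap & Hpq & Hqb & Hf).
  assert (P1 : 0 < RInt (fun t => f t * f t) p q).
  { apply RInt_gt_0; auto. intros s Hs. specialize (Hf s Hs). nra. }
  assert (P2 : 0 <= RInt (fun t => f t * f t) a p) by (apply RInt_ge_0; auto; intros; nra).
  assert (P3 : 0 <= RInt (fun t => f t * f t) q b) by (apply RInt_ge_0; auto; intros; nra).
  rewrite <- (RInt_Chasles _ a p b), <- (RInt_Chasles _ p q b) in H0 by auto.
  unfold plus in H0; simpl in H0. lra.
Qed.

(* With [G] a primitive of [K], integration by parts and the test function
   [phi' = F - G - mean] force [F - G] to be constant. *)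
Lemma du_bois_reymond (F K : R -> R) (a b : R) :
  a < b -> (forall t, continuous F t) -> (forall t, continuous K t) ->
  (forall phi psi : R -> R, (forall t, is_derive phi t (psi t)) ->
     (forall t, continuous psi t) -> phi a = 0 -> phi b = 0 ->
     RInt (fun t => K t * phi t + F t * psi t) a b = 0) ->
  F b - F a = RInt K a b.
Proof.
  intros Hab CF CK Hvar.
  assert (EX : forall (f : R -> R) p q, (forall t, continuous f t) -> ex_RInt f p q).
  { intros f p q Hf; apply (ex_RInt_continuous (V := R_CompleteNormedModule)); auto. }
  assert (DI : forall (f : R -> R) t, (forall t, continuous f t) ->
            is_derive (fun t => RInt f a t) t (f t)).
  { intros f t Hf. apply (is_derive_RInt f (fun t => RInt f a t) a t); [ | apply Hf].
    apply filter_forall. intros s. apply (RInt_correct f). now apply EX. }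
  set (G := fun t => RInt K a t).
  assert (DG : forall t, is_derive G t (K t)) by (intros; now apply DI).
  assert (CG : forall t, continuous G t).
  { intros t; apply (ex_derive_continuous (V := R_NormedModule)). now exists (K t). }
  set (c := RInt (fun t => F t - G t) a b / (b - a)).
  set (psi := fun t => F t - G t - c).
  assert (CFG : forall t, continuous (fun t => F t - G t) t).
  { intros t; now apply (continuous_minus F G). }
  assert (Cpsi : forall t, continuous psi t).
  { intros t; apply (continuous_minus (fun t => F t - G t) (fun _ => c)); auto.
    apply continuous_const. }
  set (phi := fun t => RInt psi a t).
  assert (Dphi : forall t, is_derive phi t (psi t)) by (intros; now apply DI).
  assert (Cphi : forall t, continuous phi t).
  { intros t; apply (ex_derive_continuous (V := R_NormedModule)). now exists (psi t). }
  assert (Pa : phi a = 0) by (unfold phi; now rewrite RInt_point).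
  assert (Pb : phi b = 0).
  { unfold phi, psi.
    rewrite (RInt_minus (fun t => F t - G t) (fun _ => c)); auto.
    2:{ apply EX; intros; apply continuous_const. }
    rewrite RInt_const. unfold minus, plus, opp, scal; simpl; unfold mult; simpl.
    unfold c. field. lra. }
  pose proof (Hvar phi psi Dphi Cpsi Pa Pb) as H0.
  assert (CM : forall f h : R -> R, (forall t, continuous f t) -> (forall t, continuous h t) ->
             forall t, continuous (fun t => f t * h t) t).
  { intros f h Hf Hh t; now apply (continuous_mult f h). }
  assert (Parts : is_RInt (fun t => K t * phi t + (G t + c) * psi t) a b 0).
  { replace 0 with (minus ((G b + c) * phi b) ((G a + c) * phi a))
      by (rewrite Pa, Pb; unfold minus, plus, opp; simpl; ring).
    apply (is_RInt_derive (fun t => (G t + c) * phi t)).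
    - intros t _. auto_derive.
      + split; [exists (K t); apply DG | split; [exists (psi t); apply Dphi | auto]].
      + change (Derive (fun x : R => G x) t) with (Derive G t).
        change (Derive (fun x : R => phi x) t) with (Derive phi t).
        rewrite (is_derive_unique _ _ _ (DG t)), (is_derive_unique _ _ _ (Dphi t)). ring.
    - intros t _. apply (continuous_plus (fun t => K t * phi t) (fun t => (G t + c) * psi t)).
      + now apply CM.
      + apply (CM (fun t => G t + c) psi); auto.
        intros s; apply (continuous_plus G (fun _ => c)); auto. apply continuous_const. }
  (* Subtracting the two vanishing integrals leaves the integral of [(F - G - c) psi], and
     [F - G - c] is [psi]. *)
  assert (Sq : RInt (fun t => psi t * psi t) a b = 0).
  { rewrite (RInt_ext_all _ (fun t => minus (K t * phi t + F t * psi t)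
                                (K t * phi t + (G t + c) * psi t))).
    - rewrite (RInt_minus (fun t => K t * phi t + F t * psi t)
                 (fun t => K t * phi t + (G t + c) * psi t)).
      + rewrite H0, (is_RInt_unique _ _ _ _ Parts).
        unfold minus, plus, opp; simpl; ring.
      + apply EX. intros t.
        apply (continuous_plus (fun t => K t * phi t) (fun t => F t * psi t)); now apply CM.
      + now exists 0.
    - intros t; unfold psi, minus, plus, opp; simpl; ring. }
  pose proof (RInt_square_eq_0 psi a b Hab Cpsi Sq) as Z.
  assert (Za := Z a ltac:(lra)). assert (Zb := Z b ltac:(lra)).
  unfold psi, G in Za, Zb. rewrite RInt_point in Za.
  change (zero : R_NormedModule) with 0 in Za.
  change (F b - F a = RInt K a b). lra.
Qed.

Lemma Cmod_pos_iff (p q : R) : 0 < p ^ 2 + q ^ 2 <-> (p, q) <> RtoC 0.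
Proof.
  split.
  - intros H E. injection E as -> ->. lra.
  - intros H. apply Cmod_gt_0 in H.
    assert (E := Cmod2_alt (p, q)); unfold Re, Im in E; simpl fst in E; simpl snd in E.
    rewrite <- E. now apply pow_lt.
Qed.

Lemma is_derive_Cmod_affine (p q c d y : R) :
  let X := (p + y * c, q + y * d) : C in
  X <> RtoC 0 ->
  is_derive (fun s => Cmod (p + s * c, q + s * d)) y
    ((fst X * c + snd X * d) / Cmod X).
Proof.
  intros X HX. apply Cmod_pos_iff in HX.
  pose proof (sqrt_lt_R0 _ HX) as Hs.
  unfold X, Cmod; simpl fst; simpl snd.
  auto_derive.
  - simpl in HX. lra.
  - simpl in HX, Hs |- *. field. lra.
Qed.

(** * First variation of length *)

Section Euler_Lagrange.
Variables (D : C -> Prop) (rho : C -> R).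
Hypothesis HD : open D.
Hypothesis Hrho : conformal_metric D rho.
Variables (g g' : R -> C) (a b : R).
Hypothesis Hab : a < b.
Hypothesis HP : C1_path (interval a b) g g'.
Hypothesis Hreg : forall t, interval a b t -> g' t <> RtoC 0.
Hypothesis HDg : forall t, interval a b t -> D (g t).
Hypothesis Hmin : forall l, curve_length D rho (g a) (g b) l -> rho_length rho g g' a b <= l.

Let rx := Defs.Dx rho.
Let ry := Dy rho.

(** For the Lagrangian [rho (x) |v|], [momentum] is the derivative in [v] and [force] the derivative
    in [x], both in the constant direction [e] and taken along the curve. *)
Definition momentum (e : C) (t : R) : R :=
  rho (g t) * ((fst (g' t) * fst e + snd (g' t) * snd e) / Cmod (g' t)).
Definition force (e : C) (t : R) : R :=
  (Defs.Dx rho (g t) * fst e + Dy rho (g t) * snd e) * Cmod (g' t).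

Variable e : C.
Variables phi psi : R -> R.
Hypothesis Dphi : forall t, is_derive phi t (psi t).
Hypothesis Cpsi : forall t, continuous psi t.
Hypothesis Pa : phi a = 0.
Hypothesis Pb : phi b = 0.

Let cl := clamp a b.
(** Position and velocity of the varied curve [g + s phi e]. The clamp makes them continuous for
    every real [t], so differentiation under the integral applies. *)
Let P (s t : R) : C :=
  (fst (g (cl t)) + s * (phi (cl t) * fst e), snd (g (cl t)) + s * (phi (cl t) * snd e)).
Let Q (s t : R) : C :=
  (fst (g' (cl t)) + s * (psi (cl t) * fst e), snd (g' (cl t)) + s * (psi (cl t) * snd e)).
Let A (s t : R) : R := rho (P s t) * Cmod (Q s t).
Let A' (s t : R) : R :=
  (rx (P s t) * (phi (cl t) * fst e) + ry (P s t) * (phi (cl t) * snd e)) * Cmod (Q s t)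
  + rho (P s t) * ((fst (Q s t) * (psi (cl t) * fst e) + snd (Q s t) * (psi (cl t) * snd e))
                   / Cmod (Q s t)).

Lemma continuous_clamp_comp (T : UniformSpace) (h : R -> T) (t : R) :
  (forall s, interval a b s -> filterlim h (within (interval a b) (locally s)) (locally (h s))) ->
  continuous (fun s => h (cl s)) t.
Proof. apply continuous_clamp; lra. Qed.

Lemma continuous_within (T : UniformSpace) (h : R -> T) (I : R -> Prop) (t : R) :
  continuous h t -> filterlim h (within I (locally t)) (locally (h t)).
Proof. intros H. apply filterlim_filter_le_1 with (2 := H). apply filter_le_within. Qed.

Lemma variation_continuous (p q h : R -> R) (c : R) (s t : R) :
  (forall x, continuous p x) -> (forall x, continuous h x) ->
  continuous (fun z : C => p (snd z) + fst z * (h (snd z) * c)) (s, t).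
Proof.
  intros Hp Hh. prove_continuous.
  - apply (continuous_comp (fun z : C => snd z) p); [apply continuous_snd_C | apply Hp].
  - apply (continuous_comp (fun z : C => snd z) h); [apply continuous_snd_C | apply Hh].
Qed.

Lemma continuous_PQ (s t : R) :
  continuous (fun z : C => P (fst z) (snd z)) (s, t) /\
  continuous (fun z : C => Q (fst z) (snd z)) (s, t).
Proof.
  assert (Cg : forall x, continuous (fun t => g (cl t)) x).
  { intros x; apply continuous_clamp_comp. intros y Hy; now apply C1_path_continuous with g'. }
  assert (Cg' : forall x, continuous (fun t => g' (cl t)) x).
  { intros x; apply continuous_clamp_comp. intros y Hy; now apply (HP y Hy). }
  assert (Cphi : forall x, continuous (fun t => phi (cl t)) x).
  { intros x; apply continuous_clamp_comp. intros y _. apply continuous_within.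
    apply (ex_derive_continuous (V := R_NormedModule)). now exists (psi y). }
  assert (Cps : forall x, continuous (fun t => psi (cl t)) x).
  { intros x; apply continuous_clamp_comp. intros y _. now apply continuous_within. }
  assert (C1 : forall (h : R -> C) x, continuous h x -> continuous (fun t => fst (h t)) x).
  { intros h x Hh; apply (continuous_comp h (fun z : C => fst z)); auto.
    apply continuous_fst_C. }
  assert (C2 : forall (h : R -> C) x, continuous h x -> continuous (fun t => snd (h t)) x).
  { intros h x Hh; apply (continuous_comp h (fun z : C => snd z)); auto.
    apply continuous_snd_C. }
  split; apply continuous_pair_C.
  - apply (variation_continuous (fun t => fst (g (cl t))) phi (fun t => phi (cl t))); auto.
  - apply (variation_continuous (fun t => snd (g (cl t))) phi (fun t => phi (cl t))); auto.
  - apply (variation_continuous (fun t => fst (g' (cl t))) phi (fun t => psi (cl t))); auto.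
  - apply (variation_continuous (fun t => snd (g' (cl t))) phi (fun t => psi (cl t))); auto.
Qed.

(** [D] is open and the velocity of [g] never vanishes; both conditions survive small variations,
    uniformly on the interval. A nonzero velocity is what makes its modulus differentiable. *)
Lemma admissible_variations : exists delta : posreal, forall s t,
  Rabs s < delta -> a <= t <= b -> D (P s t) /\ Q s t <> RtoC 0.
Proof.
  apply tube. intros t Ht. apply locally_2d_locally.
  destruct (continuous_PQ 0 t) as [CP CQ].
  assert (Ht' : interval a b (cl t)) by (apply clamp_interval; lra).
  apply filter_and.
  - apply (CP D). apply HD. unfold P; simpl. rewrite !Rmult_0_l, !Rplus_0_r.
    rewrite <- surjective_pairing. now apply HDg.
  - assert (HL : locally (0, t) (fun z : C => 0 < Cmod (Q (fst z) (snd z)))).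
    { apply (continuous_comp _ Cmod _ CQ (continuous_Cmod _) (fun y => 0 < y)).
      apply open_gt. apply Cmod_gt_0. unfold Q; simpl. rewrite !Rmult_0_l, !Rplus_0_r.
      rewrite <- surjective_pairing. now apply Hreg. }
    revert HL; apply filter_imp; intros z. apply Cmod_gt_0.
Qed.

Lemma is_derive_variation (s t : R) :
  D (P s t) -> Q s t <> RtoC 0 -> is_derive (fun u => A u t) s (A' s t).
Proof.
  intros HDP HQ.
  assert (DL : forall p c, is_derive (fun u => p + u * c) s c).
  { intros p c; auto_derive; auto; ring. }
  unfold A, A'.
  apply (is_derive_mult (fun u => rho (P u t)) (fun u => Cmod (Q u t))).
  - apply (grad_on_chain D rho rx ry
             (fun u => fst (g (cl t)) + u * (phi (cl t) * fst e))
             (fun u => snd (g (cl t)) + u * (phi (cl t) * snd e))); auto.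
    apply C1_on_grad, Hrho.
  - apply (is_derive_Cmod_affine (fst (g' (cl t))) (snd (g' (cl t))) _ _ s HQ).
  - intros; apply Rmult_comm.
Qed.

Lemma continuous_variation (s t : R) :
  D (P s t) -> Q s t <> RtoC 0 ->
  continuous (fun z : C => A (fst z) (snd z)) (s, t) /\
  continuous (fun z : C => A' (fst z) (snd z)) (s, t).
Proof.
  intros HDP HQ.
  destruct (continuous_PQ s t) as [CP CQ].
  assert (Ccl : forall h : R -> R, (forall x, continuous h x) ->
            continuous (fun z : C => h (cl (snd z))) (s, t)).
  { intros h Hh. apply (continuous_comp (fun z : C => snd z) (fun x => h (cl x))).
    - apply continuous_snd_C.
    - apply continuous_clamp_comp. intros y _. now apply continuous_within. }
  assert (Cphi : continuous (fun z : C => phi (cl (snd z))) (s, t)).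
  { apply Ccl. intros x. apply (ex_derive_continuous (V := R_NormedModule)).
    now exists (psi x). }
  assert (Cps : continuous (fun z : C => psi (cl (snd z))) (s, t)) by now apply Ccl.
  assert (CR : forall h : C -> R, continuous h (P s t) ->
            continuous (fun z : C => h (P (fst z) (snd z))) (s, t)).
  { intros h Hh. now apply (continuous_comp (fun z : C => P (fst z) (snd z)) h). }
  assert (CS : forall h : C -> R, continuous h (Q s t) ->
            continuous (fun z : C => h (Q (fst z) (snd z))) (s, t)).
  { intros h Hh. now apply (continuous_comp (fun z : C => Q (fst z) (snd z)) h). }
  assert (HG := C1_on_grad D rho (proj2 Hrho)).
  assert (Crho := conformal_metric_continuous D rho _ HD Hrho HDP).
  destruct (HG (fst (P s t)) (snd (P s t))) as (_ & _ & Crx & Cry);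
    [now rewrite <- surjective_pairing | ].
  rewrite <- surjective_pairing in Crx, Cry.
  assert (CCQ := CS Cmod (continuous_Cmod _)).
  split; unfold A, A'.
  - apply (continuous_mult (fun z : C => rho (P (fst z) (snd z)))
             (fun z : C => Cmod (Q (fst z) (snd z)))); auto.
  - prove_continuous; auto.
    + apply CS, continuous_fst_C.
    + apply CS, continuous_snd_C.
    + simpl. apply Rgt_not_eq. now apply Cmod_gt_0.
Qed.

(** As [phi] vanishes at both ends, the varied curve joins the same points and competes with [g]. *)
Lemma variation_length (s : R) :
  (forall t, a <= t <= b -> D (P s t)) -> rho_length rho g g' a b <= RInt (A s) a b.
Proof.
  intros HDP.
  set (h := fun t : R => (fst (g t) + s * (phi t * fst e), snd (g t) + s * (phi t * snd e)) : C).
  set (h' := fun t : R => (fst (g' t) + s * (psi t * fst e), snd (g' t) + s * (psi t * snd e)) : C).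
  assert (Hh : C1_path (interval a b) h h').
  { apply C1_path_intro. intros t Ht.
    destruct (C1_path_deriv _ g g' t HP Ht) as [D1 D2].
    pose proof (is_derive_deriv_in (interval a b) phi t _ (Dphi t)) as D3.
    assert (Cg : forall k : C -> R, continuous k (g' t) ->
      cont_in (interval a b) (fun t => k (g' t)) t).
    { intros k Hk. apply cont_in_comp; auto. apply (HP t Ht). }
    assert (C3 : cont_in (interval a b) psi t) by now apply continuous_within.
    assert (CC : forall c, cont_in (interval a b) (fun _ => c) t).
    { intros c; apply filterlim_const. }
    refine (conj _ (conj _ (conj _ _))).
    - pose proof (deriv_in_lin _ _ _ t _ _ (s * fst e) D1 D3) as E.
      intros eps He. destruct (E eps He) as (d & Hd & B). exists d; split; auto.
      intros x Hx Hxt. specialize (B x Hx Hxt). simpl.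
      replace (fst (g x) + s * (phi x * fst e) - (fst (g t) + s * (phi t * fst e))
               - (fst (g' t) + s * (psi t * fst e)) * (x - t))
        with (fst (g x) + s * fst e * phi x - (fst (g t) + s * fst e * phi t)
               - (fst (g' t) + s * fst e * psi t) * (x - t)) by ring.
      exact B.
    - pose proof (deriv_in_lin _ _ _ t _ _ (s * snd e) D2 D3) as E.
      intros eps He. destruct (E eps He) as (d & Hd & B). exists d; split; auto.
      intros x Hx Hxt. specialize (B x Hx Hxt). simpl.
      replace (snd (g x) + s * (phi x * snd e) - (snd (g t) + s * (phi t * snd e))
               - (snd (g' t) + s * (psi t * snd e)) * (x - t))
        with (snd (g x) + s * snd e * phi x - (snd (g t) + s * snd e * phi t)
               - (snd (g' t) + s * snd e * psi t) * (x - t)) by ring.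
      exact B.
    - apply cont_in_plus; [apply (Cg (fun z => fst z)), continuous_fst_C | ].
      apply cont_in_mult; [apply CC | apply cont_in_mult; auto].
    - apply cont_in_plus; [apply (Cg (fun z => snd z)), continuous_snd_C | ].
      apply cont_in_mult; [apply CC | apply cont_in_mult; auto]. }
  assert (HPh : forall t, a <= t <= b -> P s t = h t).
  { intros t Ht; unfold P, h, cl. now rewrite clamp_id. }
  assert (L : curve_length D rho (h a) (h b) (rho_length rho h h' a b)).
  { apply curve_piece; [exact Hab | exact Hh | ].
    intros t Ht. rewrite <- HPh by assumption. now apply HDP. }
  replace (h a) with (g a) in L
    by (unfold h; rewrite Pa; apply injective_projections; simpl; ring).
  replace (h b) with (g b) in L
    by (unfold h; rewrite Pb; apply injective_projections; simpl; ring).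
  apply Rle_trans with (1 := Hmin _ L). right.
  unfold rho_length. apply RInt_ext. intros t Ht.
  rewrite Rmin_left, Rmax_right in Ht by lra.
  unfold A, P, Q, h, h', cl. rewrite clamp_id by lra. reflexivity.
Qed.

(** The length of the varied curve is differentiable in [s] and minimal at [s = 0], so its
    derivative there is zero. *)
Lemma first_variation : RInt (fun t => force e (cl t) * phi t + momentum e (cl t) * psi t) a b = 0.
Proof.
  destruct admissible_variations as [delta Hdelta].
  assert (HL : locally 0 (fun s => forall t, D (P s t) /\ Q s t <> RtoC 0)).
  { exists delta; intros s Hs t.
    unfold ball in Hs; simpl in Hs; unfold AbsRing_ball, abs, minus, plus, opp in Hs;
      simpl in Hs. rewrite Ropp_0, Rplus_0_r in Hs.
    (* Everything depends on [t] through the clamp only, so what holds on the interval holds for all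
       [t]. *)
    replace (P s t) with (P s (cl t)).
    2:{ unfold P, cl. rewrite (clamp_id a b (clamp a b t)); auto. apply clamp_interval; lra. }
    replace (Q s t) with (Q s (cl t)).
    2:{ unfold Q, cl. rewrite (clamp_id a b (clamp a b t)); auto. apply clamp_interval; lra. }
    apply Hdelta; auto. apply clamp_interval; lra. }
  assert (HL0 := locally_singleton _ _ HL).
  assert (HLd : is_derive (fun s => RInt (A s) a b) 0 (RInt (A' 0) a b)).
  { apply is_derive_RInt_param_explicit.
    - revert HL; apply filter_imp; intros s Hs t. destruct (Hs t). now apply is_derive_variation.
    - intros t _. destruct (HL0 t). apply continuity_2d_pt_filterlim.
      now apply continuous_variation.
    - revert HL; apply filter_imp; intros s Hs.
      apply (ex_RInt_continuous (V := R_CompleteNormedModule)); intros t _.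
      destruct (Hs t).
      apply (continuous_comp (fun t => (s, t) : C) (fun z : C => A (fst z) (snd z))).
      + apply continuous_pair_C; [apply continuous_const | apply continuous_id].
      + now apply continuous_variation. }
  assert (E0 : forall t, a <= t <= b -> P 0 t = g t /\ Q 0 t = g' t).
  { intros t Ht; unfold P, Q, cl. rewrite clamp_id by assumption.
    split; apply injective_projections; simpl; ring. }
  transitivity (RInt (A' 0) a b).
  { apply RInt_ext. intros t Ht. rewrite Rmin_left, Rmax_right in Ht by lra.
    destruct (E0 t ltac:(lra)) as [EP EQ].
    unfold A', force, momentum, cl. rewrite EP, EQ, clamp_id by lra.
    fold rx ry.
    change (@eq R ((rx (g t) * fst e + ry (g t) * snd e) * Cmod (g' t) * phi t +
     rho (g t) * ((fst (g' t) * fst e + snd (g' t) * snd e) / Cmod (g' t)) * psi t)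
     ((rx (g t) * (phi t * fst e) + ry (g t) * (phi t * snd e)) * Cmod (g' t) +
     rho (g t) * ((fst (g' t) * (psi t * fst e) + snd (g' t) * (psi t * snd e)) / Cmod (g' t)))).
    unfold Rdiv; ring. }
  assert (Lmin : forall s, - delta < s < delta -> RInt (A 0) a b <= RInt (A s) a b).
  { intros s Hs.
    replace (RInt (A 0) a b) with (rho_length rho g g' a b).
    - apply variation_length. intros t Ht. apply Hdelta; auto. apply Rabs_lt_between; lra.
    - apply RInt_ext. intros t Ht. rewrite Rmin_left, Rmax_right in Ht by lra.
      destruct (E0 t ltac:(lra)) as [EP EQ]. unfold A. now rewrite EP, EQ. }
  apply is_derive_Reals in HLd.
  pose proof (cond_pos delta).
  assert (pr : derivable_pt (fun s => RInt (A s) a b) 0) by (eexists; exact HLd).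
  rewrite <- (derive_pt_eq_0 _ _ _ pr HLd).
  apply (deriv_minimum _ (- delta) delta); try lra.
  intros s H1 H2; apply Lmin; lra.
Qed.
End Euler_Lagrange.

Section Geodesic_equation.
Variables (D : C -> Prop) (rho : C -> R).
Hypothesis HD : open D.
Hypothesis Hrho : conformal_metric D rho.
Variables (g g' : R -> C) (a b : R).
Hypothesis Hab : a < b.
Hypothesis HP : C1_path (interval a b) g g'.
Hypothesis Hreg : forall t, interval a b t -> g' t <> RtoC 0.
Hypothesis HDg : forall t, interval a b t -> D (g t).
Hypothesis Hmin : forall l, curve_length D rho (g a) (g b) l -> rho_length rho g g' a b <= l.

Lemma momentum_cont_in (I : R -> Prop) (e : C) (t : R) :
  C1_path I g g' -> I t -> g' t <> RtoC 0 -> D (g t) ->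
  cont_in I (momentum rho g g' e) t.
Proof.
  intros HPI Ht H0 HDt. unfold momentum.
  assert (Cg : forall k : C -> R, continuous k (g' t) -> cont_in I (fun t => k (g' t)) t).
  { intros k Hk. apply cont_in_comp; auto. apply (HPI t Ht). }
  apply cont_in_mult.
  - apply cont_in_comp; [now apply C1_path_continuous with g' | ].
    now apply conformal_metric_continuous with D.
  - apply (Cg (fun z : C => (fst z * fst e + snd z * snd e) / Cmod z)).
    prove_continuous.
    + apply continuous_Cmod.
    + apply Rgt_not_eq. now apply Cmod_gt_0.
Qed.

Lemma force_cont_in (I : R -> Prop) (e : C) (t : R) :
  C1_path I g g' -> I t -> D (g t) -> cont_in I (force rho g g' e) t.
Proof.
  intros HPI Ht HDt. unfold force.
  apply cont_in_mult.
  2:{ apply cont_in_comp; [apply (HPI t Ht) | apply continuous_Cmod]. }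
  apply (cont_in_comp I g (fun z => Defs.Dx rho z * fst e + Dy rho z * snd e)).
  - now apply C1_path_continuous with g'.
  - assert (HG := C1_on_grad D rho (proj2 Hrho)).
    destruct (HG (fst (g t)) (snd (g t))) as (_ & _ & Crx & Cry);
      [now rewrite <- surjective_pairing | ].
    rewrite <- surjective_pairing in Crx, Cry.
    prove_continuous; assumption.
Qed.

Lemma geodesic_equation (e : C) :
  momentum rho g g' e b - momentum rho g g' e a = RInt (force rho g g' e) a b.
Proof.
  rewrite <- (clamp_id a b b) at 1 by lra.
  rewrite <- (clamp_id a b a) at 2 by lra.
  rewrite (du_bois_reymond (fun t => momentum rho g g' e (clamp a b t))
             (fun t => force rho g g' e (clamp a b t)) a b Hab).
  - apply RInt_ext. intros t Ht. rewrite Rmin_left, Rmax_right in Ht by lra.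
    now rewrite clamp_id by lra.
  - intros t; apply continuous_clamp; [lra | ]. intros s Hs. apply momentum_cont_in; auto.
  - intros t; apply continuous_clamp; [lra | ]. intros s Hs. apply force_cont_in; auto.
  - intros phi psi Dphi Cpsi Pa Pb.
    now apply (first_variation D rho HD Hrho g g' a b Hab HP Hreg HDg Hmin e phi psi).
Qed.
End Geodesic_equation.

(** * Differentiation with respect to arclength *)

Lemma deriv_in_is_derive (J : R -> Prop) (h : R -> R) (x l : R) :
  locally x J -> deriv_in J h x l -> is_derive h x l.
Proof.
  intros [d0 HJ] H. apply is_derive_Reals. intros eps He.
  destruct (H (eps / 2) ltac:(lra)) as (d & Hd & B).
  assert (Hm : 0 < Rmin d0 d) by (apply Rmin_glb_lt; [apply cond_pos | assumption]).
  exists (mkposreal _ Hm). intros y Hy Hyd. simpl in Hyd.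
  assert (HJy : J (x + y)).
  { apply HJ. unfold ball; simpl; unfold AbsRing_ball, abs, minus, plus, opp; simpl.
    replace (x + y + - x) with y by ring.
    apply Rlt_le_trans with (1 := Hyd), Rmin_l. }
  specialize (B (x + y) HJy). replace (x + y - x) with y in B by ring.
  specialize (B (Rlt_le_trans _ _ _ Hyd (Rmin_r _ _))).
  replace ((h (x + y) - h x) / y - l) with ((h (x + y) - h x - l * y) / y) by (field; auto).
  unfold Rdiv; rewrite Rabs_mult, Rabs_inv.
  pose proof (Rabs_pos_lt _ Hy). apply Rlt_div_l; [assumption | ]. nra.
Qed.

Lemma deriv_in_lipschitz (J : R -> Prop) (h : R -> R) (x l : R) :
  deriv_in J h x l -> exists K delta, 0 < K /\ 0 < delta /\
    forall y, J y -> Rabs (y - x) < delta -> Rabs (h y - h x) <= K * Rabs (y - x).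
Proof.
  intros H. destruct (H 1 Rlt_0_1) as (d & Hd & B).
  pose proof (Rabs_pos l).
  exists (1 + Rabs l), d. repeat split; [lra | assumption | ].
  intros y Hy Hyx. specialize (B y Hy Hyx).
  replace (h y - h x) with ((h y - h x - l * (y - x)) + l * (y - x)) by ring.
  apply Rle_trans with (1 := Rabs_triang _ _). rewrite Rabs_mult. lra.
Qed.

Lemma RInt_cont_in_pos (k : R -> R) (a b : R) : a < b ->
  (forall t, interval a b t -> cont_in (interval a b) k t) ->
  (forall t, interval a b t -> 0 < k t) -> 0 < RInt k a b.
Proof.
  intros Hab Hc Hp.
  rewrite (RInt_ext _ (fun t => k (clamp a b t))).
  - apply RInt_gt_0; auto.
    + intros t _. apply Hp, clamp_interval; lra.
    + intros t _. apply continuous_clamp; [lra | assumption].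
  - intros t Ht. rewrite Rmin_left, Rmax_right in Ht by lra. now rewrite clamp_id by lra.
Qed.

Section Interval_integral.
Variables (I : R -> Prop) (k : R -> R).
Hypothesis HI : is_connected I.
Hypothesis Hk : forall t, I t -> cont_in I k t.

Lemma connected_interval (s t : R) : I s -> I t -> forall x, interval s t x -> I x.
Proof. intros Hs Ht x Hx. now apply (HI s t x). Qed.

Lemma ex_RInt_connected (s t : R) : I s -> I t -> ex_RInt k s t.
Proof.
  assert (W : forall s t, s <= t -> I s -> I t -> ex_RInt k s t).
  { intros p q Hpq Hp Hq. apply ex_RInt_cont_in; [assumption | ].
    intros x Hx. apply cont_in_subset with I.
    - now apply connected_interval.
    - now apply Hk, (connected_interval p q). }
  intros Hs Ht. destruct (Rle_dec s t).
  - now apply W.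
  - apply ex_RInt_swap, W; auto; lra.
Qed.

(** The fundamental theorem of calculus relative to an interval, one-sided at an endpoint that
    belongs to it. *)
Lemma deriv_in_RInt (h : R -> R) (t : R) : I t ->
  (forall s, I s -> h s - h t = RInt k t s) -> deriv_in I h t (k t).
Proof.
  intros Ht Hh eps He.
  destruct (proj1 (cont_in_eps I k t) (Hk t Ht) eps He) as (d & Hd & B).
  exists d; split; [assumption | ]. intros s Hs Hst.
  rewrite Hh by assumption.
  assert (E : RInt k t s - k t * (s - t) = RInt (fun x => k x - k t) t s).
  { rewrite (RInt_minus k (fun _ => k t)).
    - rewrite RInt_const. unfold minus, plus, opp, scal; simpl; unfold mult; simpl. ring.
    - now apply ex_RInt_connected.
    - apply ex_RInt_const. }
  rewrite E.
  assert (EX : forall p q, I p -> I q -> ex_RInt (fun x => k x - k t) p q).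
  { intros p q Hp Hq. apply (ex_RInt_minus k (fun _ => k t)).
    - now apply ex_RInt_connected.
    - apply ex_RInt_const. }
  destruct (Rle_dec t s) as [L | L].
  - apply Rle_trans with (eps * (s - t)); [ | rewrite (Rabs_right (s - t)); lra].
    rewrite Rmult_comm.
    apply abs_RInt_le_const; auto.
    intros x Hx. left. apply B; [now apply (connected_interval t s) | ].
    rewrite Rabs_right in Hst |- *; lra.
  - apply Rle_trans with (eps * (t - s)); [ | rewrite (Rabs_left (s - t)); lra].
    rewrite <- opp_RInt_swap by auto.
    unfold opp; simpl. rewrite Rabs_Ropp. rewrite Rmult_comm.
    apply abs_RInt_le_const; auto; [lra | ].
    intros x Hx. left. apply B; [now apply (connected_interval s t) | ].
    rewrite Rabs_left in Hst by lra. rewrite Rabs_left1; lra.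
Qed.
End Interval_integral.

Section Arclength.
Variables (I : R -> Prop) (sigma S : R -> R).
Hypothesis HI : is_connected I.
Hypothesis Hsigma : forall t, I t -> cont_in I sigma t.
Hypothesis Hpos : forall t, I t -> 0 < sigma t.
Hypothesis HS : forall s t, I s -> I t -> S t - S s = RInt sigma s t.

Lemma arclength_increasing (s t : R) : I s -> I t -> s < t -> S s < S t.
Proof.
  intros Hs Ht Hst.
  assert (0 < RInt sigma s t).
  { apply RInt_cont_in_pos; auto.
    - intros x Hx. apply cont_in_subset with I.
      + now apply connected_interval.
      + now apply Hsigma, (connected_interval I HI s t).
    - intros x Hx. now apply Hpos, (connected_interval I HI s t). }
  rewrite <- HS in H by assumption. lra.
Qed.

(** Strict monotonicity of [S]: its increment over a step of size [eps] bounds from below the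
    increments over all longer steps. *)
Lemma arclength_inverse_continuous (t eps : R) : I t -> 0 < eps ->
  exists delta, 0 < delta /\
    forall s, I s -> Rabs (S s - S t) < delta -> Rabs (s - t) < eps.
Proof.
  intros Ht He.
  assert (R1 : exists d, 0 < d /\ forall s, I s -> t + eps <= s -> d <= S s - S t).
  { destruct (classic (I (t + eps))) as [Y | N].
    - exists (S (t + eps) - S t). split.
      + pose proof (arclength_increasing t (t + eps) Ht Y). lra.
      + intros s Hs [L | <-]; [ | lra].
        pose proof (arclength_increasing _ _ Y Hs L). lra.
    - exists 1; split; [lra | ]. intros s Hs L. exfalso; apply N.
      apply (HI t s); auto; lra. }
  assert (R2 : exists d, 0 < d /\ forall s, I s -> s <= t - eps -> d <= S t - S s).
  { destruct (classic (I (t - eps))) as [Y | N].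
    - exists (S t - S (t - eps)). split.
      + pose proof (arclength_increasing (t - eps) t Y Ht). lra.
      + intros s Hs [L | ->]; [ | lra].
        pose proof (arclength_increasing _ _ Hs Y L). lra.
    - exists 1; split; [lra | ]. intros s Hs L. exfalso; apply N.
      apply (HI s t); auto; lra. }
  destruct R1 as (d1 & H1 & B1), R2 as (d2 & H2 & B2).
  exists (Rmin d1 d2); split; [now apply Rmin_glb_lt | ].
  intros s Hs HSs.
  pose proof (Rlt_le_trans _ _ _ HSs (Rmin_l _ _)) as L1.
  pose proof (Rlt_le_trans _ _ _ HSs (Rmin_r _ _)) as L2.
  apply Rabs_lt_between in L1; apply Rabs_lt_between in L2.
  apply Rabs_lt_between.
  split; apply Rnot_le_lt; intros N.
  - specialize (B2 s Hs ltac:(lra)). lra.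
  - specialize (B1 s Hs ltac:(lra)). lra.
Qed.

Lemma cont_in_wrt_arclength (h : R -> R) (t eps : R) : I t -> cont_in I h t -> 0 < eps ->
  exists delta, 0 < delta /\
    forall s, I s -> Rabs (S s - S t) < delta -> Rabs (h s - h t) < eps.
Proof.
  intros Ht Hh He.
  destruct (proj1 (cont_in_eps I h t) Hh eps He) as (d & Hd & B).
  destruct (arclength_inverse_continuous t d Ht Hd) as (d' & Hd' & B').
  exists d'; split; auto.
Qed.

(** The derivative of [h] in the variable [S] is [l / sigma t]. The error is measured by increments
    of [S], as it is [S (tau y)] and not [tau y] that can be controlled in the applications. *)
Lemma deriv_wrt_arclength (h : R -> R) (t l eps : R) : I t -> deriv_in I h t l -> 0 < eps ->
  exists delta, 0 < delta /\
    forall s, I s -> Rabs (S s - S t) < delta ->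
      Rabs (h s - h t - l / sigma t * (S s - S t)) <= eps * Rabs (S s - S t).
Proof.
  intros Ht Hh He.
  pose proof (Hpos t Ht) as Hp.
  assert (DS : deriv_in I S t (sigma t)).
  { apply (deriv_in_RInt I sigma HI Hsigma); auto. }
  pose proof (deriv_in_lin I h S t _ _ (- (l / sigma t)) Hh DS) as DK.
  replace (l + - (l / sigma t) * sigma t) with 0 in DK by (field; lra).
  destruct (DK (eps * (sigma t / 2))) as (d1 & Hd1 & B1); [nra | ].
  destruct (DS (sigma t / 2)) as (d2 & Hd2 & B2); [lra | ].
  destruct (arclength_inverse_continuous t (Rmin d1 d2) Ht) as (d & Hd & B).
  { now apply Rmin_glb_lt. }
  exists d; split; [assumption | ]. intros s Hs HSs.
  specialize (B s Hs HSs).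
  specialize (B1 s Hs (Rlt_le_trans _ _ _ B (Rmin_l _ _))).
  specialize (B2 s Hs (Rlt_le_trans _ _ _ B (Rmin_r _ _))).
  replace (h s - h t - l / sigma t * (S s - S t)) with
    (h s + - (l / sigma t) * S s - (h t + - (l / sigma t) * S t) - 0 * (s - t)) by ring.
  apply Rle_trans with (1 := B1).
  (* Since [S] has positive derivative at [t], its increments near [t] dominate those of the
     parameter. *)
  assert (L : sigma t / 2 * Rabs (s - t) <= Rabs (S s - S t)).
  { pose proof (Rabs_triang_inv (sigma t * (s - t)) (S s - S t)) as T.
    rewrite <- (Rabs_Ropp (sigma t * (s - t) - (S s - S t))) in T.
    replace (- (sigma t * (s - t) - (S s - S t))) with (S s - S t - sigma t * (s - t))
      in T by ring.
    rewrite Rabs_mult, (Rabs_right (sigma t)) in T by lra. lra. }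
  rewrite Rmult_assoc. apply Rmult_le_compat_l; lra.
Qed.

(** The chain rule for [h] as a function of arclength, composed with the arclength of the moving
    point. No regularity of [tau] itself enters. *)
Lemma deriv_in_comp_arclength (J : R -> Prop) (tau h : R -> R) (x l m : R) :
  (forall y, J y -> I (tau y)) -> J x ->
  deriv_in J (fun y => S (tau y)) x l -> deriv_in I h (tau x) m ->
  deriv_in J (fun y => h (tau y)) x (m / sigma (tau x) * l).
Proof.
  intros HJ Hx HS' Hh eps He.
  set (c := m / sigma (tau x)).
  destruct (deriv_in_lipschitz _ _ _ _ HS') as (K & d0 & HK & Hd0 & B0).
  destruct (deriv_wrt_arclength h (tau x) m (eps / (2 * K)) (HJ x Hx) Hh) as (d1 & Hd1 & B1).
  { apply Rdiv_lt_0_compat; lra. }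
  pose proof (Rabs_pos c) as Hc.
  destruct (HS' (eps / (2 * (1 + Rabs c)))) as (d2 & Hd2 & B2).
  { apply Rdiv_lt_0_compat; lra. }
  exists (Rmin (Rmin d0 (d1 / K)) d2). split.
  { repeat apply Rmin_glb_lt; auto. apply Rdiv_lt_0_compat; lra. }
  intros y Hy Hyx.
  pose proof (Rlt_le_trans _ _ _ Hyx (Rmin_r _ _)) as L2.
  pose proof (Rlt_le_trans _ _ _ Hyx (Rmin_l _ _)) as L.
  pose proof (Rlt_le_trans _ _ _ L (Rmin_l _ _)) as L0.
  pose proof (Rlt_le_trans _ _ _ L (Rmin_r _ _)) as L1.
  specialize (B0 y Hy L0). specialize (B2 y Hy L2).
  apply Rlt_div_r in L1; [ | assumption].
  specialize (B1 (tau y) (HJ y Hy) ltac:(lra)).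
  fold c in B1.
  replace (h (tau y) - h (tau x) - c * l * (y - x)) with
    ((h (tau y) - h (tau x) - c * (S (tau y) - S (tau x)))
     + c * (S (tau y) - S (tau x) - l * (y - x))) by ring.
  apply Rle_trans with (1 := Rabs_triang _ _). rewrite Rabs_mult.
  apply (Rmult_le_compat_l (Rabs c)) in B2; [ | assumption].
  assert (E2 : Rabs c * (eps / (2 * (1 + Rabs c)) * Rabs (y - x)) <= eps / 2 * Rabs (y - x)).
  { rewrite <- Rmult_assoc. apply Rmult_le_compat_r; [apply Rabs_pos | ].
    replace (Rabs c * (eps / (2 * (1 + Rabs c)))) with
      (Rabs c * (eps / 2) / (1 + Rabs c)) by (field; lra).
    apply Rle_div_l; nra. }
  assert (E1 : eps / (2 * K) * Rabs (S (tau y) - S (tau x)) <= eps / 2 * Rabs (y - x)).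
  { replace (eps / 2) with (eps / (2 * K) * K) by (field; lra).
    rewrite Rmult_assoc. apply Rmult_le_compat_l; [ | assumption].
    left; apply Rdiv_lt_0_compat; lra. }
  lra.
Qed.

(* Near [tau x] the arclength agrees to first order with the linear function
   [q1 g1 + q2 g2] of the position, and it is controlled by the position. *)
Lemma deriv_in_arclength (J : R -> Prop) (tau g1 g2 : R -> R)
    (x l1 l2 v1 v2 q1 q2 M eta : R) :
  (forall y, J y -> I (tau y)) -> J x ->
  deriv_in I g1 (tau x) l1 -> deriv_in I g2 (tau x) l2 ->
  q1 * l1 + q2 * l2 = sigma (tau x) ->
  deriv_in J (fun y => g1 (tau y)) x v1 -> deriv_in J (fun y => g2 (tau y)) x v2 ->
  0 < eta -> 0 < M ->
  (forall s, I s -> Rabs (g1 s - g1 (tau x)) < eta -> Rabs (g2 s - g2 (tau x)) < eta ->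
     Rabs (S s - S (tau x)) <= M * (Rabs (g1 s - g1 (tau x)) + Rabs (g2 s - g2 (tau x)))) ->
  deriv_in J (fun y => S (tau y)) x (q1 * v1 + q2 * v2).
Proof.
  intros HJ Hx D1 D2 Eq DV1 DV2 Heta HM HC eps He.
  pose proof (Hpos _ (HJ x Hx)) as Hp.
  assert (Dh : deriv_in I (fun s => (0 + q1 * g1 s) + q2 * g2 s) (tau x)
                 ((0 + q1 * l1) + q2 * l2)).
  { apply deriv_in_lin; [ | assumption].
    apply (deriv_in_lin I (fun _ => 0)); [ | assumption].
    intros e' He'. exists 1; split; [lra | ]. intros s _ _.
    replace (0 - 0 - 0 * (s - tau x)) with 0 by ring. rewrite Rabs_R0.
    pose proof (Rabs_pos (s - tau x)). nra. }
  assert (DV : deriv_in J (fun y => (0 + q1 * g1 (tau y)) + q2 * g2 (tau y)) x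
                 ((0 + q1 * v1) + q2 * v2)).
  { apply (deriv_in_lin J (fun y => 0 + q1 * g1 (tau y)) (fun y => g2 (tau y)));
      [ | assumption].
    apply (deriv_in_lin J (fun _ => 0) (fun y => g1 (tau y))); [ | assumption].
    intros e' He'. exists 1; split; [lra | ]. intros s _ _.
    replace (0 - 0 - 0 * (s - x)) with 0 by ring. rewrite Rabs_R0.
    pose proof (Rabs_pos (s - x)). nra. }
  destruct (deriv_in_lipschitz _ _ _ _ DV1) as (K1 & e1 & HK1 & He1 & B1).
  destruct (deriv_in_lipschitz _ _ _ _ DV2) as (K2 & e2 & HK2 & He2 & B2).
  set (K := M * (K1 + K2)). assert (HK : 0 < K) by (unfold K; nra).
  destruct (deriv_wrt_arclength _ (tau x) _ (eps / (2 * K)) (HJ x Hx) Dh) as (d & Hd & B).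
  { apply Rdiv_lt_0_compat; lra. }
  destruct (DV (eps / 2) ltac:(lra)) as (d' & Hd' & B').
  set (m := Rmin (Rmin e1 e2) (Rmin d' (Rmin (eta / (K1 + K2)) (d / K)))).
  exists m. split.
  { unfold m. repeat apply Rmin_glb_lt; auto; apply Rdiv_lt_0_compat; lra. }
  intros y Hy Hyx.
  assert (L1 : Rabs (y - x) < e1).
  { apply Rlt_le_trans with (1 := Hyx). unfold m.
    eapply Rle_trans; [apply Rmin_l | apply Rmin_l]. }
  assert (L2 : Rabs (y - x) < e2).
  { apply Rlt_le_trans with (1 := Hyx). unfold m.
    eapply Rle_trans; [apply Rmin_l | apply Rmin_r]. }
  assert (L3 : Rabs (y - x) < d').
  { apply Rlt_le_trans with (1 := Hyx). unfold m.
    eapply Rle_trans; [apply Rmin_r | apply Rmin_l]. }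
  assert (L4 : Rabs (y - x) < eta / (K1 + K2)).
  { apply Rlt_le_trans with (1 := Hyx). unfold m.
    eapply Rle_trans; [apply Rmin_r | eapply Rle_trans; [apply Rmin_r | apply Rmin_l]]. }
  assert (L5 : Rabs (y - x) < d / K).
  { apply Rlt_le_trans with (1 := Hyx). unfold m.
    eapply Rle_trans; [apply Rmin_r | eapply Rle_trans; [apply Rmin_r | apply Rmin_r]]. }
  apply Rlt_div_r in L4; [ | lra]. apply Rlt_div_r in L5; [ | lra].
  specialize (B1 y Hy L1). specialize (B2 y Hy L2). specialize (B' y Hy L3).
  pose proof (Rabs_pos (y - x)) as Hyp.
  (* A Lipschitz bound for [S] along [tau], inherited from the positions; it makes the first-order
     comparison between [S] and the linear function applicable at [tau y]. *)
  assert (C : Rabs (S (tau y) - S (tau x)) <= K * Rabs (y - x)).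
  { eapply Rle_trans; [apply HC; auto; nra | ]. unfold K.
    rewrite Rmult_assoc. apply Rmult_le_compat_l; lra. }
  specialize (B (tau y) (HJ y Hy) ltac:(lra)).
  replace ((0 + q1 * l1 + q2 * l2) / sigma (tau x)) with 1 in B
    by (rewrite <- Eq; field; lra).
  replace (S (tau y) - S (tau x) - (q1 * v1 + q2 * v2) * (y - x)) with
    ((0 + q1 * g1 (tau y) + q2 * g2 (tau y) - (0 + q1 * g1 (tau x) + q2 * g2 (tau x))
       - (0 + q1 * v1 + q2 * v2) * (y - x))
     - (0 + q1 * g1 (tau y) + q2 * g2 (tau y) - (0 + q1 * g1 (tau x) + q2 * g2 (tau x))
       - 1 * (S (tau y) - S (tau x)))) by ring.
  eapply Rle_trans; [apply Rabs_triang | ]. rewrite Rabs_Ropp.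
  assert (E1 : eps / (2 * K) * Rabs (S (tau y) - S (tau x)) <= eps / 2 * Rabs (y - x)).
  { replace (eps / 2) with (eps / (2 * K) * K) by (field; lra).
    rewrite Rmult_assoc. apply Rmult_le_compat_l; [ | assumption].
    left; apply Rdiv_lt_0_compat; lra. }
  lra.
Qed.
End Arclength.

(** * The arclength coordinate of a harmonic map *)

Lemma Cmod_le_sum (z : C) : Cmod z <= Rabs (fst z) + Rabs (snd z).
Proof.
  pose proof (Rabs_pos (fst z)); pose proof (Rabs_pos (snd z)).
  rewrite <- (sqrt_Rsqr (Rabs (fst z) + Rabs (snd z))) by lra.
  unfold Cmod. apply sqrt_le_1_alt.
  rewrite <- (pow2_abs (fst z)), <- (pow2_abs (snd z)). unfold Rsqr. nra.
Qed.

Lemma C1_path_subset (I J : R -> Prop) (g g' : R -> C) :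
  (forall t, J t -> I t) -> C1_path I g g' -> C1_path J g g'.
Proof.
  intros HJ HP t Ht. destruct (HP t (HJ t Ht)) as [H1 H2].
  split.
  - intros Q HQ. generalize (H1 Q HQ). unfold filtermap, within.
    apply filter_imp; auto.
  - intros Q HQ. generalize (H2 Q HQ). unfold filtermap, within.
    apply filter_imp; auto.
Qed.

Lemma deriv_in_ext (J : R -> Prop) (h k : R -> R) (x l : R) :
  (forall y, J y -> h y = k y) -> J x -> deriv_in J h x l -> deriv_in J k x l.
Proof.
  intros E Hx H eps He. destruct (H eps He) as (d & Hd & B).
  exists d; split; [assumption | ]. intros s Hs Hsx.
  rewrite <- !E by assumption. now apply B.
Qed.

Lemma grad_on_unique (W : C -> Prop) (h hx hy : C -> R) (z : C) :
  grad_on W h hx hy -> W z -> Defs.Dx h z = hx z /\ Dy h z = hy z.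
Proof.
  destruct z as [x y]; intros H Hz. destruct (H x y Hz) as (H1 & H2 & _).
  split; now apply is_derive_unique.
Qed.

Lemma C2_grad (h : C -> R) : C2_on unit_disk h ->
  grad_on unit_disk h (Defs.Dx h) (Dy h) /\
  grad_on unit_disk (Defs.Dx h) (Defs.Dx (Defs.Dx h)) (Dy (Defs.Dx h)) /\
  grad_on unit_disk (Dy h) (Defs.Dx (Dy h)) (Dy (Dy h)).
Proof. intros (H1 & H2 & H3). refine (conj _ (conj _ _)); now apply C1_on_grad. Qed.

Lemma mixed_partials (h : C -> R) (z : C) : C2_on unit_disk h -> unit_disk z ->
  Defs.Dx (Dy h) z = Dy (Defs.Dx h) z.
Proof.
  intros HC Hz. destruct (C2_grad h HC) as (G & Gx & Gy).
  destruct z as [x y].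
  apply (Schwarz (fun a b => h (a, b)) x y).
  - apply locally_2d_locally. generalize (open_unit_disk _ Hz); apply filter_imp.
    intros [a b] Hab; simpl.
    destruct (G a b Hab) as (A1 & A2 & _), (Gx a b Hab) as (_ & B2 & _),
      (Gy a b Hab) as (C1 & _).
    refine (conj _ (conj _ (conj _ _))); eexists; [exact A1 | exact A2 | exact C1 | exact B2].
  - apply continuity_2d_pt_filterlim.
    apply (continuous_ext (Defs.Dx (Dy h))); [intros [a b]; reflexivity | ].
    exact (proj1 (proj2 (proj2 (Gy x y Hz)))).
  - apply continuity_2d_pt_filterlim.
    apply (continuous_ext (Dy (Defs.Dx h))); [intros [a b]; reflexivity | ].
    exact (proj2 (proj2 (proj2 (Gx x y Hz)))).
Qed.

(** The operator is a quarter of the Laplacian, because the mixed partials cancel by symmetry. *)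
Lemma wirtinger_laplacian (f : C -> C) (z : C) :
  C2_map_on unit_disk f -> unit_disk z ->
  let f1 := fun w => Re (f w) in let f2 := fun w => Im (f w) in
  wirtinger_bar (wirtinger f) z =
  ((Defs.Dx (Defs.Dx f1) z + Dy (Dy f1) z) / 4, (Defs.Dx (Defs.Dx f2) z + Dy (Dy f2) z) / 4).
Proof.
  intros [HC1 HC2] Hz f1 f2.
  destruct (C2_grad f1 HC1) as (_ & G1x & G1y).
  destruct (C2_grad f2 HC2) as (_ & G2x & G2y).
  pose proof (grad_on_lin unit_disk (/ 2) (/ 2) _ _ _ _ _ _ G1x G2y) as GR.
  pose proof (grad_on_lin unit_disk (/ 2) (- / 2) _ _ _ _ _ _ G2x G1y) as GI.
  assert (ER : grad_on unit_disk (fun w => Re (wirtinger f w))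
    (fun z => / 2 * Defs.Dx (Defs.Dx f1) z + / 2 * Defs.Dx (Dy f2) z)
    (fun z => / 2 * Dy (Defs.Dx f1) z + / 2 * Dy (Dy f2) z)).
  { refine (grad_on_ext unit_disk _ _ _ _ _ _ open_unit_disk _ _ _ GR); try reflexivity.
    intros w _. unfold wirtinger, CDx, CDy. fold f1 f2. simpl. field. }
  assert (EI : grad_on unit_disk (fun w => Im (wirtinger f w))
    (fun z => / 2 * Defs.Dx (Defs.Dx f2) z + - / 2 * Defs.Dx (Dy f1) z)
    (fun z => / 2 * Dy (Defs.Dx f2) z + - / 2 * Dy (Dy f1) z)).
  { refine (grad_on_ext unit_disk _ _ _ _ _ _ open_unit_disk _ _ _ GI); try reflexivity.
    intros w _. unfold wirtinger, CDx, CDy. fold f1 f2. simpl. field. }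
  destruct (grad_on_unique _ _ _ _ z ER Hz) as [R1 R2].
  destruct (grad_on_unique _ _ _ _ z EI Hz) as [I1 I2].
  unfold wirtinger_bar, CDx, CDy. rewrite R1, R2, I1, I2.
  pose proof (mixed_partials f1 z HC1 Hz) as S1.
  pose proof (mixed_partials f2 z HC2 Hz) as S2.
  rewrite S1, S2.
  apply injective_projections; simpl; field.
Qed.

(** In complex notation the value is [(rho_x - i rho_y) / rho]. *)
Lemma wirtinger_log_square (D : C -> Prop) (rho : C -> R) (w : C) :
  conformal_metric D rho -> D w ->
  wirtinger (fun w => RtoC (ln (rho w ^ 2))) w = (Defs.Dx rho w / rho w, - (Dy rho w / rho w)).
Proof.
  intros [Hp HC] Hw. pose proof (C1_on_grad D rho HC) as G.
  specialize (Hp w Hw). destruct w as [x y].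
  destruct (G x y Hw) as (G1 & G2 & _).
  assert (L : forall (h : R -> R) t l, 0 < h t -> is_derive h t l ->
    Derive (fun s => ln (h s ^ 2)) t = 2 * (l / h t)).
  { intros h t l Ht Hd. apply is_derive_unique. auto_derive.
    - split; [now exists l | split; [ | auto]]. simpl. nra.
    - change (Derive (fun x : R => h x) t) with (Derive h t).
      rewrite (is_derive_unique _ _ _ Hd). field. lra. }
  set (k := fun w : C => RtoC (ln (rho w ^ 2))).
  assert (A1 : Defs.Dx (fun w => Re (k w)) (x, y) = 2 * (Defs.Dx rho (x, y) / rho (x, y)))
    by exact (L (fun t => rho (t, y)) x _ Hp G1).
  assert (A2 : Dy (fun w => Re (k w)) (x, y) = 2 * (Dy rho (x, y) / rho (x, y)))
    by exact (L (fun t => rho (x, t)) y _ Hp G2).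
  assert (A3 : Defs.Dx (fun w => Im (k w)) (x, y) = 0) by exact (Derive_const 0 x).
  assert (A4 : Dy (fun w => Im (k w)) (x, y) = 0) by exact (Derive_const 0 y).
  unfold wirtinger, CDx, CDy. rewrite A1, A2, A3, A4.
  apply injective_projections; simpl; field; lra.
Qed.

Section Harmonic_map.
Variables (D : C -> Prop) (rho : C -> R) (f : C -> C) (I : R -> Prop) (g g' : R -> C).
Hypothesis HD : open D.
Hypothesis Hrho : conformal_metric D rho.
Hypothesis HI : is_connected I.
Hypothesis HP : C1_path I g g'.
Hypothesis Hreg : forall t, I t -> g' t <> RtoC 0.
Hypothesis HDg : forall t, I t -> D (g t).
Hypothesis Hlen : forall s t, I s -> I t -> s <= t ->
  rho_dist D rho (g s) (g t) = rho_length rho g g' s t.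
Hypothesis Hf : rho_harmonic D rho unit_disk f.
Variable tau : C -> R.
Hypothesis Htau : forall z, unit_disk z -> I (tau z) /\ g (tau z) = f z.

Let sigma (t : R) := rho (g t) * Cmod (g' t).
Let S (t : R) := RInt sigma (tau (RtoC 0)) t.
(** The map [tau] is any choice of parameters for the points [f z], with no regularity assumed. The
    integral is oriented, so the coordinate is negative on one side of the base point. *)
Definition arclength_coordinate (z : C) : R :=
  RInt (fun t => rho (g t) * Cmod (g' t)) (tau (RtoC 0)) (tau z).
Let u := arclength_coordinate.
Let e1 : C := (1, 0).
Let e2 : C := (0, 1).
Let Q1 (z : C) := momentum rho g g' e1 (tau z).
Let Q2 (z : C) := momentum rho g g' e2 (tau z).
Let f1 (z : C) := Re (f z).
Let f2 (z : C) := Im (f z).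
Let f1x := Defs.Dx f1.
Let f1y := Dy f1.
Let f2x := Defs.Dx f2.
Let f2y := Dy f2.

Lemma sigma_cont_in (t : R) : I t -> cont_in I sigma t.
Proof. intros Ht. apply (speed_cont_in D rho HD Hrho I g g' t); auto. Qed.

Lemma sigma_pos (t : R) : I t -> 0 < sigma t.
Proof.
  intros Ht. apply Rmult_lt_0_compat.
  - apply Hrho; auto.
  - apply Cmod_gt_0; auto.
Qed.

Lemma unit_disk_0 : unit_disk (RtoC 0).
Proof. unfold unit_disk. rewrite Cmod_0. lra. Qed.

Lemma arclength_difference (s t : R) : I s -> I t -> S t - S s = RInt sigma s t.
Proof.
  intros Hs Ht. unfold S.
  assert (H0 : I (tau (RtoC 0))) by apply (Htau _ unit_disk_0).
  rewrite <- (RInt_Chasles sigma (tau (RtoC 0)) s t).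
  - unfold plus; simpl. ring.
  - apply (ex_RInt_connected I sigma HI sigma_cont_in); auto.
  - apply (ex_RInt_connected I sigma HI sigma_cont_in); auto.
Qed.

Lemma dist_arclength (s t : R) : I s -> I t -> rho_dist D rho (g s) (g t) = Rabs (S t - S s).
Proof.
  assert (W : forall s t, s <= t -> I s -> I t -> rho_dist D rho (g s) (g t) = Rabs (S t - S s)).
  { intros p q Hpq Hp Hq. rewrite Hlen by assumption. unfold rho_length. fold sigma.
    rewrite <- arclength_difference by assumption.
    rewrite Rabs_right; [reflexivity | ].
    destruct Hpq as [L | ->]; [ | lra].
    pose proof (arclength_increasing I sigma S HI sigma_cont_in sigma_pos
                  arclength_difference p q Hp Hq L). lra. }
  intros Hs Ht. destruct (Rle_dec s t).
  - now apply W.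
  - rewrite (rho_dist_sym D rho HD Hrho), W by (auto; lra). apply Rabs_minus_sym.
Qed.

Lemma dist_coordinate (z w : C) : unit_disk z -> unit_disk w ->
  rho_dist D rho (f z) (f w) = Rabs (u w - u z).
Proof.
  intros Hz Hw. destruct (Htau z Hz) as [Iz <-], (Htau w Hw) as [Iw <-].
  now apply dist_arclength.
Qed.

(** Near [w0] the segments stay in [D] and [rho] stays below [rho w0 + 1]. Combined with
    [dist_arclength], this prevents the geodesic from returning close to one of its points after a
    positive length. *)
Lemma rho_dist_local_bound (w0 : C) : D w0 ->
  exists M eta, 0 < M /\ 0 < eta /\ forall w : C,
    Rabs (fst w - fst w0) < eta -> Rabs (snd w - snd w0) < eta ->
    rho_dist D rho w0 w <= M * (Rabs (fst w - fst w0) + Rabs (snd w - snd w0)).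
Proof.
  intros Hw0.
  assert (HL : locally w0 (fun w => D w /\ rho w < rho w0 + 1)).
  { apply filter_and; [now apply HD | ].
    apply (conformal_metric_continuous D rho w0 HD Hrho Hw0 (fun y => y < rho w0 + 1)).
    apply open_lt. lra. }
  destruct HL as [eta Heta].
  exists (rho w0 + 1), eta.
  pose proof (proj1 Hrho w0 Hw0) as Hp.
  split; [lra | split; [apply cond_pos | ]].
  intros w H1 H2.
  apply Rle_trans with ((rho w0 + 1) * Cmod (w - w0)).
  - apply rho_dist_segment; auto. intros t Ht; cbv zeta.
    assert (B : forall p q, Rabs (q - p) < eta -> Rabs (p + t * (q - p) - p) < eta).
    { intros p q Hpq. replace (p + t * (q - p) - p) with (t * (q - p)) by ring.
      rewrite Rabs_mult, (Rabs_right t) by lra. pose proof (Rabs_pos (q - p)). nra. }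
    destruct (Heta (w0 + RtoC t * (w - w0))%C) as [B1 B2].
    + split.
      * change (Rabs (fst w0 + (t * (fst w - fst w0) - 0 * (snd w - snd w0)) - fst w0) < eta).
        rewrite Rmult_0_l, Rminus_0_r. now apply B.
      * change (Rabs (snd w0 + (t * (snd w - snd w0) + 0 * (fst w - fst w0)) - snd w0) < eta).
        rewrite Rmult_0_l, Rplus_0_r. now apply B.
    + split; [exact B1 | lra].
  - apply Rmult_le_compat_l; [lra | ]. apply (Cmod_le_sum (w - w0)%C).
Qed.

(** Every subarc of the geodesic minimises length between its ends, so the integrated equation holds
    on all subintervals and can be differentiated. *)
Lemma momentum_derivative (e : C) (t : R) : I t ->
  deriv_in I (momentum rho g g' e) t (force rho g g' e t).
Proof.
  intros Ht.
  assert (Cf : forall s, I s -> cont_in I (force rho g g' e) s).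
  { intros s Hs. apply force_cont_in with D; auto. }
  apply deriv_in_RInt; auto.
  assert (W : forall p q, p < q -> I p -> I q ->
    momentum rho g g' e q - momentum rho g g' e p = RInt (force rho g g' e) p q).
  { intros p q Hpq Hp Hq.
    pose proof (connected_interval I HI p q Hp Hq) as Hsub.
    apply geodesic_equation with D; auto.
    - now apply C1_path_subset with I.
    - intros l Hl. rewrite <- Hlen by (auto; lra). now apply rho_dist_le. }
  intros s Hs. destruct (Rtotal_order t s) as [L | [-> | L]].
  - now apply W.
  - rewrite RInt_point. exact (Rminus_diag _).
  - rewrite <- opp_RInt_swap by (apply (ex_RInt_connected I _ HI Cf); auto).
    rewrite <- W by auto. unfold opp; simpl. ring.
Qed.

(** Euler's relation for the Lagrangian, homogeneous of degree one in the velocity. It is the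
    normalisation that [deriv_in_arclength] requires of its linear function. *)
Lemma momentum_dot_velocity (t : R) : I t ->
  momentum rho g g' e1 t * fst (g' t) + momentum rho g g' e2 t * snd (g' t) = sigma t.
Proof.
  intros Ht. pose proof (proj1 (Cmod_gt_0 _) (Hreg t Ht)) as Hp.
  pose proof (Cmod2_alt (g' t)) as E; unfold Re, Im in E.
  unfold momentum, sigma, e1, e2; simpl fst; simpl snd.
  replace (Cmod (g' t)) with (Cmod (g' t) ^ 2 / Cmod (g' t)) at 3 by (field; lra).
  rewrite E. field. lra.
Qed.

(** * Differentiation along horizontal and vertical lines *)

Section Slice.
Variables (p : R -> C) (x v1 v2 : R).
Let J (t : R) := unit_disk (p t).
Hypothesis Hx : J x.
Hypothesis HJ : locally x J.
Hypothesis D1 : is_derive (fun t => f1 (p t)) x v1.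
Hypothesis D2 : is_derive (fun t => f2 (p t)) x v2.
Let z := p x.
Let du := Q1 z * v1 + Q2 z * v2.

Lemma slice_in_I (y : R) : J y -> I (tau (p y)).
Proof. intros Hy. now apply (Htau (p y)). Qed.

Lemma slice_g (y : R) : J y -> g (tau (p y)) = f (p y).
Proof. intros Hy. now apply (Htau (p y)). Qed.

(** The two components of the momentum at the point provide the linear function of position that
    approximates arclength to first order. *)
Lemma slice_coordinate : deriv_in J (fun t => u (p t)) x du.
Proof.
  pose proof (slice_in_I x Hx) as It.
  destruct (C1_path_deriv I g g' _ HP It) as [G1 G2].
  destruct (rho_dist_local_bound (g (tau (p x)))) as (M & eta & HM & Heta & B); [now apply HDg | ].
  apply (deriv_in_arclength I sigma S HI sigma_cont_in sigma_pos arclength_difference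
           J (fun t => tau (p t)) (fun t => fst (g t)) (fun t => snd (g t))
           x (fst (g' (tau (p x)))) (snd (g' (tau (p x)))) v1 v2 _ _ M eta); auto.
  - apply slice_in_I.
  - now apply momentum_dot_velocity.
  - apply deriv_in_ext with (fun t => f1 (p t)); auto.
    + intros y Hy. now rewrite slice_g.
    + now apply is_derive_deriv_in.
  - apply deriv_in_ext with (fun t => f2 (p t)); auto.
    + intros y Hy. now rewrite slice_g.
    + now apply is_derive_deriv_in.
  - intros s Hs B1 B2. rewrite <- dist_arclength by auto. now apply B.
Qed.

Lemma slice_coordinate_derive : is_derive (fun t => u (p t)) x du.
Proof. apply deriv_in_is_derive with J; auto. apply slice_coordinate. Qed.

Lemma slice_comp (h : R -> R) (m : R) : deriv_in I h (tau z) m ->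
  is_derive (fun t => h (tau (p t))) x (m / sigma (tau z) * du).
Proof.
  intros Hh. apply deriv_in_is_derive with J; auto.
  apply (deriv_in_comp_arclength I sigma S HI sigma_cont_in sigma_pos arclength_difference
           J (fun t => tau (p t)) h x du m); auto.
  - apply slice_in_I.
  - apply slice_coordinate.
Qed.

(** The chain rule through arclength, applied to the coordinates of [g]: the velocity of [f] is the
    tangent vector per unit of arclength times the derivative of the coordinate. *)
Lemma slice_velocity :
  v1 = fst (g' (tau z)) / sigma (tau z) * du /\ v2 = snd (g' (tau z)) / sigma (tau z) * du.
Proof.
  pose proof (slice_in_I x Hx) as It.
  destruct (C1_path_deriv I g g' _ HP It) as [G1 G2].
  split.
  - rewrite <- (is_derive_unique _ _ _ D1).
    apply is_derive_unique.
    apply is_derive_ext_loc with (fun t => fst (g (tau (p t)))).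
    + revert HJ; apply filter_imp; intros y Hy. now rewrite slice_g.
    + now apply (slice_comp (fun t => fst (g t))).
  - rewrite <- (is_derive_unique _ _ _ D2).
    apply is_derive_unique.
    apply is_derive_ext_loc with (fun t => snd (g (tau (p t)))).
    + revert HJ; apply filter_imp; intros y Hy. now rewrite slice_g.
    + now apply (slice_comp (fun t => snd (g t))).
Qed.

(** The same chain rule applied to the momentum. The speed [|g'|] cancels in [force / sigma],
    leaving the logarithmic derivatives of [rho]. *)
Lemma slice_momentum :
  is_derive (fun t => Q1 (p t)) x (Defs.Dx rho (f z) / rho (f z) * du) /\
  is_derive (fun t => Q2 (p t)) x (Dy rho (f z) / rho (f z) * du).
Proof.
  pose proof (slice_in_I x Hx) as It.
  pose proof (proj1 (Cmod_gt_0 _) (Hreg _ It)) as Hc.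
  pose proof (proj1 Hrho _ (HDg _ It)) as Hr.
  rewrite <- (slice_g x Hx : g (tau z) = f z).
  fold z in Hc, Hr.
  split.
  - replace (Defs.Dx rho (g (tau z)) / rho (g (tau z)))
      with (force rho g g' e1 (tau z) / sigma (tau z)).
    + apply (slice_comp (momentum rho g g' e1)). now apply momentum_derivative.
    + unfold force, sigma, e1; simpl fst; simpl snd. field. lra.
  - replace (Dy rho (g (tau z)) / rho (g (tau z)))
      with (force rho g g' e2 (tau z) / sigma (tau z)).
    + apply (slice_comp (momentum rho g g' e2)). now apply momentum_derivative.
    + unfold force, sigma, e2; simpl fst; simpl snd. field. lra.
Qed.
End Slice.

(** Continuity of [f] makes [rho_dist (f z) (f w)] small, and this distance is the difference of the
    coordinates. The statement replaces continuity of [tau] from here on. *)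
Lemma coordinate_near (z : C) (eps : R) : unit_disk z -> 0 < eps ->
  locally z (fun w => unit_disk w /\ Rabs (u w - u z) < eps).
Proof.
  intros Hz He.
  assert (Hc : continuous f1 z /\ continuous f2 z).
  { destruct Hf as (_ & [HC1 HC2] & _).
    split; eapply (grad_on_continuous unit_disk); try apply open_unit_disk; auto;
      apply C1_on_grad; [apply HC1 | apply HC2]. }
  destruct Hc as [Hc1 Hc2].
  destruct (rho_dist_local_bound (f z)) as (M & eta & HM & Heta & B); [now apply Hf | ].
  set (m := Rmin eta (eps / (2 * M))).
  assert (Hm : 0 < m).
  { apply Rmin_glb_lt; [assumption | apply Rdiv_lt_0_compat; lra]. }
  assert (HL1 := proj1 (filterlim_locally _ _) Hc1 (mkposreal m Hm)).
  assert (HL2 := proj1 (filterlim_locally _ _) Hc2 (mkposreal m Hm)).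
  generalize (filter_and _ _ (open_unit_disk z Hz) (filter_and _ _ HL1 HL2)).
  apply filter_imp; intros w (Hw & B1 & B2).
  split; [assumption | ].
  rewrite <- dist_coordinate by assumption.
  change (Rabs (fst (f w) - fst (f z)) < m) in B1.
  change (Rabs (snd (f w) - snd (f z)) < m) in B2.
  assert (Hm1 : m <= eta) by apply Rmin_l.
  assert (Hm2 : m <= eps / (2 * M)) by apply Rmin_r.
  apply Rle_lt_trans with (1 := B (f w) ltac:(lra) ltac:(lra)).
  apply Rlt_le_trans with (M * (2 * m)).
  - apply Rmult_lt_compat_l; lra.
  - apply Rle_div_r in Hm2; [ | lra]. lra.
Qed.

Lemma continuous_momentum (e z : C) : unit_disk z ->
  continuous (fun w => momentum rho g g' e (tau w)) z.
Proof.
  intros Hz. apply filterlim_locally; intros eps.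
  destruct (Htau z Hz) as [It _].
  destruct (cont_in_wrt_arclength I sigma S HI sigma_cont_in sigma_pos arclength_difference
              (momentum rho g g' e) (tau z) eps It) as (d & Hd & B).
  - eapply deriv_in_cont. now apply momentum_derivative.
  - apply cond_pos.
  - generalize (coordinate_near z d Hz Hd).
    apply filter_imp; intros w [Hw Hu].
    apply (B (tau w)); [now apply Htau | exact Hu].
Qed.

Definition coordinate_dx (z : C) : R := Q1 z * f1x z + Q2 z * f2x z.
Definition coordinate_dy (z : C) : R := Q1 z * f1y z + Q2 z * f2y z.
Let ux := coordinate_dx.
Let uy := coordinate_dy.

Lemma unit_disk_slices (x y : R) : unit_disk (x, y) ->
  locally x (fun t => unit_disk (t, y)) /\ locally y (fun t => unit_disk (x, t)).
Proof.
  intros Hz.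
  assert (HL2 : locally_2d (fun a b => unit_disk (a, b)) x y).
  { apply locally_2d_locally. generalize (open_unit_disk _ Hz); apply filter_imp.
    now intros [a b]. }
  split.
  - now apply locally_2d_1d_const_y in HL2.
  - now apply locally_2d_1d_const_x in HL2.
Qed.

Lemma velocity_coordinates (z : C) : unit_disk z ->
  let a := fst (g' (tau z)) / sigma (tau z) in
  let b := snd (g' (tau z)) / sigma (tau z) in
  f1x z = a * ux z /\ f1y z = a * uy z /\ f2x z = b * ux z /\ f2y z = b * uy z.
Proof.
  intros Hz. destruct Hf as (_ & [HC1 HC2] & _).
  destruct (C2_grad _ HC1) as (G1 & _ & _). destruct (C2_grad _ HC2) as (G2 & _ & _).
  destruct z as [x y].
  destruct (unit_disk_slices x y Hz) as [L1 L2].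
  destruct (G1 x y Hz) as (X1 & Y1 & _). destruct (G2 x y Hz) as (X2 & Y2 & _).
  destruct (slice_velocity (fun t => (t, y)) x _ _ Hz L1 X1 X2) as [E1 E2].
  destruct (slice_velocity (fun t => (x, t)) y _ _ Hz L2 Y1 Y2) as [E3 E4].
  cbv zeta. auto.
Qed.

Lemma continuous_f (h : C -> R) (z : C) : unit_disk z -> continuous h (f z) ->
  continuous (fun w => h (f w)) z.
Proof.
  intros Hz Hh. destruct Hf as (_ & [HC1 HC2] & _).
  apply (continuous_comp f h); [ | exact Hh].
  apply continuous_ext with (fun w => (f1 w, f2 w) : C).
  - intros w. unfold f1, f2. now destruct (f w).
  - apply continuous_pair_C; eapply (grad_on_continuous unit_disk);
      try apply open_unit_disk; auto; apply C1_on_grad; [apply HC1 | apply HC2].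
Qed.

Lemma coordinate_grad : grad_on unit_disk u ux uy.
Proof.
  intros x y Hz. destruct Hf as (_ & [HC1 HC2] & _).
  destruct (C2_grad _ HC1) as (G1 & _ & _). destruct (C2_grad _ HC2) as (G2 & _ & _).
  destruct (unit_disk_slices x y Hz) as [L1 L2].
  destruct (G1 x y Hz) as (X1 & Y1 & CX1 & CY1).
  destruct (G2 x y Hz) as (X2 & Y2 & CX2 & CY2).
  assert (K1 := continuous_momentum e1 (x, y) Hz).
  assert (K2 := continuous_momentum e2 (x, y) Hz).
  refine (conj _ (conj _ (conj _ _))).
  - exact (slice_coordinate_derive (fun t => (t, y)) x _ _ Hz L1 X1 X2).
  - exact (slice_coordinate_derive (fun t => (x, t)) y _ _ Hz L2 Y1 Y2).
  - apply (continuous_plus (fun z => Q1 z * f1x z) (fun z => Q2 z * f2x z)).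
    + now apply (continuous_mult Q1 f1x).
    + now apply (continuous_mult Q2 f2x).
  - apply (continuous_plus (fun z => Q1 z * f1y z) (fun z => Q2 z * f2y z)).
    + now apply (continuous_mult Q1 f1y).
    + now apply (continuous_mult Q2 f2y).
Qed.

(** The momentum at [f z] is a C^1 function of [z], although the tangent of the arc is only
    continuous in its parameter. This gives the coordinate its second derivatives. *)
Lemma momentum_grad :
  grad_on unit_disk Q1 (fun z => Defs.Dx rho (f z) / rho (f z) * ux z)
    (fun z => Defs.Dx rho (f z) / rho (f z) * uy z) /\
  grad_on unit_disk Q2 (fun z => Dy rho (f z) / rho (f z) * ux z)
    (fun z => Dy rho (f z) / rho (f z) * uy z).
Proof.
  assert (HG := C1_on_grad D rho (proj2 Hrho)).
  assert (W : forall x y, unit_disk (x, y) ->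
    continuous (fun z => Defs.Dx rho (f z) / rho (f z)) (x, y) /\
    continuous (fun z => Dy rho (f z) / rho (f z)) (x, y)).
  { intros x y Hz.
    assert (HDz : D (f (x, y))) by now apply Hf.
    assert (Cr := conformal_metric_continuous D rho _ HD Hrho HDz).
    assert (Hp := proj1 Hrho _ HDz).
    destruct (HG (fst (f (x, y))) (snd (f (x, y)))) as (_ & _ & Crx & Cry);
      [now rewrite <- surjective_pairing | ].
    rewrite <- surjective_pairing in Crx, Cry.
    split.
    - apply (continuous_f (fun w => Defs.Dx rho w / rho w)); auto.
      prove_continuous; auto. lra.
    - apply (continuous_f (fun w => Dy rho w / rho w)); auto.
      prove_continuous; auto. lra. }
  destruct Hf as (_ & [HC1 HC2] & _).
  destruct (C2_grad _ HC1) as (G1 & _ & _). destruct (C2_grad _ HC2) as (G2 & _ & _).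
  split; intros x y Hz; destruct (W x y Hz) as [W1 W2];
    destruct (unit_disk_slices x y Hz) as [L1 L2];
    destruct (G1 x y Hz) as (X1 & Y1 & _); destruct (G2 x y Hz) as (X2 & Y2 & _);
    destruct (coordinate_grad x y Hz) as (_ & _ & Cx & Cy);
    destruct (slice_momentum (fun t => (t, y)) x _ _ Hz L1 X1 X2) as [M1 M2];
    destruct (slice_momentum (fun t => (x, t)) y _ _ Hz L2 Y1 Y2) as [M3 M4];
    refine (conj _ (conj _ (conj _ _))).
  - exact M1.
  - exact M3.
  - now apply (continuous_mult (fun z => Defs.Dx rho (f z) / rho (f z)) ux).
  - now apply (continuous_mult (fun z => Defs.Dx rho (f z) / rho (f z)) uy).
  - exact M2.
  - exact M4.
  - now apply (continuous_mult (fun z => Dy rho (f z) / rho (f z)) ux).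
  - now apply (continuous_mult (fun z => Dy rho (f z) / rho (f z)) uy).
Qed.
Lemma coordinate_harmonic : harmonic_on unit_disk u ux uy.
Proof.
  split; [apply coordinate_grad | ].
  destruct momentum_grad as [GQ1 GQ2].
  pose proof (proj1 (proj2 Hf)) as HC.
  destruct (C2_grad _ (proj1 HC)) as (_ & G1x & G1y).
  destruct (C2_grad _ (proj2 HC)) as (_ & G2x & G2y).
  pose proof (grad_on_lin unit_disk 1 1 _ _ _ _ _ _
    (grad_on_mult unit_disk _ _ _ _ _ _ open_unit_disk GQ1 G1x)
    (grad_on_mult unit_disk _ _ _ _ _ _ open_unit_disk GQ2 G2x)) as GX.
  pose proof (grad_on_lin unit_disk 1 1 _ _ _ _ _ _
    (grad_on_mult unit_disk _ _ _ _ _ _ open_unit_disk GQ1 G1y)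
    (grad_on_mult unit_disk _ _ _ _ _ _ open_unit_disk GQ2 G2y)) as GY.
  do 4 eexists; refine (conj _ (conj _ _)).
  - refine (grad_on_ext unit_disk _ _ _ _ _ _ open_unit_disk _ _ _ GX);
      [intros; unfold ux, coordinate_dx; rewrite !Rmult_1_l; reflexivity
      | reflexivity | reflexivity].
  - refine (grad_on_ext unit_disk _ _ _ _ _ _ open_unit_disk _ _ _ GY);
      [intros; unfold uy, coordinate_dy; rewrite !Rmult_1_l; reflexivity
      | reflexivity | reflexivity].
  - intros z Hz; cbv beta.
    destruct (Htau z Hz) as [It Eg].
    assert (HDz : D (f z)) by now apply Hf.
    pose proof (proj1 Hrho _ HDz) as Hr.
    pose proof (proj1 (Cmod_gt_0 _) (Hreg _ It)) as Hm.
    pose proof (Cmod2_alt (g' (tau z))) as Em; unfold Re, Im in Em.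
    pose proof (proj2 (proj2 Hf) z Hz) as HE.
    rewrite (wirtinger_laplacian f z HC Hz), (wirtinger_log_square D rho _ Hrho HDz) in HE.
    unfold wirtinger, wirtinger_bar, CDx, CDy in HE.
    fold f1 f2 f1x f1y f2x f2y in HE.
    destruct (velocity_coordinates z Hz) as (V1 & V2 & V3 & V4).
    unfold sigma in V1, V2, V3, V4. rewrite Eg in V1, V2, V3, V4.
    fold f1 f2 f1x f1y f2x f2y.
    rewrite V1, V2, V3, V4 in HE |- *.
    assert (EQ1 : Q1 z = rho (f z) * (fst (g' (tau z)) / Cmod (g' (tau z)))).
    { unfold Q1, momentum, e1; simpl fst; simpl snd. rewrite Eg. f_equal. f_equal. ring. }
    assert (EQ2 : Q2 z = rho (f z) * (snd (g' (tau z)) / Cmod (g' (tau z)))).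
    { unfold Q2, momentum, e2; simpl fst; simpl snd. rewrite Eg. f_equal. f_equal. ring. }
    rewrite EQ1, EQ2.
    (* The product rule: the products of the gradients of [Q1], [Q2] with those of [f1], [f2], all
       multiples of the gradient of [u], and then the momentum applied to the Laplacian of [f]. *)
    match goal with |- ?G = 0 => transitivity
      (Defs.Dx rho (f z) / rho (f z) * (fst (g' (tau z)) / (rho (f z) * Cmod (g' (tau z))))
         * (ux z ^ 2 + uy z ^ 2)
       + Dy rho (f z) / rho (f z) * (snd (g' (tau z)) / (rho (f z) * Cmod (g' (tau z))))
         * (ux z ^ 2 + uy z ^ 2)
       + rho (f z) * (fst (g' (tau z)) / Cmod (g' (tau z))) * (Defs.Dx f1x z + Dy f1y z)
       + rho (f z) * (snd (g' (tau z)) / Cmod (g' (tau z))) * (Defs.Dx f2x z + Dy f2y z));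
       [ring | ] end.
    set (L1 := Defs.Dx f1x z + Dy f1y z) in *.
    set (L2 := Defs.Dx f2x z + Dy f2y z) in *.
    generalize (f_equal fst HE) (f_equal snd HE); clear HE; intros HE1 HE2.
    simpl in HE1, HE2.
    clearbody L1 L2.
    revert Hr Hm Em HE1 HE2.
    generalize (rho (f z)) (Cmod (g' (tau z))) (fst (g' (tau z))) (snd (g' (tau z)))
      (Defs.Dx rho (f z)) (Dy rho (f z)) (ux z) (uy z).
    clear. intros rr m a b p q X Y Hr Hm Em HE1 HE2.
    (* Real and imaginary parts of the harmonic map equation, solved for the two Laplacians. *)
    assert (E1 : L1 = - ((X ^ 2 + Y ^ 2) / (rr ^ 3 * m ^ 2)
                         * (p * (a ^ 2 - b ^ 2) + 2 * q * a * b))).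
    { rewrite <- (Rminus_0_r L1), <- (Rmult_0_r 4), <- HE1 at 1. field. lra. }
    assert (E2 : L2 = - ((X ^ 2 + Y ^ 2) / (rr ^ 3 * m ^ 2)
                         * (2 * p * a * b - q * (a ^ 2 - b ^ 2)))).
    { rewrite <- (Rminus_0_r L2), <- (Rmult_0_r 4), <- HE2 at 1. field. lra. }
    rewrite E1, E2.
    (* The last factor is zero, [m] being the modulus of [(a, b)]. *)
    transitivity ((X ^ 2 + Y ^ 2) * (p * a + q * b) / (rr ^ 2 * m)
                  * (1 - (a ^ 2 + b ^ 2) / m ^ 2)); [field; lra | ].
    rewrite <- Em. field. lra.
Qed.

(** The differential of [f] has rank at most one: it sends [h] to a multiple of the tangent [g'],
    and its [rho]-length is the absolute value of the derivative of [u] along [h]. *)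
Lemma operator_norm_differential (z : C) (B : R) : unit_disk z ->
  (forall h : C, fst h * ux z + snd h * uy z <= Cmod h * B) ->
  rho (f z) * operator_norm (Defs.differential f z) <= B.
Proof.
  intros Hz HB.
  destruct (Htau z Hz) as [It Eg].
  assert (Hr : 0 < rho (f z)) by (apply (proj1 Hrho); now apply Hf).
  pose proof (proj1 (Cmod_gt_0 _) (Hreg _ It)) as Hm.
  destruct (velocity_coordinates z Hz) as (V1 & V2 & V3 & V4).
  unfold sigma in V1, V2, V3, V4. rewrite Eg in V1, V2, V3, V4.
  assert (HN : forall h, Cmod (Defs.differential f z h)
            = Rabs (fst h * ux z + snd h * uy z) / rho (f z)).
  { intros h.
    replace (Defs.differential f z h) with
      (RtoC ((fst h * ux z + snd h * uy z) / (rho (f z) * Cmod (g' (tau z)))) * g' (tau z))%C.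
    - rewrite Cmod_mult, Cmod_R. unfold Rdiv. rewrite Rabs_mult, Rabs_inv, Rabs_mult.
      rewrite (Rabs_right (rho (f z))), (Rabs_right (Cmod (g' (tau z)))) by lra.
      field. lra.
    - unfold Defs.differential, CDx, CDy. fold f1 f2 f1x f1y f2x f2y.
      rewrite V1, V2, V3, V4.
      apply injective_projections; simpl; unfold Re, Im; field; lra. }
  assert (HB1 : forall h, Cmod h <= 1 -> Cmod (Defs.differential f z h) <= B / rho (f z)).
  (* Adding the bounds for the opposite unit vectors [(1, 0)] and [(-1, 0)] gives [0 <= 2 B]. *)
  { assert (H0B : 0 <= B).
    { pose proof (HB (1, 0)) as P1. pose proof (HB (- (1), 0)) as P2.
      pose proof (Cmod_1) as N1. unfold RtoC in N1.
      pose proof (Cmod_opp (1, 0)) as N2.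
      replace (- (1, 0))%C with ((- (1), 0) : C) in N2
        by (apply injective_projections; simpl; ring).
      rewrite N2 in P2. rewrite N1 in P1, P2. simpl in P1, P2. lra. }
    intros h Hh. rewrite HN. unfold Rdiv. apply Rmult_le_compat_r.
    - left; now apply Rinv_0_lt_compat.
    - pose proof (HB h) as P1. pose proof (HB (- h)%C) as P2. rewrite Cmod_opp in P2.
      simpl in P2. pose proof (Cmod_ge_0 h).
      apply Rabs_le. nra. }
  unfold operator_norm.
  set (E := fun s => exists h, Cmod h <= 1 /\ s = Cmod (Defs.differential f z h)).
  destruct (Lub_Rbar_correct E) as [Hub Hlub].
  assert (Hle : Rbar_le (Lub_Rbar E) (B / rho (f z))).
  { apply Hlub. intros s (h & Hh & ->). now apply HB1. }
  (* The value at [h = 0] shows that the supremum is not minus infinity, so it is a real number and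
     [real] returns it. *)
  assert (Hge : Rbar_le (Cmod (Defs.differential f z 0)) (Lub_Rbar E)).
  { apply Hub. exists (RtoC 0). split; [rewrite Cmod_0; lra | reflexivity]. }
  rewrite Rmult_comm. apply Rle_div_r; [exact Hr | ].
  destruct (Lub_Rbar E); simpl in *; tauto.
Qed.
End Harmonic_map.

(** * The three estimates *)

Lemma harmonic_on_opp (W : C -> Prop) (u ux uy : C -> R) : open W ->
  harmonic_on W u ux uy ->
  harmonic_on W (fun z => - u z) (fun z => - ux z) (fun z => - uy z).
Proof.
  intros HW [Hu (uxx & uxy & uyx & uyy & Hux & Huy & HL)].
  assert (N : forall h hx hy, grad_on W h hx hy ->
    grad_on W (fun z => - h z) (fun z => - hx z) (fun z => - hy z)).
  { intros h hx hy H.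
    refine (grad_on_ext W _ _ _ _ _ _ HW _ _ _ (grad_on_lin W (-1) 0 _ _ _ _ _ _ H H));
      intros; simpl; ring. }
  split; [now apply N | ].
  do 4 eexists; refine (conj (N _ _ _ Hux) (conj (N _ _ _ Huy) _)).
  intros z Hz. specialize (HL z Hz). simpl. lra.
Qed.

Lemma harmonic_distance (r : R) (u ux uy : C -> R) (z1 z2 : C) :
  0 < r -> harmonic_on unit_disk u ux uy ->
  (forall z, unit_disk z -> Rabs (u z) <= r) ->
  unit_disk z1 -> unit_disk z2 ->
  Rabs (u z2 - u z1) <= 4 / PI * r * hyperbolic_dist z1 z2.
Proof.
  intros Hr Hu Hb H1 H2.
  pose proof (harmonic_distance_upper r u ux uy z1 z2 Hr Hu Hb H1 H2) as B1.
  pose proof (harmonic_distance_upper r _ _ _ z1 z2 Hr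
                (harmonic_on_opp _ _ _ _ open_unit_disk Hu)) as B2.
  apply Rabs_le. split; [ | exact B1].
  assert (- u z2 - - u z1 <= 4 / PI * r * hyperbolic_dist z1 z2); [ | lra].
  apply B2; auto. intros z Hz; rewrite Rabs_Ropp; auto.
Qed.

Lemma harmonic_growth (r : R) (u ux uy : C -> R) (z : C) :
  0 < r -> harmonic_on unit_disk u ux uy ->
  (forall z, unit_disk z -> Rabs (u z) < r) -> u (RtoC 0) = 0 ->
  unit_disk z -> Rabs (u z) <= 4 / PI * r * atan (Cmod z).
Proof.
  intros Hr Hu Hb H0 Hz.
  pose proof (harmonic_growth_upper r u ux uy z Hr Hu Hb H0 Hz) as B1.
  pose proof (harmonic_growth_upper r _ _ _ z Hr
                (harmonic_on_opp _ _ _ _ open_unit_disk Hu)) as B2.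
  apply Rabs_le. split; [ | exact B1].
  assert (- u z <= 4 / PI * r * atan (Cmod z)); [ | lra].
  apply B2; auto.
  - intros w Hw; rewrite Rabs_Ropp; auto.
  - rewrite H0; ring.
Qed.

Lemma harmonic_into_geodesic_estimates (D : C -> Prop) (rho : C -> R) (omega : C) (r : R)
    (gamma : C -> Prop) (f : C -> C) :
  harmonic_into_geodesic D rho omega r gamma f ->
  growth_estimate (4 / PI) D rho r f /\ gradient_estimate (4 / PI) rho r f /\
  distance_estimate (4 / PI) D rho r f.
Proof.
  intros [[HD _] Hrho _ Hr Hline Hdisk _ Hval Hf H0].
  destruct Hline as (I & g & g' & HI & _ & HP & Hreg & _ & Hg & HgD & Hlen).
  (* A parameter of [f z] is picked by choice; only its value for [z] in the disk is meaningful. *)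
  set (tau := fun z => epsilon (inhabits 0) (fun t => I t /\ g t = f z)).
  assert (Htau : forall z, unit_disk z -> I (tau z) /\ g (tau z) = f z).
  { intros z Hz. apply (epsilon_spec (inhabits 0) (fun t => I t /\ g t = f z)).
    apply Hg. now apply Hval. }
  assert (HDg : forall t, I t -> D (g t)).
  { intros t Ht. apply HgD, Hg. now exists t. }
  pose proof (coordinate_harmonic D rho f I g g' HD Hrho HI HP Hreg HDg Hlen Hf tau Htau) as Hu.
  pose proof (dist_coordinate D rho f I g g' HD Hrho HI HP Hreg HDg Hlen tau Htau) as Hdist.
  pose proof (operator_norm_differential D rho f I g g' HD Hrho HI HP Hreg HDg Hlen Hf tau Htau)
    as Hnorm.
  set (u := arclength_coordinate rho g g' tau) in *.
  assert (Hu0 : u (RtoC 0) = 0) by exact (RInt_point _ _).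
  pose proof unit_disk_0 as U0.
  (* The coordinate vanishes at [0], so [|u z|] is the distance from [f z] to [omega], which the
     geodesic disk bounds. *)
  assert (Hb : forall z, unit_disk z -> Rabs (u z) < r).
  { intros z Hz. rewrite <- (Rminus_0_r (u z)), <- Hu0, <- Hdist by assumption.
    rewrite (rho_dist_sym D rho HD Hrho), H0. apply Hdisk. now apply Hval. }
  assert (Hb' : forall z, unit_disk z -> Rabs (u z) <= r) by (intros z Hz; left; auto).
  refine (conj _ (conj _ _)).
  - intros z Hz. rewrite (rho_dist_sym D rho HD Hrho), Hdist by assumption.
    rewrite Hu0, Rminus_0_r. now apply harmonic_growth with (1 := Hr) (2 := Hu).
  - intros z Hz. apply Hnorm; [assumption | ]. intros h.
    apply Rle_trans with (1 := harmonic_gradient_bound r u _ _ Hr Hu Hb' z h Hz).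
    right. unfold Rdiv. ring.
  - intros z1 z2 H1 H2. rewrite Hdist by assumption.
    now apply harmonic_distance with (1 := Hr) (2 := Hu).
Qed.

(** * Sharpness *)

Lemma grad_on_C1 (W : C -> Prop) (u ux uy : C -> R) : open W ->
  grad_on W u ux uy -> Defs.C1_on W u.
Proof.
  intros HW Hu [x y] Hz. destruct (Hu x y Hz) as (H1 & H2 & _).
  assert (G : grad_on W u (Defs.Dx u) (Dy u)).
  { apply (grad_on_ext W u u ux uy); auto; intros z Hw; symmetry;
      now apply (grad_on_unique W u ux uy z). }
  destruct (G x y Hz) as (_ & _ & C1 & C2).
  refine (conj _ (conj _ (conj C1 C2))); eexists; [exact H1 | exact H2].
Qed.

Lemma grad_on_const (W : C -> Prop) (c : R) :
  grad_on W (fun _ => c) (fun _ => 0) (fun _ => 0).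
Proof.
  intros x y _; refine (conj _ (conj _ (conj _ _))).
  - auto_derive; auto.
  - auto_derive; auto.
  - apply continuous_const.
  - apply continuous_const.
Qed.

Lemma harmonic_on_C2 (W : C -> Prop) (u ux uy : C -> R) : open W ->
  harmonic_on W u ux uy ->
  C2_on W u /\ forall z, W z -> Defs.Dx (Defs.Dx u) z + Dy (Dy u) z = 0.
Proof.
  intros HW [Hu (uxx & uxy & uyx & uyy & Hux & Huy & HL)].
  assert (Gx : grad_on W (Defs.Dx u) uxx uxy).
  { apply (grad_on_ext W ux _ uxx uxy); auto; intros z Hw; symmetry;
      now apply (grad_on_unique W u ux uy z). }
  assert (Gy : grad_on W (Dy u) uyx uyy).
  { apply (grad_on_ext W uy _ uyx uyy); auto; intros z Hw; symmetry;
      now apply (grad_on_unique W u ux uy z). }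
  split.
  - refine (conj _ (conj _ _)); eapply grad_on_C1; eauto.
  - intros z Hz.
    rewrite (proj1 (grad_on_unique _ _ _ _ z Gx Hz)), (proj2 (grad_on_unique _ _ _ _ z Gy Hz)).
    now apply HL.
Qed.

Lemma harmonic_on_lin (W : C -> Prop) (c d : R) (u ux uy v vx vy : C -> R) :
  harmonic_on W u ux uy -> harmonic_on W v vx vy ->
  harmonic_on W (fun z => c * u z + d * v z) (fun z => c * ux z + d * vx z)
    (fun z => c * uy z + d * vy z).
Proof.
  intros [Hu (uxx & uxy & uyx & uyy & Hux & Huy & HL)].
  intros [Hv (vxx & vxy & vyx & vyy & Hvx & Hvy & HM)].
  split; [now apply grad_on_lin | ].
  do 4 eexists.
  refine (conj (grad_on_lin _ _ _ _ _ _ _ _ _ Hux Hvx)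
            (conj (grad_on_lin _ _ _ _ _ _ _ _ _ Huy Hvy) _)).
  intros z Hz; simpl. specialize (HL z Hz). specialize (HM z Hz).
  replace (uyy z) with (- uxx z) by lra. replace (vyy z) with (- vxx z) by lra. ring.
Qed.

(** The function is the argument of [1 + s y + i x]: the imaginary part of [log (1 + i z)] for
    [s = -1], and minus that of [log (1 - i z)] for [s = 1]. The real part of this number is
    positive on the disk. *)
Lemma harmonic_on_atan (s : R) : s * s = 1 ->
  harmonic_on unit_disk (fun z => atan (fst z / (1 + s * snd z)))
    (fun z => (1 + s * snd z) / ((1 + s * snd z) ^ 2 + fst z ^ 2))
    (fun z => - (s * fst z) / ((1 + s * snd z) ^ 2 + fst z ^ 2)).
Proof.
  intros Hs.
  assert (Hpos : forall x y, unit_disk (x, y) -> 0 < 1 + s * y).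
  { intros x y Hz. apply unit_disk_iff in Hz.
    assert (-1 < s * y) by nra. lra. }
  set (d := fun z : C => (1 + s * snd z) ^ 2 + fst z ^ 2).
  assert (Hd : forall x y, unit_disk (x, y) -> 0 < (1 + s * y) ^ 2 + x ^ 2).
  { intros x y Hz. specialize (Hpos x y Hz). nra. }
  split.
  - intros x y Hz. specialize (Hpos x y Hz). specialize (Hd x y Hz).
    simpl fst; simpl snd. refine (conj _ (conj _ (conj _ _))).
    + auto_derive; [lra | ]. unfold Rsqr. field. split; [nra | lra].
    + auto_derive; [lra | ]. unfold Rsqr. field. split; [nra | lra].
    + prove_continuous. simpl; lra.
    + prove_continuous. simpl; lra.
  - exists (fun z => - (2 * fst z * (1 + s * snd z)) / d z ^ 2),
      (fun z => s * (fst z ^ 2 - (1 + s * snd z) ^ 2) / d z ^ 2),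
      (fun z => s * (fst z ^ 2 - (1 + s * snd z) ^ 2) / d z ^ 2),
      (fun z => s * s * (2 * fst z * (1 + s * snd z)) / d z ^ 2).
    unfold d. refine (conj _ (conj _ _)).
    + intros x y Hz. specialize (Hd x y Hz).
      simpl fst; simpl snd. refine (conj _ (conj _ (conj _ _))).
      * auto_derive; [simpl in Hd; lra | field; nra].
      * auto_derive; [simpl in Hd; lra | field; nra].
      * prove_continuous. apply pow_nonzero; simpl fst; simpl snd; lra.
      * prove_continuous. apply pow_nonzero; simpl fst; simpl snd; lra.
    + intros x y Hz. specialize (Hd x y Hz).
      simpl fst; simpl snd. refine (conj _ (conj _ (conj _ _))).
      * auto_derive; [simpl in Hd; lra | field; nra].
      * auto_derive; [simpl in Hd; lra | field; nra].
      * prove_continuous. apply pow_nonzero; simpl fst; simpl snd; lra.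
      * prove_continuous. apply pow_nonzero; simpl fst; simpl snd; lra.
    + intros z _. rewrite Hs. unfold Rdiv. ring.
Qed.

(* Equal to [4 / PI * Re (arctan z)]: it maps the right and the left half of the unit
   circle to [1] and [-1]. *)
Definition extremal (z : C) : R :=
  2 / PI * atan (fst z / (1 + 1 * snd z)) + 2 / PI * atan (fst z / (1 + -1 * snd z)).

Lemma extremal_harmonic :
  exists ux uy, harmonic_on unit_disk extremal ux uy /\ ux (0, 0) = 4 / PI.
Proof.
  pose proof PI_RGT_0.
  do 2 eexists; split.
  - apply (harmonic_on_lin unit_disk (2 / PI) (2 / PI)); apply harmonic_on_atan; ring.
  - simpl. field. lra.
Qed.

(** For positive [p], the angles [atan p] and [atan (1 / p)] are complementary. In [extremal_bound]
    the product of the two tangents is [x^2 / (1 - y^2)], which is below [1] exactly inside the unit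
    circle. *)
Lemma atan_sum_lt (p q : R) : 0 < p -> p * q < 1 -> atan p + atan q < PI / 2.
Proof.
  intros Hp Hpq.
  assert (q < / p).
  { apply Rmult_lt_reg_l with p; [assumption | ]. rewrite Rinv_r; lra. }
  apply atan_increasing in H. rewrite atan_inv in H by assumption. lra.
Qed.

Lemma extremal_opp (x y : R) : extremal (- x, y) = - extremal (x, y).
Proof.
  unfold extremal; simpl fst; simpl snd.
  unfold Rdiv at 2 4. rewrite <- !Ropp_mult_distr_l, !atan_opp. unfold Rdiv. ring.
Qed.

Lemma extremal_bound (z : C) : unit_disk z -> -1 < extremal z < 1.
Proof.
  pose proof PI_RGT_0 as HPI.
  assert (W : forall x y, 0 <= x -> unit_disk (x, y) -> 0 <= extremal (x, y) < 1).
  { intros x y Hx Hz. apply unit_disk_iff in Hz.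
    assert (Hy : -1 < y < 1) by nra.
    assert (P1 : 0 <= x / (1 + 1 * y)) by (apply Rle_mult_inv_pos; lra).
    assert (P2 : 0 <= x / (1 + -1 * y)) by (apply Rle_mult_inv_pos; lra).
    assert (A : forall p, 0 <= p -> 0 <= atan p).
    { intros p [L | <-]; [ | rewrite atan_0; lra]. left. rewrite <- atan_0.
      now apply atan_increasing. }
    unfold extremal; simpl fst; simpl snd.
    assert (S : atan (x / (1 + 1 * y)) + atan (x / (1 + -1 * y)) < PI / 2).
    { destruct (Rle_lt_or_eq_dec _ _ Hx) as [L | <-].
      - apply atan_sum_lt; [apply Rdiv_lt_0_compat; lra | ].
        replace (x / (1 + 1 * y) * (x / (1 + -1 * y))) with (x ^ 2 / (1 - y ^ 2)).
        + apply Rlt_div_l; nra.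
        + field. repeat split; nra.
      - unfold Rdiv; rewrite !Rmult_0_l, atan_0. lra. }
    pose proof (A _ P1); pose proof (A _ P2).
    assert (H2 : 0 < 2 / PI) by (apply Rdiv_lt_0_compat; lra).
    split; [nra | ].
    rewrite <- Rmult_plus_distr_l.
    apply Rlt_le_trans with (2 / PI * (PI / 2)).
    - now apply Rmult_lt_compat_l.
    - right; field; lra. }
  destruct z as [x y]; intros Hz.
  destruct (Rle_dec 0 x) as [L | L].
  - specialize (W x y L Hz). lra.
  - assert (Hz' : unit_disk (- x, y)) by (apply unit_disk_iff in Hz; apply unit_disk_iff; nra).
    specialize (W (- x) y ltac:(lra) Hz'). rewrite extremal_opp in W. lra.
Qed.

Lemma extremal_real (x : R) : extremal (x, 0) = 4 / PI * atan x.
Proof.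
  unfold extremal; simpl fst; simpl snd.
  rewrite !Rmult_0_r, !Rplus_0_r, !Rdiv_1_r. unfold Rdiv; ring.
Qed.

(** * The Euclidean plane and a real segment as target *)

Definition plane (w : C) : Prop := True.
Definition euclidean (w : C) : R := 1.

Lemma open_plane : open plane.
Proof. intros z _. now apply filter_forall. Qed.

(* If [A] and [B] were disjoint, the indicator function of [A] along a segment from [A] to [B]
   would have derivative [0] everywhere. *)
Lemma domain_plane : Defs.domain plane.
Proof.
  split; [apply open_plane | split; [now exists (RtoC 0) | ]].
  intros A B HA HB HAB (p & _ & Hp) (q & _ & Hq).
  apply NNPP; intros HN.
  assert (Hdisj : forall w, A w -> B w -> False).
  { intros w HAw HBw. apply HN. now exists w. }
  set (seg := fun t : R => (fst p + t * (fst q - fst p), snd p + t * (snd q - snd p)) : C).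
  assert (Cseg : forall t, continuous seg t).
  { intros t. apply continuous_pair_C; prove_continuous; apply continuous_id. }
  set (k := fun t => if excluded_middle_informative (A (seg t)) then 0 else 1).
  assert (Dk : forall t, is_derive k t 0).
  { intros t.
    assert (HL : locally t (fun s => k s = k t)).
    { unfold k at 2. destruct (excluded_middle_informative (A (seg t))) as [Y | N].
      - generalize (Cseg t A (HA _ Y)). unfold filtermap; apply filter_imp.
        intros s Hs. unfold k. now destruct excluded_middle_informative.
      - assert (Y : B (seg t)) by (destruct (HAB (seg t) I); tauto).
        generalize (Cseg t B (HB _ Y)). unfold filtermap; apply filter_imp.
        intros s Hs. unfold k. destruct excluded_middle_informative as [Y' | _]; [ | reflexivity].
        exfalso; now apply (Hdisj (seg s)). }
    apply is_derive_ext_loc with (fun _ => k t).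
    - revert HL; apply filter_imp; auto.
    - apply (is_derive_const (k t)). }
  assert (E : k 1 = k 0).
  { apply is_derive_0_constant with (fun _ => 0); auto; lra. }
  unfold k in E.
  replace (seg 0) with p in E
    by (unfold seg; apply injective_projections; simpl; ring).
  replace (seg 1) with q in E
    by (unfold seg; apply injective_projections; simpl; ring).
  destruct (excluded_middle_informative (A q)) as [Y | _]; [now apply (Hdisj q) | ].
  destruct (excluded_middle_informative (A p)); [lra | tauto].
Qed.

Lemma euclidean_metric : conformal_metric plane euclidean.
Proof.
  split.
  - intros; unfold euclidean; lra.
  - apply grad_on_C1 with (fun _ => 0) (fun _ => 0); [apply open_plane | ].
    apply grad_on_const.
Qed.

(** The speed dominates the derivative of the real part. Displacement in the real direction is the
    quantity needed, as the test geodesic lies on the real axis. *)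
Lemma euclidean_length_lower (w1 w2 : C) (l : R) :
  curve_length plane euclidean w1 w2 l -> fst w2 - fst w1 <= l.
Proof.
  intros H; induction H as [g g' a b Hab HP _ | w1 w2 w3 l1 l2 _ IH1 _ IH2]; [ | lra].
  set (v := fun t => euclidean (g t) * Cmod (g' t)).
  assert (Cv : forall t, interval a b t -> cont_in (interval a b) v t).
  { intros t Ht. now apply (speed_cont_in plane euclidean open_plane euclidean_metric _ g g'). }
  set (V := fun t => RInt (fun s => v (clamp a b s)) a t).
  assert (Cc : forall t, continuous (fun s => v (clamp a b s)) t).
  { intros t. apply continuous_clamp; [lra | assumption]. }
  assert (DV : forall t, is_derive V t (v (clamp a b t))).
  { intros t. apply (is_derive_RInt (fun s => v (clamp a b s)) V a t); [ | apply Cc].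
    apply filter_forall. intros s. apply (RInt_correct (fun s => v (clamp a b s))).
    apply (ex_RInt_continuous (V := R_CompleteNormedModule)); auto. }
  set (G := fun t => fst (g (clamp a b t))).
  assert (CG : forall t, continuous G t).
  { intros t. apply (continuous_clamp R_UniformSpace (fun s => fst (g s))); [lra | ].
    intros s Hs. destruct (C1_path_deriv _ g g' s HP Hs) as [D1 _].
    apply (deriv_in_cont _ _ _ _ D1). }
  assert (DG : forall t, a < t < b -> is_derive G t (fst (g' t))).
  { intros t Ht.
    assert (HL : locally t (fun s => a < s < b)).
    { apply (open_and (fun s => a < s) (fun s => s < b)); auto;
        [apply open_gt | apply open_lt]. }
    apply is_derive_ext_loc with (fun s => fst (g s)).
    - revert HL; apply filter_imp; intros s Hs. unfold G. rewrite clamp_id; [reflexivity | lra].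
    - apply deriv_in_is_derive with (interval a b).
      + revert HL; apply filter_imp; intros s Hs. unfold interval; lra.
      + apply (C1_path_deriv _ g g' t HP). unfold interval; lra. }
  destruct (MVT_gen (fun t => V t - G t) a b (fun t => v t - fst (g' t))) as [c [Hc E]].
  - intros t Ht. rewrite Rmin_left, Rmax_right in Ht by lra.
    apply (is_derive_minus V G); [ | now apply DG].
    rewrite <- (clamp_id a b t) at 2 by lra. apply DV.
  - intros t _. apply continuity_pt_filterlim.
    apply (continuous_minus V G); [ | apply CG].
    apply (ex_derive_continuous (V := R_NormedModule)). eexists; apply DV.
  - assert (Hvc : 0 <= v c - fst (g' c)).
    { unfold v, euclidean. pose proof (re_le_Cmod (g' c)) as B. unfold Re in B.
      pose proof (Rle_abs (fst (g' c))). lra. }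
    assert (EV : V b = rho_length euclidean g g' a b).
    { apply RInt_ext. intros t Ht. rewrite Rmin_left, Rmax_right in Ht by lra.
      now rewrite clamp_id by lra. }
    assert (EVa : V a = 0) by exact (RInt_point _ _).
    unfold G in E. rewrite !clamp_id in E by lra. rewrite EV, EVa in E. nra.
Qed.

Lemma euclidean_dist_upper (w1 w2 : C) : rho_dist plane euclidean w1 w2 <= Cmod (w2 - w1).
Proof.
  rewrite <- (Rmult_1_l (Cmod (w2 - w1))).
  apply (rho_dist_segment plane euclidean open_plane euclidean_metric).
  intros t _; split; [exact I | unfold euclidean; lra].
Qed.

(** Guarantees a finite infimum: with no connecting curve the infimum would be plus infinity, and
    [real] would turn it into [0]. *)
Lemma euclidean_curve_exists (w1 w2 : C) : exists l, curve_length plane euclidean w1 w2 l.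
Proof.
  set (g := fun t : R => (fst w1 + t * (fst w2 - fst w1), snd w1 + t * (snd w2 - snd w1)) : C).
  assert (P : curve_length plane euclidean (g 0) (g 1)
                (rho_length euclidean g (fun _ => (w2 - w1)%C) 0 1)).
  { apply curve_piece; [lra | | intros; exact I].
    apply C1_path_intro. intros t _.
    refine (conj _ (conj _ (conj _ _))).
    - apply is_derive_deriv_in. unfold g; simpl. auto_derive; auto; ring.
    - apply is_derive_deriv_in. unfold g; simpl. auto_derive; auto; ring.
    - apply filterlim_const.
    - apply filterlim_const. }
  replace (g 0) with w1 in P by (unfold g; apply injective_projections; simpl; ring).
  replace (g 1) with w2 in P by (unfold g; apply injective_projections; simpl; ring).
  eexists; exact P.
Qed.

Lemma euclidean_dist_lower (w1 w2 : C) : fst w2 - fst w1 <= rho_dist plane euclidean w1 w2.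
Proof.
  unfold rho_dist.
  destruct (Glb_Rbar_correct (curve_length plane euclidean w1 w2)) as [Hlb Hglb].
  destruct (euclidean_curve_exists w1 w2) as [l Hl].
  specialize (Hlb l Hl).
  assert (B : Rbar_le (fst w2 - fst w1) (Glb_Rbar (curve_length plane euclidean w1 w2))).
  { apply Hglb. intros x Hx. now apply (euclidean_length_lower w1 w2). }
  destruct (Glb_Rbar (curve_length plane euclidean w1 w2)); simpl in *; tauto.
Qed.

Definition real_segment (w : C) : Prop := -1 < fst w < 1 /\ snd w = 0.

Lemma real_segment_geodesic : geodesic_line plane euclidean real_segment.
Proof.
  exists (fun t => -1 < t < 1), (fun t => (t, 0)), (fun _ => (1, 0)).
  refine (conj _ (conj _ (conj _ (conj _ (conj _ (conj _ (conj _ _))))))).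
  - intros a b x Ha Hb Hx; lra.
  - exists 0, (1 / 2); lra.
  - apply C1_path_intro. intros t _. refine (conj _ (conj _ (conj _ _))).
    + apply is_derive_deriv_in. simpl. auto_derive; auto.
    + apply is_derive_deriv_in. simpl. auto_derive; auto.
    + apply filterlim_const.
    + apply filterlim_const.
  - intros t _ E. injection E; lra.
  - intros s t _ _ E. now injection E.
  - intros w; split.
    + intros [Hw E]. exists (fst w); split; [assumption | ]. rewrite <- E.
      symmetry; apply surjective_pairing.
    + intros (t & Ht & <-). now split.
  - intros w _; exact I.
  - intros s t _ _ Hst.
    assert (E : rho_length euclidean (fun t => (t, 0)) (fun _ => (1, 0)) s t = t - s).
    { unfold rho_length, euclidean. rewrite RInt_const.
      pose proof Cmod_1 as N; unfold RtoC in N. rewrite N.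
      unfold scal; simpl; unfold mult; simpl. ring. }
    rewrite E. apply Rle_antisym.
    + apply Rle_trans with (1 := euclidean_dist_upper _ _).
      replace ((t, 0) - (s, 0))%C with (RtoC (t - s))
        by (apply injective_projections; simpl; ring).
      rewrite Cmod_R, Rabs_right; lra.
    + apply (euclidean_dist_lower (s, 0) (t, 0)).
Qed.

Definition extremal_map (z : C) : C := (extremal z, 0).

Lemma extremal_map_harmonic_into_geodesic :
  harmonic_into_geodesic plane euclidean (RtoC 0) 1 real_segment extremal_map.
Proof.
  destruct extremal_harmonic as (ux & uy & Hh & _).
  destruct (harmonic_on_C2 _ _ _ _ open_unit_disk Hh) as [HC HL].
  assert (H0 : harmonic_on unit_disk (fun _ => 0) (fun _ => 0) (fun _ => 0)).
  { split; [apply grad_on_const | ].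
    exists (fun _ => 0), (fun _ => 0), (fun _ => 0), (fun _ => 0).
    split; [apply grad_on_const | split; [apply grad_on_const | ]].
    intros; ring. }
  destruct (harmonic_on_C2 _ _ _ _ open_unit_disk H0) as [HC0 HL0].
  assert (HCf : C2_map_on unit_disk extremal_map) by (split; assumption).
  constructor.
  - apply domain_plane.
  - apply euclidean_metric.
  - exact I.
  - lra.
  - apply real_segment_geodesic.
  - intros w [Hw E]. split; [exact I | ].
    apply Rle_lt_trans with (1 := euclidean_dist_upper _ _).
    destruct w as [x y]; simpl in Hw, E; subst y.
    replace (RtoC 0 - (x, 0))%C with (RtoC (- x))
      by (apply injective_projections; simpl; ring).
    rewrite Cmod_R. apply Rabs_lt_between; lra.
  - split; simpl; [lra | reflexivity].
  - intros z Hz. split; [now apply extremal_bound | reflexivity].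
  - refine (conj _ (conj HCf _)); [intros; exact I | ].
    intros z Hz.
    rewrite (wirtinger_laplacian extremal_map z HCf Hz).
    rewrite (wirtinger_log_square plane euclidean _ euclidean_metric I).
    destruct (grad_on_unique plane euclidean _ _ (extremal_map z) (grad_on_const plane 1) I)
      as [E1 E2].
    rewrite E1, E2.
    pose proof (HL z Hz) as L1. pose proof (HL0 z Hz) as L0.
    change (fun w => Re (extremal_map w)) with extremal.
    change (fun w => Im (extremal_map w)) with (fun _ : C => 0).
    rewrite L1, L0. unfold Rdiv. rewrite !Rmult_0_l, Ropp_0.
    change ((0, 0) : C) with (RtoC 0). ring.
  - unfold extremal_map. change (RtoC 0) with ((0, 0) : C). rewrite extremal_real, atan_0.
    now rewrite Rmult_0_r.
Qed.

Lemma extremal_dist (x : R) : 4 / PI * atan x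
  <= rho_dist plane euclidean (extremal_map (RtoC 0)) (extremal_map (x, 0)).
Proof.
  eapply Rle_trans; [ | apply euclidean_dist_lower].
  unfold extremal_map; simpl fst. change (RtoC 0) with ((0, 0) : C).
  rewrite !extremal_real, atan_0. lra.
Qed.

(** The direction [1] attains [4 / PI]. The supremum must also be shown finite, since [real] would
    send an infinite one to [0]. *)
Lemma extremal_operator_norm :
  4 / PI <= operator_norm (Defs.differential extremal_map (RtoC 0)).
Proof.
  destruct extremal_harmonic as (ux & uy & [Hu _] & E0).
  destruct (grad_on_unique unit_disk extremal ux uy (0, 0) Hu unit_disk_0) as [E1 _].
  pose proof PI_RGT_0.
  assert (Hp : 0 < 4 / PI) by (apply Rdiv_lt_0_compat; lra).
  assert (EX : CDx extremal_map (RtoC 0) = RtoC (4 / PI)).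
  { unfold CDx. apply injective_projections; simpl.
    - rewrite <- E0, <- E1. reflexivity.
    - exact (Derive_const 0 0). }
  set (L := Defs.differential extremal_map (RtoC 0)).
  assert (E2 : Cmod (L (RtoC 1)) = 4 / PI).
  { unfold L, Defs.differential. rewrite EX.
    replace (RtoC (Re (RtoC 1)) * RtoC (4 / PI)
             + RtoC (Im (RtoC 1)) * CDy extremal_map (RtoC 0))%C with (RtoC (4 / PI))
      by (apply injective_projections; simpl; ring).
    rewrite Cmod_R, Rabs_right; lra. }
  assert (Hbd : forall h, Cmod h <= 1 ->
    Cmod (L h) <= 4 / PI + Cmod (CDy extremal_map (RtoC 0))).
  { intros h Hh. unfold L, Defs.differential. rewrite EX.
    apply Rle_trans with (1 := Cmod_triangle _ _). rewrite !Cmod_mult, !Cmod_R.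
    rewrite (Rabs_right (4 / PI)) by lra.
    pose proof (Rmax_Cmod h) as M.
    pose proof (Rmax_l (Rabs (fst h)) (Rabs (snd h))).
    pose proof (Rmax_r (Rabs (fst h)) (Rabs (snd h))).
    pose proof (Cmod_ge_0 (CDy extremal_map (RtoC 0))).
    unfold Re, Im. nra. }
  unfold operator_norm.
  set (E := fun s => exists h, Cmod h <= 1 /\ s = Cmod (L h)).
  destruct (Lub_Rbar_correct E) as [Hub Hlub].
  assert (Hge : Rbar_le (4 / PI) (Lub_Rbar E)).
  { apply Hub. exists (RtoC 1). rewrite Cmod_1. split; [lra | now rewrite E2]. }
  assert (Hle : Rbar_le (Lub_Rbar E) (4 / PI + Cmod (CDy extremal_map (RtoC 0)))).
  { apply Hlub. intros s (h & Hh & ->). now apply Hbd. }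
  destruct (Lub_Rbar E); simpl in *; tauto.
Qed.

(** Both functions have slope [1] at [0], so the difference starts with slope [k - c > 0]. The
    distance estimate is thus tested on pairs of points close to each other. *)
Lemma atan_exceeds_artanh (c k : R) : c < k ->
  exists x, 0 < x < 1 /\ c * artanh x < k * atan x.
Proof.
  intros Hc.
  assert (D : is_derive (fun x => k * atan x - c * artanh x) 0 (k - c)).
  { replace (k - c) with (k * / (1 + 0²) - c * / (1 - 0 ^ 2)) by (unfold Rsqr; field).
    apply (is_derive_minus (fun x => k * atan x) (fun x => c * artanh x)).
    - apply (is_derive_scal atan), is_derive_atan.
    - apply (is_derive_scal artanh), is_derive_artanh. lra. }
  apply is_derive_Reals in D.
  destruct (D (k - c) ltac:(lra)) as [d Hd].
  pose proof (cond_pos d) as Hdp.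
  set (x := Rmin (d / 2) (1 / 2)).
  assert (Hx : 0 < x) by (apply Rmin_glb_lt; lra).
  assert (Hx1 : x <= d / 2) by apply Rmin_l.
  assert (Hx2 : x <= 1 / 2) by apply Rmin_r.
  exists x; split; [lra | ].
  specialize (Hd x ltac:(lra)). rewrite Rabs_right in Hd by lra. specialize (Hd ltac:(lra)).
  rewrite Rplus_0_l, atan_0, artanh_0 in Hd.
  apply Rabs_lt_between in Hd.
  assert (P : 0 < (k * atan x - c * artanh x - (k * 0 - c * 0)) / x) by lra.
  apply (Rmult_lt_compat_r x) in P; [ | assumption].
  rewrite Rmult_0_l in P.
  replace ((k * atan x - c * artanh x - (k * 0 - c * 0)) / x * x)
    with (k * atan x - c * artanh x) in P by (field; lra).
  lra.
Qed.

Lemma unit_disk_real (x : R) : 0 <= x < 1 -> unit_disk (x, 0) /\ Cmod (x, 0) = x.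
Proof.
  intros Hx. assert (E : Cmod (x, 0) = x).
  { change ((x, 0) : C) with (RtoC x). rewrite Cmod_R, Rabs_right; lra. }
  split; [ | exact E]. unfold unit_disk. lra.
Qed.

Theorem theorem1p1 :
  (forall (D : C -> Prop) (rho : C -> R) (omega : C) (r : R)
          (gamma : C -> Prop) (f : C -> C),
     harmonic_into_geodesic D rho omega r gamma f ->
     growth_estimate (4 / PI) D rho r f /\
     gradient_estimate (4 / PI) rho r f /\
     distance_estimate (4 / PI) D rho r f) /\
  (forall c : R, c < 4 / PI ->
     ~ (forall (D : C -> Prop) (rho : C -> R) (omega : C) (r : R)
               (gamma : C -> Prop) (f : C -> C),
          harmonic_into_geodesic D rho omega r gamma f ->
          growth_estimate c D rho r f)) /\
  (forall c : R, c < 4 / PI ->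
     ~ (forall (D : C -> Prop) (rho : C -> R) (omega : C) (r : R)
               (gamma : C -> Prop) (f : C -> C),
          harmonic_into_geodesic D rho omega r gamma f ->
          gradient_estimate c rho r f)) /\
  (forall c : R, c < 4 / PI ->
     ~ (forall (D : C -> Prop) (rho : C -> R) (omega : C) (r : R)
               (gamma : C -> Prop) (f : C -> C),
          harmonic_into_geodesic D rho omega r gamma f ->
          distance_estimate c D rho r f)).
Proof.
  pose proof extremal_map_harmonic_into_geodesic as HE.
  refine (conj harmonic_into_geodesic_estimates (conj _ (conj _ _))); intros c Hc H;
    specialize (H _ _ _ _ _ _ HE).
  (* On the positive real axis the extremal map attains equality in the growth estimate; [1 / 2] is
     an arbitrary point of it. *)
  - destruct (unit_disk_real (1 / 2) ltac:(lra)) as [Hz Ez].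
    specialize (H _ Hz).
    rewrite (rho_dist_sym plane euclidean open_plane euclidean_metric), Ez in H.
    pose proof (extremal_dist (1 / 2)).
    pose proof (atan_increasing 0 (1 / 2) ltac:(lra)) as A. rewrite atan_0 in A. nra.
  (* At the origin the cosine in the Schwarz-Pick inequality is [1], and the extremal map attains
     the gradient bound. *)
  - specialize (H _ unit_disk_0). rewrite Cmod_0 in H.
    pose proof extremal_operator_norm. unfold euclidean in H.
    replace (1 / (1 - 0 ^ 2)) with 1 in H by field. lra.
  - destruct (atan_exceeds_artanh c (4 / PI) Hc) as (x & Hx & A).
    destruct (unit_disk_real x ltac:(lra)) as [Hz Ez].
    specialize (H _ _ unit_disk_0 Hz).
    pose proof (extremal_dist x).
    assert (E : hyperbolic_dist (RtoC 0) (x, 0) = artanh x).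
    { unfold hyperbolic_dist. f_equal. transitivity (Cmod (x, 0)); [ | exact Ez].
      rewrite <- (Cmod_opp (x, 0)).
      f_equal. apply injective_projections; simpl; field. }
    rewrite E in H. lra.
Qed.
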